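(* Let $1<p<\infty$ and $1/p+1/q=1$. A smooth interpolation curve network $F^*=\{f_e^*\}_{e\in E}\in\mathcal{C}_p(E)$ is a solution to the extremal problem $(P_p)$, i.e. satisfies $$\|F^{*\prime\prime}\|_p=\inf_{F\in\mathcal{C}_p(E)}\|F''\|_p ,$$ if and only if there exist real numbers $\alpha_{is}$, $is\in N_B$, such that $$F^{*\prime\prime}=\Bigl(\sum_{is\in N_B}\alpha_{is}B_{is}\Bigr)^{q-1}_{\pm}$$ (equality almost everywhere on every edge of $E$).
   Context: Data and triangulation. Let $n\ge 3$ and let $P_i=(x_i,y_i,z_i)\in\mathbb{R}^3$, $i=1,\dots,n$, be points whose projections $V_i=(x_i,y_i)\in\mathbb{R}^2$ are pairwise different and not all on one line. A triangulation of $V_1,\dots,V_n$ is a collection of non-degenerate, non-overlapping triangles in the plane (two distinct triangles intersect, if at all, only in a common vertex or a common full edge) such that the set of all vertices of the triangles is exactly $\{V_1,\dots,V_n\}$. A triangulation $T$ is fixed. $D\subset\mathbb{R}^2$ is the union of the (closed) triangles of $T$ (in general a collection of polygons with holes), and $E$ is the set of edges of the triangles of $T$. The edge between $V_i$ and $V_j$ is denoted $e_{ij}$ or $e$, and $\|e\|$ is its Euclidean length. Curve networks. A curve network is a family $\{f_e\}_{e\in E}$ of real-valued univariate functions, $f_e$ being defined on the edge $e$, i.e. on $[0,\|e\|]$ via the arc-length parametrization of $e$. A function $F:D\to\mathbb{R}$ induces the curve network given for $e=e_{ij}$ by $$f_e(t)=F\Bigl(\bigl(1-\tfrac{t}{\|e\|}\bigr)x_i+\tfrac{t}{\|e\|}x_j,\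 \bigl(1-\tfrac{t}{\|e\|}\bigr)y_i+\tfrac{t}{\|e\|}y_j\Bigr),\quad 0\le t\le\|e\| .$$ The direction in which an edge is parametrized is immaterial (networks are compared as functions on the edges themselves). Smooth interpolation curve networks. $\mathcal{F}_p$ is the set of functions $F:D\to\mathbb{R}$ with $F(x_i,y_i)=z_i$ for $i=1,\dots,n$, with $\partial F/\partial x,\ \partial F/\partial y\in C(D)$ (i.e. $F$ is differentiable relative to $D$ with gradient continuous on $D$), and such that for every $e\in E$ the function $f_e'$ is absolutely continuous on $[0,\|e\|]$ and $f_e''\in L_p[0,\|e\|]$. $\mathcal{C}_p(E)$ is the set of curve networks $\{f_e\}_{e\in E}$ induced on $E$ by functions $F\in\mathcal{F}_p$. Geometrically, the smoothness of such a network means that at every vertex $V_i$ the graphs of the $f_e$, for the edges $e$ incident to $V_i$, have a common tangent plane: there is $(a_i,b_i)\in\mathbb{R}^2$ such that for every edge $e$ at $V_i$ with unit direction vector $(u,v)$ pointing away from $V_i$, the derivative of $f_e$ at $V_i$ in that direction equals $a_iu+b_iv$. For a network $F=\{f_e\}_{e\in E}$, $F''=\{f_e''\}_{e\in E}$, and for a network $G=\{g_e\}_{e\in E}$, $\|G\|_p=\bigl(\sum_{e\in E}\int_0^{\|e\|}|g_e(t)|^p\,dt\bigr)^{1/p}$. Basic curve networks. Let $m_i$ be the number of edges of $E$ incident to $V_i$, and let $e_{ii_1},\dots,e_{ii_{m_i}}$ be these edges listed in clockwise order around $V_i$. For $s=1,\dots,m_i-2$, the coefficients $\lambda^{(s)}_{1,i},\lambda^{(s)}_{2,i},\lambda^{(s)}_{3,i}$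 are the unique real numbers with sum $1$ such that $\sum_{r=1}^3\lambda^{(s)}_{r,i}u_r=0$, where $u_r$ is the unit vector starting at $V_i$ along the edge $e_{ii_{s+r-1}}$. The first edge $e_{ii_1}$ is chosen so that $\lambda^{(s)}_{1,i}\ne 0$ for $s=1,\dots,m_i-2$ (this is always possible). Put $N_B=\{is : m_i\ge 3,\ i=1,\dots,n,\ s=1,\dots,m_i-2\}$ (here $is$ denotes the pair of indices $(i,s)$). For $is\in N_B$ the basic curve network $B_{is}$ is defined by $$B_{is}=\lambda^{(s)}_{r,i}\Bigl(1-\frac{t}{\|e_{ii_{s+r-1}}\|}\Bigr)\ \text{ on } e_{ii_{s+r-1}},\ r=1,2,3,\ 0\le t\le\|e_{ii_{s+r-1}}\|,$$ where $t$ is the distance from $V_i$ along the edge, and $B_{is}=0$ on all other edges of $E$. Notation: $(x)^r_{\pm}=|x|^r\operatorname{sign}(x)$ for real $x,r$, applied pointwise to networks. *)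

(* Defs.v *)
From HB Require Import structures.
From mathcomp Require Import all_boot all_order all_algebra.
From mathcomp Require Import all_classical all_reals all_analysis.
Import Order.TTheory GRing.Theory Num.Theory.
Import numFieldNormedType.Exports.
Set Implicit Arguments.
Unset Strict Implicit.
Unset Printing Implicit Defensive.
Local Open Scope classical_set_scope.
Local Open Scope ring_scope.

(* Euclidean distance; the library norm on [R * R] is the max norm. *)
Definition eucl_dist (R : realType) (v w : R * R) : R :=
  Num.sqrt ((w.1 - v.1) ^+ 2 + (w.2 - v.2) ^+ 2).

Definition collinear (R : realType) (n : nat) (V : 'I_n -> R * R)
    (A : {set 'I_n}) : Prop :=
  exists a b c : R, (a != 0) || (b != 0) /\
    forall i, i \in A -> a * (V i).1 + b * (V i).2 = c.

(* Closed convex hull of the points V i, i in A. *)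
Definition hull (R : realType) (n : nat) (V : 'I_n -> R * R)
    (A : {set 'I_n}) : set (R * R) :=
  [set v | exists c : 'I_n -> R,
    [/\ forall i, i \in A -> 0 <= c i,
        \sum_(i in A) c i = 1 &
        v = (\sum_(i in A) c i * (V i).1, \sum_(i in A) c i * (V i).2)]].

(* A triangle is given by the set of indices of its three vertices. *)
Definition triangulation (R : realType) (n : nat) (V : 'I_n -> R * R)
    (T : {set {set 'I_n}}) : Prop :=
  [/\ forall s, s \in T -> #|s| = 3%N /\ ~ collinear V s,
      forall s t, s \in T -> t \in T -> s != t ->
        [\/ hull V s `&` hull V t = set0,
            exists2 i, i \in s :&: t & hull V s `&` hull V t = [set V i] |
            exists i j, [/\ i != j, i \in s :&: t, j \in s :&: t &
                            hull V s `&` hull V t = hull V [set i; j]%SET]] &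
      (\bigcup_(s in T) s)%SET = [set: 'I_n]%SET].

Definition domain (R : realType) (n : nat) (V : 'I_n -> R * R)
    (T : {set {set 'I_n}}) : set (R * R) :=
  [set v | exists2 s, s \in T & hull V s v].

(* The edge between V i and V j is represented by the pair (i, j) with i < j,
   and is parametrized by arc length starting from V i. *)
Definition edge (n : nat) (i j : 'I_n) : 'I_n * 'I_n :=
  if (i < j)%N then (i, j) else (j, i).

Definition edges (n : nat) (T : {set {set 'I_n}}) : {set 'I_n * 'I_n} :=
  [set e : 'I_n * 'I_n | (e.1 < e.2)%N &&
     [exists s in T, (e.1 \in s) && (e.2 \in s)]]%SET.

Definition edge_length (R : realType) (n : nat) (V : 'I_n -> R * R)
    (e : 'I_n * 'I_n) : R := eucl_dist (V e.1) (V e.2).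

Definition neighbours (n : nat) (T : {set {set 'I_n}}) (i : 'I_n) :
    {set 'I_n} := [set j | edge i j \in edges T]%SET.

Definition degree (n : nat) (T : {set {set 'I_n}}) (i : 'I_n) : nat :=
  #|neighbours T i|.

(* Only the values of [f e] for e in [edges T] and on [0, edge_length V e]
   are meaningful. *)
Definition network (R : realType) (n : nat) := 'I_n * 'I_n -> R -> R.

Definition induced_network (R : realType) (n : nat) (V : 'I_n -> R * R)
    (F : R * R -> R) : network R n :=
  fun e t => let L := edge_length V e in
    F ((1 - t / L) * (V e.1).1 + t / L * (V e.2).1,
       (1 - t / L) * (V e.1).2 + t / L * (V e.2).2).

(* [g] is the derivative of [f] on [a, b], one-sided at the endpoints. *)
Definition derivative_on (R : realType) (a b : R) (f g : R -> R) : Prop :=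
  forall t, a <= t <= b ->
    (fun s => (f s - f t) / (s - t)) @ within `[a, b]%classic t^' --> g t.

Definition abs_continuous (R : realType) (a b : R) (g : R -> R) : Prop :=
  forall eps : R, 0 < eps -> exists2 delta : R, 0 < delta &
    forall (m : nat) (c d : 'I_m -> R),
      (forall k, a <= c k /\ c k <= d k /\ d k <= b) ->
      trivIset [set: 'I_m] (fun k => `]c k, d k[%classic) ->
      \sum_(k < m) (d k - c k) < delta ->
      \sum_(k < m) `|g (d k) - g (c k)| < eps.

(* On the open edges this depends only on the values on the edges.  Where
   f_e'' does not exist, and possibly at the two endpoints, the value is
   irrelevant: it is only used up to null sets. *)
Definition second_derivative (R : realType) (n : nat) (f : network R n) :
    network R n := fun e => derive1 (derive1 (f e)).

(* [G] is the gradient of [F] relative to [D]. *)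
Definition gradient_on (R : realType) (D : set (R * R)) (F : R * R -> R)
    (G : R * R -> R * R) : Prop :=
  forall w, D w ->
    (fun v => (F v - F w - ((G w).1 * (v.1 - w.1) + (G w).2 * (v.2 - w.2)))
              / eucl_dist w v) @ within D w^' --> (0 : R).

Definition smooth_interpolant (R : realType) (n : nat) (V : 'I_n -> R * R)
    (z : 'I_n -> R) (T : {set {set 'I_n}}) (p : R) (F : R * R -> R) : Prop :=
  [/\ forall i, F (V i) = z i,
      exists2 G : R * R -> R * R, gradient_on (domain V T) F G &
        {within domain V T, continuous G} &
      forall e, e \in edges T ->
        let L := edge_length V e in
        (exists2 g : R -> R, derivative_on 0 L (induced_network V F e) g &
           abs_continuous 0 L g) /\
        second_derivative (induced_network V F) e \_ `[0, L]%classic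
          \in Lfun (@lebesgue_measure R) p%:E].

Definition smooth_network (R : realType) (n : nat) (V : 'I_n -> R * R)
    (z : 'I_n -> R) (T : {set {set 'I_n}}) (p : R) : set (network R n) :=
  [set f | exists2 F, smooth_interpolant V z T p F &
    forall e t, e \in edges T -> 0 <= t <= edge_length V e ->
      f e t = induced_network V F e t].

Definition network_norm (R : realType) (n : nat) (V : 'I_n -> R * R)
    (T : {set {set 'I_n}}) (p : R) (g : network R n) : \bar R :=
  ((\sum_(e in edges T)
     \int[@lebesgue_measure R]_(t in `[0%R, edge_length V e]%classic)
       (`|g e t| `^ p)%:E) `^ p^-1)%E.

(* [nb i] lists the other endpoints of the edges at V i in clockwise order,
   i.e. the polar angles [theta] of these edges decrease along the list,
   within less than one full turn. *)
Definition clockwise_listing (R : realType) (n : nat) (V : 'I_n -> R * R)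
    (T : {set {set 'I_n}}) (nb : 'I_n -> seq 'I_n) : Prop :=
  forall i, perm_eq (nb i) (enum (neighbours T i)) /\
    exists theta : 'I_n -> R,
      (forall j, j \in nb i ->
         (V j).1 - (V i).1 = eucl_dist (V i) (V j) * cos (theta j) /\
         (V j).2 - (V i).2 = eucl_dist (V i) (V j) * sin (theta j)) /\
      pairwise (fun j k => theta k < theta j < theta k + 2 * pi) (nb i).

Definition unit_dir (R : realType) (n : nat) (V : 'I_n -> R * R)
    (i j : 'I_n) : R * R :=
  (((V j).1 - (V i).1) / eucl_dist (V i) (V j),
   ((V j).2 - (V i).2) / eucl_dist (V i) (V j)).

(* Indices are 0-based: s < degree T i - 2 and r < 3, so that the edges
   involved are those towards entries s, s + 1, s + 2 of [nb i]. *)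
Definition nb_vertex (n : nat) (nb : 'I_n -> seq 'I_n) (i : 'I_n) (s r : nat) :
    'I_n := nth i (nb i) (s + r).

(* The unique triple satisfying the conditions; it exists because the three
   unit vectors are pairwise different. *)
Definition lambda (R : realType) (n : nat) (V : 'I_n -> R * R)
    (nb : 'I_n -> seq 'I_n) (i : 'I_n) (s : nat) : 'I_3 -> R :=
  get [set l : 'I_3 -> R |
    [/\ \sum_(r < 3) l r = 1,
        \sum_(r < 3) l r * (unit_dir V i (nb_vertex nb i s r)).1 = 0 &
        \sum_(r < 3) l r * (unit_dir V i (nb_vertex nb i s r)).2 = 0]].

Definition admissible_first_edges (R : realType) (n : nat) (V : 'I_n -> R * R)
    (T : {set {set 'I_n}}) (nb : 'I_n -> seq 'I_n) : Prop :=
  forall i s, (s < degree T i - 2)%N -> lambda V nb i s ord0 != 0.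

(* Distance from the endpoint V i of [e] to the point of parameter [t]. *)
Definition dist_from (R : realType) (n : nat) (V : 'I_n -> R * R) (i : 'I_n)
    (e : 'I_n * 'I_n) (t : R) : R :=
  if i == e.1 then t else edge_length V e - t.

(* For a given [e], at most one summand is nonzero. *)
Definition basic_network (R : realType) (n : nat) (V : 'I_n -> R * R)
    (nb : 'I_n -> seq 'I_n) (i : 'I_n) (s : nat) : network R n :=
  fun e t => \sum_(r < 3 | e == edge i (nb_vertex nb i s r))
    lambda V nb i s r * (1 - dist_from V i e t / edge_length V e).

Definition signed_pow (R : realType) (x r : R) : R := `|x| `^ r * Num.sg x.

(* Main.v *)
(* For functions of the class F_p minimality of the norm of F'' amounts to the vanishing of the
   first variation.  Put W = |F''|^(p-1) sign(F'') on the edges.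

   Necessity.  A C^1 function concentrated near one edge, with a prescribed bounded second
   derivative g along that edge and zero on all other edges, is an admissible variation as soon as
   g is compactly supported in the open edge and orthogonal to the affine functions; hence W is
   affine on every edge (du Bois-Reymond).  Varying next by functions that vanish at all vertices
   and whose gradient is nonzero at a single vertex V_i, two integrations by parts give
   sum_j w_ij u_ij = 0 over the edges at V_i, where w_ij is the value of W at V_i on e_ij and u_ij
   is the unit direction of e_ij.  Because lambda_1 <> 0, elimination shows that such a relation is
   a combination of the relations lambda^(s), so W is a combination of the B_is.

   Sufficiency.  If W is such a combination, then for every F in F_p two integrations by parts
   show that sum_e int F'' W depends only on the values z_i, and convexity of |x|^p concludes.

   The fundamental theorem of calculus for absolutely continuous functions, on which the
   integrations by parts rest, comes from the Radon-Nikodym theorem applied to the total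
   variation. *)
Require Import Defs.
From HB Require Import structures.
From mathcomp Require Import all_boot all_order all_algebra.
From mathcomp Require Import all_classical all_reals all_analysis.
From mathcomp Require Import measurable_realfun ring lra zify.
Import Order.TTheory GRing.Theory Num.Theory.
Import numFieldNormedType.Exports.
Local Open Scope classical_set_scope.
Local Open Scope ring_scope.

Set Implicit Arguments.
Unset Strict Implicit.
Unset Printing Implicit Defensive.

(** The norm is never differentiated: the tangent inequality of |x|^p is used at the candidate for
    sufficiency and at the perturbed function for the first variation, where dominated convergence
    then suffices. Two geometric points carry the necessity. A test function near an edge must
    vanish on all other edges, although the domain may have holes and triangles meeting in a single
    vertex; uniqueness of barycentric coordinates shows that no other edge meets the open edge, and
    compactness turns this into a strip that leaves room for a cutoff. The elimination at a vertex
    ends with a relation between the last two directions, so these must be linearly independent;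
    opposite directions are excluded by lambda_1 <> 0, or by a nondegenerate triangle when the
    degree is 2. On the analytic side, [derive1] is a total function with a default value where no
    limit exists, so the measurability of f_e'' takes an argument of its own, and F'' is additive in
    F only almost everywhere. *)

(** * Absolutely continuous functions *)

(** Refining each interval of a family by its own partition gives a family indexed by a dependent
    sum, hence the arbitrary finite index type. *)
Lemma abs_continuous_finType (R : realType) (a b : R) (g : R -> R) :
  abs_continuous a b g -> forall eps : R, 0 < eps ->
  exists2 delta : R, 0 < delta & forall (I : finType) (c d : I -> R),
    (forall k, a <= c k /\ c k <= d k /\ d k <= b) ->
    trivIset [set: I] (fun k => `]c k, d k[%classic) ->
    \sum_k (d k - c k) < delta -> \sum_k `|g (d k) - g (c k)| < eps.
Proof.
move=> acg eps eps0; have [delta delta0 acd] := acg _ eps0.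
exists delta => // I c d cd tI.
pose C (k : 'I_#|I|) := c (enum_val k); pose D (k : 'I_#|I|) := d (enum_val k).
have -> : \sum_k (d k - c k) = \sum_(k < #|I|) (D k - C k).
  by rewrite -(big_enum_val (fun k => d k - c k)).
have -> : \sum_k `|g (d k) - g (c k)| = \sum_(k < #|I|) `|g (D k) - g (C k)|.
  by rewrite -(big_enum_val (fun k => `|g (d k) - g (c k)|)).
apply: acd => [k|]; first exact: cd.
move=> i j _ _ ij; apply: enum_val_inj.
exact: (tI _ _ Logic.I Logic.I ij).
Qed.

(** Partitions of the individual intervals together form one disjoint family of the same total
    length, so the sum of the variations stays below [eps]; the total variations are suprema of
    these. *)
Lemma total_variation_abs_continuous (R : realType) (a b : R) (g : R -> R) :
  abs_continuous a b g -> forall eps : R, 0 < eps ->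
  exists2 delta : R, 0 < delta & forall (I : finType) (c d : I -> R),
    (forall k, a <= c k /\ c k <= d k /\ d k <= b) ->
    trivIset [set: I] (fun k => `]c k, d k[%classic) ->
    \sum_k (d k - c k) < delta ->
    (\sum_k total_variation (c k) (d k) g <= eps%:E)%E.
Proof.
move=> acg eps eps0.
have [delta delta0 acd] := abs_continuous_finType acg eps0.
exists delta => // I c d cd tI lt_delta.
have variation_lt (l : I -> seq R) : (forall k, itv_partition (c k) (d k) (l k)) ->
    \sum_k variation (c k) (d k) g (l k) < eps.
  move=> part_l.
  pose J := {k : I & 'I_(size (l k))}.
  pose C (p : J) := nth (d (tag p)) (c (tag p) :: l (tag p)) (tagged p).
  pose D (p : J) := nth (d (tag p)) (l (tag p)) (tagged p).
  have node k (i : nat) : (i < (size (l k)).+1)%N ->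
      c k <= nth (d k) (c k :: l k) i <= d k.
    by move=> il; rewrite itv_partition_nth_ge// itv_partition_nth_le.
  have sorted_nodes k (i j : nat) : (i <= j < (size (l k)).+1)%N ->
      nth (d k) (c k :: l k) i <= nth (d k) (c k :: l k) j.
    move=> /andP[ij jl]; have [pl _] := part_l k.
    apply: sorted_leq_nth => //.
    - exact: le_trans.
    - by have := pl; rewrite lt_path_sortedE => /andP[h1 h2] /=;
        apply: sub_path pl => x y /ltW.
    - by rewrite inE /= (leq_ltn_trans ij).
  have -> : \sum_k variation (c k) (d k) g (l k) = \sum_(p : J) `|g (D p) - g (C p)|.
    under eq_bigr do rewrite /variation big_mkord.
    by rewrite sig_big_dep.
  apply: acd.
  - move=> [k i]; rewrite /C /D /=.
    have /andP[h1 h2] := node k i (leqW (ltn_ord i)).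
    have /andP[h3 h4] := node k i.+1 (ltn_ord i).
    have [h5 [h6 h7]] := cd k.
    split; first exact: le_trans h5 h1.
    split; last exact: le_trans h4 h7.
    by apply: (sorted_nodes k i i.+1); rewrite leqnSn ltnS ltn_ord.
  - move=> [k i] [k' i'] _ _ [x []]; rewrite /C /D /= !in_itv /=.
    move=> /andP[x1 x2] /andP[x3 x4].
    have kk' : k = k'.
      apply: tI => //; exists x; split => /=; rewrite in_itv /=.
        have /andP[h1 _] := node k i (leqW (ltn_ord i)).
        have /andP[_ h4] := node k i.+1 (ltn_ord i).
        by rewrite (le_lt_trans h1 x1) (lt_le_trans x2 h4).
      have /andP[h1 _] := node k' i' (leqW (ltn_ord i')).
      have /andP[_ h4] := node k' i'.+1 (ltn_ord i').
      by rewrite (le_lt_trans h1 x3) (lt_le_trans x4 h4).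
    subst k'; congr existT; apply: val_inj => /=.
    have [ii'|ii'|//] := ltngtP i i'.
      have := sorted_nodes k i.+1 i'; rewrite ii' ltnS (ltnW (ltn_ord i')) => /(_ erefl).
      by move=> /(lt_le_trans x2) /(lt_trans x3); rewrite ltxx.
    have := sorted_nodes k i'.+1 i; rewrite ii' ltnS (ltnW (ltn_ord i)) => /(_ erefl).
    by move=> /(lt_le_trans x4) /(lt_trans x1); rewrite ltxx.
  - suff -> : \sum_p (D p - C p) = \sum_k (d k - c k) by [].
    transitivity (\sum_k \sum_(i < size (l k))
        (nth (d k) (c k :: l k) i.+1 - nth (d k) (c k :: l k) i)).
      by rewrite sig_big_dep.
    apply: eq_bigr => k _.
    rewrite -(big_mkord xpredT (fun i => nth (d k) (c k :: l k) i.+1 - nth (d k) (c k :: l k) i)).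
    rewrite telescope_sumr// (itv_partition_nth_size _ (part_l k))//.
have part_ex (k : I) : exists l, itv_partition (c k) (d k) l.
  have [_ [+ _]] := cd k; rewrite le_eqVlt => /predU1P[->|ck].
    by exists [::]; split.
  by exists [:: d k]; exact: itv_partition1.
have {part_ex} [l0 part_l0] := choice part_ex.
(* The other summands are nonnegative, so each single total variation is bounded; its finiteness
   permits the approximation from below. *)
have TV_le k : (total_variation (c k) (d k) g <= eps%:E)%E.
  apply: ge_ereal_sup => _ [_ [l pl <-] <-]; rewrite lee_fin.
  pose l1 j := if j == k then l else l0 j.
  have pl1 j : itv_partition (c j) (d j) (l1 j).
    by rewrite /l1; case: eqP => [->|].
  apply: le_trans (ltW (variation_lt _ pl1)).
  rewrite (bigD1 k)//= {1}/l1 eqxx lerDl sumr_ge0// => j _.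
  exact: variation_ge0.
have TV_fin k : total_variation (c k) (d k) g \is a fin_num.
  rewrite ge0_fin_numE; first by rewrite (le_lt_trans (TV_le k))// ltry.
  by apply: total_variation_ge0; have [_ []] := cd k.
apply/lee_addgt0Pr => eta eta0.
(* The errors of all the approximations must add up to at most [eta]; the successor keeps the
   quotient positive for an empty family. *)
pose eta' := eta / #|I|.+1%:R.
have eta'0 : 0 < eta' by rewrite divr_gt0.
have adh k : exists l, itv_partition (c k) (d k) l /\
    (total_variation (c k) (d k) g - eta'%:E < (variation (c k) (d k) g l)%:E)%E.
  have [_ [_ [l pl <-] <-] ltl] := ub_ereal_sup_adherent eta'0 (TV_fin k).
  by exists l; split.
have {adh} [l /all_and2[pl ltl]] := choice adh.
apply: (@le_trans _ _ (\sum_k ((variation (c k) (d k) g (l k))%:E + eta'%:E))%E).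
  by apply: lee_sum => k _; rewrite -leeBlDr//; exact/ltW/ltl.
rewrite big_split /= !sumEFin -EFinD lee_fin.
apply: lerD; first exact/ltW/variation_lt.
rewrite sumr_const -mulr_natr /eta' -mulrA ler_piMr ?(ltW eta0)//.
by rewrite mulrC ler_pdivrMr ?ltr0n// mul1r ler_nat.
Qed.

(** With [delta] chosen for the tolerance 1, a subdivision into finitely many pieces shorter than
    [delta] bounds the variation by the number of pieces. *)
Lemma total_variation_fin_num (R : realType) (a b : R) (g : R -> R) :
  a <= b -> abs_continuous a b g -> total_variation a b g \is a fin_num.
Proof.
move=> ab /total_variation_abs_continuous/(_ 1 ltr01)[delta delta0 tvd].
have short c d : a <= c -> c <= d -> d <= b -> d - c < delta ->
    (total_variation c d g <= 1%:E)%E.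
  move=> ac cd db dc.
  have := tvd unit (fun _ => c) (fun _ => d); rewrite !big_const card_unit /= addr0 adde0.
  by apply=> //; move=> [] [].
pose n := (Num.truncn ((b - a) / delta)).+1.
pose h := (b - a) / n%:R.
have h0 : 0 <= h by rewrite divr_ge0// subr_ge0.
have hdelta : h < delta.
  rewrite ltr_pdivrMr// mulrC -ltr_pdivrMr//.
  by apply: truncnS_gt.
have nh : n%:R * h = b - a by rewrite mulrC divfK// pnatr_eq0.
suff main k : (k <= n)%N -> (total_variation a (a + k%:R * h) g <= k%:R%:E)%E.
  rewrite ge0_fin_numE ?total_variation_ge0//.
  by have := main n (leqnn _); rewrite nh subrKC => /le_lt_trans; apply; rewrite ltry.
elim: k => [_|k IH kn]; first by rewrite mul0r addr0 total_variationxx.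
have khb : a + k.+1%:R * h <= b.
  by rewrite -lerBrDl -nh ler_wpM2r// ler_nat.
rewrite (@total_variationD _ a _ (a + k%:R * h)).
- rewrite -[in leRHS]natr1 EFinD leeD ?IH//; first exact: ltnW.
  apply: short.
  + by rewrite lerDl mulr_ge0.
  + by rewrite lerD2l ler_wpM2r// ler_nat.
  + by [].
  + by rewrite -natr1 (_ : _ - _ = h)//; ring.
- by rewrite lerDl mulr_ge0.
- by rewrite lerD2l ler_wpM2r// ler_nat.
Qed.

(** Absolute continuity says that the Lebesgue-Stieltjes measure of [H] is dominated by Lebesgue
    measure, and [h] is a Radon-Nikodym derivative. The hypotheses concern the whole line because
    the Stieltjes measure lives there; its restriction to ]a, b] is the finite measure to be
    differentiated. *)
Lemma nondecreasing_abs_continuous_density (R : realType) (a b : R) (H : R -> R) :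
  a <= b -> nondecreasing_fun H ->
  (forall eps : R, 0 < eps -> exists2 delta : R, 0 < delta &
    forall (m : nat) (c d : 'I_m -> R), (forall k, c k <= d k) ->
      trivIset [set: 'I_m] (fun k => `]c k, d k[%classic) ->
      \sum_(k < m) (d k - c k) < delta -> \sum_(k < m) (H (d k) - H (c k)) <= eps) ->
  exists2 h : R -> R, (@lebesgue_measure R).-integrable setT (EFin \o h) &
    forall x, a <= x <= b -> H x - H a = \int[@lebesgue_measure R]_(t in `[a, x]) h t.
Proof.
move=> ab ndH acH.
have rcH (x : R) : H @ x^'+ --> H x.
  apply/cvgrPdist_le => eps eps0; have [delta delta0 dH] := acH _ eps0.
  near=> t.
  have xt : x < t by near: t; exact: nbhs_right_gt.
  rewrite distrC ger0_norm ?subr_ge0 ?ndH ?(ltW xt)//.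
  have := dH 1%N (fun=> x) (fun=> t); rewrite !big_ord1; apply.
  - by move=> _; exact: ltW.
  - by move=> i j _ _ _; rewrite !ord1.
  - rewrite ltrBlDl; near: t; apply: nbhs_right_lt; rewrite ltrDl//.
pose T := measurableTypeR R.
pose Hc : cumulative R R := HB.pack H (isCumulative.Build R _ R H ndH rcH).
pose nu0 : {measure set T -> \bar R} := lebesgue_stieltjes_measure Hc.
pose mu : {sigma_finite_measure set T -> \bar R} := @lebesgue_measure R.
have nu0E (c d : R) : c <= d -> nu0 (`]c, d]%classic : set R) = (H d - H c)%:E.
  move=> cd; rewrite /nu0 /=.
  rewrite /lebesgue_stieltjes_measure /measure_extension.
  rewrite measurable_mu_extE/=; last exact: is_ocitv.
  by rewrite wlength_itv_bnd.
have mab : measurable (`]a, b]%classic : set T) by exact: measurable_itv.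
have nu0fin : (nu0 (`]a, b]%classic : set T) < +oo)%E by rewrite nu0E// ltry.
pose nu : {finite_measure set T -> \bar R} := mfrestr mab nu0fin.
(* A null set lies in an open set of measure below [delta], whose components form a countable
   disjoint family of intervals; the hypothesis bounds the Stieltjes measure of any finitely many of
   them. *)
have dom0 (N : set T) : measurable N -> mu N = 0%E -> nu0 N = 0%E.
  move=> mN muN0; apply/eqP; rewrite eq_le measure_ge0 andbT.
  apply/lee_addgt0Pr => eps eps0; rewrite add0e.
  have [delta delta0 dH] := acH _ eps0.
  have [|U [oU NU muU]] := lebesgue_regularity_outer mN _ delta0.
    by move: muN0; rewrite /mu /= => ->.
  have mU : measurable (U : set T) by exact: measurable_realfun.open_measurable.
  have {}muU : (mu U < delta%:E)%E.
    apply: le_lt_trans muU; rewrite -[leRHS]add0e -muN0.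
    rewrite -{1}(setDUK NU).
    by apply: measureU2 => //; exact: measurableD.
  pose J := open_disjoint_itv oU.
  have oJ q : open (J q) by exact: open_disjoint_itv_open.
  have mJ q : measurable (J q : set T) by exact: measurable_realfun.open_measurable.
  have tJ : trivIset [set: nat] J by exact: open_disjoint_itv_trivIset.
  have UJ : U = \bigcup_q J q by exact: open_disjoint_itv_bigcup.
  have muUE : mu U = (\sum_(0 <= q <oo) mu (J q))%E.
    rewrite {1}UJ; apply: (measure_semi_bigcup mu) => //.
    by rewrite -UJ.
  have muJ q : (mu (J q) < +oo)%E.
    apply: (@le_lt_trans _ _ (mu U)); last by rewrite (lt_trans muU)// ltry.
    by apply: le_measure; rewrite ?inE// UJ; exact: bigcup_sup.
  (* A component of finite Lebesgue measure is a bounded interval; an empty one is represented by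
     equal ends. *)
  have /choice[cd cdP] q : exists cd : R * R, [/\ cd.1 <= cd.2,
      J q = `]cd.1, cd.2[%classic & mu (J q) = (cd.2 - cd.1)%:E].
    have iJ : is_interval (J q) by exact: open_disjoint_itv_is_interval.
    have [[lJ uJ]|] := pselect (has_lbound (J q) /\ has_ubound (J q)).
      have JE := interval_bounded_interior iJ lJ uJ.
      rewrite (_ : (J q)° = J q) in JE; last first.
        by apply/interior_id; exact: oJ.
      have [J0|/set0P[y Jy]] := eqVneq (J q) set0.
        exists (a, a); split => //=; first by rewrite set_itvoo0//; rewrite J0.
        by rewrite J0 measure0 subrr.
      have ltJ : inf (J q) < sup (J q).
        have : [set r | inf (J q) < r < sup (J q)] y by rewrite -JE.
        by move=> /= /andP[yl yu]; exact: lt_trans yl yu.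
      have JE' : J q = `]inf (J q), sup (J q)[%classic.
        by rewrite {1}JE; apply/seteqP; split => x/=; rewrite in_itv.
      exists (inf (J q), sup (J q)); split => //=; first exact: ltW.
      rewrite {1}JE' /mu /= lebesgue_measure_itv /= lte_fin ltJ.
      by rewrite EFinB.
    have JE : [set` Rhull (J q)] = J q by apply: RhullK; rewrite inE.
    have := muJ q; rewrite -JE /mu /= lebesgue_measure_itv.
    case: (Rhull (J q)) JE => [[bl l|bl] [br r|br]] JE.
    - move=> _ []; split.
        by exists l => x /=; rewrite in_itv /= => /andP[/lteifW].
      by exists r => x /=; rewrite in_itv /= => /andP[_ /lteifW].
    - case: br JE => JE /=; last by rewrite ltry.
      by move=> _ []; split; exists 0 => x /=; rewrite in_itv /= andbF.
    - case: bl JE => JE /=; first by rewrite ltNyr.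
      by move=> _ []; split; exists 0 => x /=; rewrite in_itv.
    - case: bl JE => JE; case: br JE => JE //=;
        by move=> _ []; split; exists 0 => x /=; rewrite in_itv.
  apply: (@le_trans _ _ (\sum_(0 <= q <oo) nu0 (J q))%E).
    by apply: measure_sigma_subadditive => //; rewrite -UJ.
  apply: lime_le; first by apply: is_cvg_nneseries => q _ _; exact: measure_ge0.
  apply: nearW => m.
  apply: (@le_trans _ _ (\sum_(k < m) (H (cd k).2 - H (cd k).1))%:E).
    rewrite big_mkord -sumEFin; apply: lee_sum => k _.
    have [cdk Jk _] := cdP k; rewrite -nu0E// Jk.
    apply: le_measure; rewrite ?inE; try exact: measurable_itv.
    exact: subset_itv_oo_oc.
  rewrite lee_fin; apply: (dH m (fun k => (cd k).1) (fun k => (cd k).2)).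
  - by move=> k; have [] := cdP k.
  - move=> i j _ _ ij; apply: val_inj; apply: tJ => //.
    by have [_ -> _] := cdP i; have [_ -> _] := cdP j.
  - rewrite -lte_fin; apply: le_lt_trans muU; rewrite muUE -sumEFin.
    rewrite (eq_bigr (fun k : 'I_m => mu (J k))); last first.
      by move=> k _; have [_ _ ->] := cdP k.
    rewrite -(big_mkord xpredT (fun k => mu (J k))).
    by apply: nneseries_lim_ge => q _ _; exact: measure_ge0.
have dom : nu `<< mu.
  move=> N nullN A mA AN; rewrite /nu /= /mfrestr /mrestr.
  apply: dom0; first exact: measurableI.
  apply/eqP; rewrite eq_le measure_ge0 andbT -(nullN A mA AN).
  by apply: le_measure; rewrite ?inE//; exact: measurableI.
have [f [f0 ffin fint nuE]] := radon_nikodym_sigma_finite dom.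
exists (fine \o f).
  by apply: eq_integrable fint => // x _ /=; rewrite fineK.
move=> x /andP[ax xb].
apply: EFin_inj.
rewrite -nu0E//.
have -> : nu0 (`]a, x]%classic : set T) = nu (`]a, x]%classic : set T).
  rewrite /nu /= /mfrestr /mrestr; congr (nu0 _).
  by apply/esym/setIidl => y /=; rewrite !in_itv/= => /andP[-> /le_trans ->].
rewrite nuE; last exact: measurable_itv.
have intf : mu.-integrable setT (EFin \o (fine \o f)).
  by apply: eq_integrable fint => // y _ /=; rewrite fineK.
rewrite -Rintegral_itv_obnd_cbnd; last first.
  by apply: integrableS intf => //; exact: measurable_itv.
rewrite /Rintegral fineK; last first.
  apply: integrable_fin_num; first exact: measurable_itv.
  by apply: integrableS intf => //; exact: measurable_itv.
by apply: eq_integral => y _ /=; rewrite fineK.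
Unshelve. all: by end_near. Qed.

#[local] Instance ae_lebesgue_filter (R : realType) :
  Filter (almost_everywhere (@lebesgue_measure R)).
Proof. exact: ae_filter_ringOfSetsType. Qed.

(** The sigma-algebra is the Borel one, which is not complete: measurability does not pass along an
    equality almost everywhere and is assumed for [g]. *)
Lemma ae_eq_integrable (R : realType) (D : set R) (f g : R -> R) :
  measurable D -> measurable_fun D g ->
  {ae @lebesgue_measure R, forall x, D x -> f x = g x} ->
  (@lebesgue_measure R).-integrable D (EFin \o f) ->
  (@lebesgue_measure R).-integrable D (EFin \o g).
Proof.
move=> mD mg fg /integrableP[mf intf]; apply/integrableP; split.
  exact/measurable_EFinP.
apply: le_lt_trans intf; rewrite le_eqVlt; apply/orP; left; apply/eqP.
apply: ae_eq_integral => //.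
- by apply: measurableT_comp => //; exact/measurable_EFinP.
- exact: measurableT_comp.
- by apply: filterS fg => x fgx Dx /=; rewrite fgx.
Qed.

(** Composition with it extends a function on [a, b] by constants, which makes results on the whole
    line applicable. *)
Definition clamp (R : realType) (a b x : R) : R := Num.min b (Num.max a x).

Lemma clamp_itv (R : realType) (a b x : R) : a <= b -> a <= clamp a b x <= b.
Proof. by move=> ab; rewrite /clamp le_min ab le_max lexx ge_min lexx. Qed.

Lemma clamp_id (R : realType) (a b x : R) : a <= x <= b -> clamp a b x = x.
Proof. by move=> /andP[ax xb]; rewrite /clamp max_r// min_r. Qed.

Lemma clamp_le (R : realType) (a b x y : R) : x <= y -> clamp a b x <= clamp a b y.
Proof. by rewrite /clamp => xy; rewrite /Num.min /Num.max; repeat case: ifPn; rewrite -?leNgt; lra. Qed.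

Lemma clamp_sub_le (R : realType) (a b x y : R) : x <= y ->
  clamp a b y - clamp a b x <= y - x.
Proof.
rewrite /clamp => xy.
by rewrite /Num.min /Num.max; repeat case: ifPn; rewrite -?leNgt; lra.
Qed.

Lemma clamp_oo_sub (R : realType) (a b c d : R) :
  (`]clamp a b c, clamp a b d[ `<=` `]c, d[)%classic.
Proof.
move=> x /=; rewrite !in_itv /= /clamp /Num.min /Num.max.
by repeat case: ifPn; rewrite -?leNgt; lra.
Qed.

(** Jordan decomposition: g is the difference of its variation function V and of V - g. Both are
    nondecreasing, and the increments of g are bounded by those of V, so V - g inherits absolute
    continuity from V. *)
Lemma abs_continuous_density (R : realType) (a b : R) (g : R -> R) :
  a <= b -> abs_continuous a b g ->
  exists2 h : R -> R, (@lebesgue_measure R).-integrable setT (EFin \o h) &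
    forall x, a <= x <= b -> g x - g a = \int[@lebesgue_measure R]_(t in `[a, x]) h t.
Proof.
move=> ab acg.
pose V x := fine (total_variation a (clamp a b x) g).
pose k x := clamp a b x.
have kab x : a <= k x /\ k x <= b by have /andP[] := clamp_itv x ab.
have acS c d : a <= c -> d <= b -> abs_continuous c d g.
  move=> ac db eps /acg[delta delta0 H]; exists delta => // m c' d' cd'.
  apply: H => l; have [h1 [h2 h3]] := cd' l.
  by split; [exact: le_trans h1|split => //; exact: le_trans db].
have TVfin c d : a <= c -> c <= d -> d <= b -> total_variation c d g \is a fin_num.
  by move=> ac cd db; apply: total_variation_fin_num => //; exact: acS.
have VB c d : c <= d -> (V d - V c)%:E = total_variation (k c) (k d) g.
  move=> cd; have [ac cb] := kab c; have [ad db] := kab d.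
  have kcd : k c <= k d by exact: clamp_le.
  rewrite /V (@total_variationD _ a (k d) (k c))// fineD ?TVfin//.
  by rewrite addrAC subrr add0r fineK// TVfin.
have gV c d : c <= d -> `|g (k d) - g (k c)| <= V d - V c.
  move=> cd; rewrite -lee_fin VB//.
  by apply: total_variation_ge; exact: clamp_le.
have acV : forall eps : R, 0 < eps -> exists2 delta : R, 0 < delta &
    forall (m : nat) (c d : 'I_m -> R), (forall k, c k <= d k) ->
      trivIset [set: 'I_m] (fun k => `]c k, d k[%classic) ->
      \sum_(k < m) (d k - c k) < delta -> \sum_(k < m) (V (d k) - V (c k)) <= eps.
  move=> eps eps0.
  have [delta delta0 H] := total_variation_abs_continuous acg eps0.
  exists delta => // m c d cd tI lt_delta.
  rewrite -lee_fin -sumEFin.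
  under eq_bigr do rewrite VB//.
  apply: H.
  - move=> l; have [ac cb] := kab (c l); have [ad db] := kab (d l).
    by split => //; split => //; exact: clamp_le.
  - move=> i j _ _ [x [xi xj]]; apply: tI => //; exists x; split.
      exact: clamp_oo_sub xi.
    exact: clamp_oo_sub xj.
  - by apply: le_lt_trans lt_delta; apply: ler_sum => l _; exact: clamp_sub_le.
have [h1 ih1 h1E] : exists2 h : R -> R, (@lebesgue_measure R).-integrable setT (EFin \o h) &
    forall x, a <= x <= b -> V x - V a = \int[@lebesgue_measure R]_(t in `[a, x]) h t.
  apply: (nondecreasing_abs_continuous_density ab _ acV).
  by move=> x y xy; rewrite -subr_ge0 (le_trans _ (gV _ _ xy)).
have [h2 ih2 h2E] : exists2 h : R -> R, (@lebesgue_measure R).-integrable setT (EFin \o h) &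
    forall x, a <= x <= b -> (V x - g (k x)) - (V a - g (k a)) =
      \int[@lebesgue_measure R]_(t in `[a, x]) h t.
  apply: (@nondecreasing_abs_continuous_density _ _ _ (fun x => V x - g (k x)) ab).
    by move=> x y xy; have := gV _ _ xy; rewrite ler_norml => /andP[]; lra.
  (* V - g grows at most twice as fast as V. *)
  move=> eps eps0; have [delta delta0 H] := acV (eps / 2) (divr_gt0 eps0 (ltr0Sn _ 1)).
  exists delta => // m c d cd tI lt_delta.
  have {}H := H m c d cd tI lt_delta.
  apply: (@le_trans _ _ (\sum_(l < m) ((V (d l) - V (c l)) + (V (d l) - V (c l))))).
    apply: ler_sum => l _; have := gV _ _ (cd l).
    by rewrite ler_norml => /andP[]; lra.
  by rewrite big_split /=; lra.
exists (fun x => h1 x - h2 x).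
  by apply: (integrableB _ ih1 ih2); exact: measurableT.
move=> x xab; rewrite RintegralB//; last 2 first.
- by apply: integrableS ih1 => //; exact: measurable_itv.
- by apply: integrableS ih2 => //; exact: measurable_itv.
rewrite -h1E// -h2E// /k !clamp_id//; first by lra.
by rewrite lexx.
Qed.

(** Lebesgue differentiation: near an interior point, g is the integral of its density plus a
    constant. *)
Lemma abs_continuous_derivable (R : realType) (a b : R) (g : R -> R) :
  a <= b -> abs_continuous a b g ->
  exists h : R -> R, [/\ (@lebesgue_measure R).-integrable setT (EFin \o h),
    forall x, a <= x <= b -> g x - g a = \int[@lebesgue_measure R]_(t in `[a, x]) h t &
    {ae @lebesgue_measure R, forall x, a < x < b ->
      derivable g x 1 /\ derive1 g x = h x}].
Proof.
move=> ab /(abs_continuous_density ab)[h ih hE].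
exists h; split => //.
have loch : locally_integrable [set: R] h.
  by apply: open_integrable_locally => //; exact: openT.
have inth y : (@lebesgue_measure R).-integrable `[a, y] (EFin \o h).
  by apply: integrableS ih => //; exact: measurable_itv.
have := FTC1 (a := BLeft a) inth loch.
apply: filterS => x dx /andP[ax xb].
have [|dF F'] := dx; first by rewrite lte_fin.
set F := (fun y : R => _) in dF F'.
have gF : {near x, (fun y => F y + g a) =1 g}.
  near=> y.
  have ay : a <= y by apply: ltW; near: y; exact: lt_nbhsr.
  have yb : y <= b by apply: ltW; near: y; exact: lt_nbhsl.
  by rewrite /F -hE ?ay// subrK.
have dFa : is_derive x 1 (fun y => F y + g a) (h x).
  rewrite -[h x]addr0 -F' derive1E; apply: is_deriveD; exact: derivableP.
have [dg g'E] := near_eq_is_derive gF dFa.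
split; first exact: dg.
by rewrite derive1E; exact: g'E.
Unshelve. all: by end_near. Qed.

(** The derivative enters as a separate measurable [k], since for the products below a formula for
    it is known only almost everywhere. *)
Lemma abs_continuous_FTC2 (R : realType) (a b : R) (g k : R -> R) :
  a <= b -> abs_continuous a b g -> measurable_fun `[a, b] k ->
  {ae @lebesgue_measure R, forall x, a < x < b -> derive1 g x = k x} ->
  (@lebesgue_measure R).-integrable `[a, b] (EFin \o k) /\
  \int[@lebesgue_measure R]_(t in `[a, b]) k t = g b - g a.
Proof.
move=> ab /(abs_continuous_derivable ab)[h [ih hE aeh]] mk aek.
pose mu : {measure set (measurableTypeR R) -> \bar R} := @lebesgue_measure R.
have mab : measurable (`[a, b]%classic : set (measurableTypeR R)) by exact: measurable_itv.
have iab : mu.-integrable `[a, b] (EFin \o h) by exact: integrableS ih.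
have hk : {ae mu, forall x, `[a, b]%classic x -> h x = k x}.
  have neq c : {ae mu, forall x, x != c}.
    exists [set c]; split; [exact: measurable_set1|exact: lebesgue_measure_set1|].
    by move=> x /= /negP; rewrite negbK => /eqP.
  have aeab : {ae mu, forall x, x != a /\ x != b} by exact: filterI (neq a) (neq b).
  have := aeh; have := aek; have := aeab.
  apply: filterS3 => x [xa xb] kx hx /=.
  rewrite in_itv /= => /andP[ax bx].
  have xab : a < x < b by rewrite !lt_neqAle ax bx xb eq_sym xa.
  by rewrite -(kx xab) (hx xab).2.
have ik := ae_eq_integrable mab mk hk iab.
split => //.
rewrite hE ?ab ?lexx// /Rintegral; congr fine.
apply: ae_eq_integral => //.
- exact/measurable_EFinP.
- by case/integrableP: iab.
- by apply: filterS hk => x hkx /hkx ->.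
Qed.

(** Where it exists, the derivative is a limit of continuous difference quotients. By the Cauchy
    criterion the set where it exists is obtained from closed sets by countable unions and
    intersections. *)
Lemma measurable_fun_derive1 (R : realType) (G : R -> R) :
  continuous G -> measurable_fun setT (derive1 G).
Proof.
move=> cG.
pose q (h x : R) := h^-1 * (G (h + x) - G x).
have cq h : continuous (q h).
  move=> x; apply: cvgM; first exact: cvg_cst.
  apply: cvgB; last exact: cG.
  apply: (@continuous_comp _ _ _ (fun y => h + y) G); last exact: cG.
  by apply: cvgD; [exact: cvg_cst|exact: cvg_id].
pose D : set R := [set x | cvg (q ^~ x @ 0^')].
pose C (n m : nat) : set R := [set x | forall h k, h != 0 -> k != 0 ->
  `|h| < m.+1%:R^-1 -> `|k| < m.+1%:R^-1 -> `|q h x - q k x| <= n.+1%:R^-1].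
have DE : D = \bigcap_n \bigcup_m C n m.
  apply/seteqP; split => x.
    move=> /cvg_ex[l ql] n _.
    have e0 : 0 < n.+1%:R^-1 / 2 :> R by rewrite divr_gt0// invr_gt0.
    move/cvgrPdist_le : ql => /(_ _ e0)[d /= d0 dP].
    pose m := Num.truncn d^-1; exists m => // h k h0 k0 hm km.
    have md : m.+1%:R^-1 < d :> R.
      by rewrite invf_plt ?posrE//; exact: truncnS_gt.
    have qle r : r != 0 -> `|r| < m.+1%:R^-1 -> `|l - q r x| <= n.+1%:R^-1 / 2.
      move=> r0 rm; apply: dP => //=; rewrite sub0r normrN.
      exact: lt_trans rm md.
    have -> : q h x - q k x = (l - q k x) - (l - q h x) by ring.
    rewrite (le_trans (ler_normB _ _))// [leRHS]splitr.
    by rewrite lerD// qle.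
  move=> CC; apply/cauchy_cvgP/cauchy_exP => e e0.
  pose n := Num.truncn e^-1.
  have ne : n.+1%:R^-1 < e :> R.
    by rewrite invf_plt ?posrE//; exact: truncnS_gt.
  have [m _ Cnm] := CC n Logic.I.
  have m0 : 0 < m.+1%:R^-1 :> R by rewrite invr_gt0.
  have h0m : `|m.+1%:R^-1 / 2| < m.+1%:R^-1 :> R.
    by rewrite ger0_norm ?divr_ge0 ?(ltW m0)// ltr_pdivrMr// ltr_pMr// ltr1n.
  exists (q (m.+1%:R^-1 / 2) x).
  exists m.+1%:R^-1 => //= h /=; rewrite sub0r normrN => hm h0.
  by apply: le_lt_trans ne; apply: Cnm.
have mD : measurable D.
  rewrite DE; apply: bigcapT_measurable => n; apply: bigcupT_measurable => m.
  (* [C n m] is closed as an intersection of closed conditions, one for each pair of increments. *)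
  apply: measurable_realfun.closed_measurable.
  rewrite (_ : C n m = \bigcap_(hk in [set hk : R * R | [/\ hk.1 != 0, hk.2 != 0,
      `|hk.1| < m.+1%:R^-1 & `|hk.2| < m.+1%:R^-1]])
      [set x | `|q hk.1 x - q hk.2 x| <= n.+1%:R^-1]); last first.
    apply/seteqP; split => [x Cx [h k] [/= *]|x Cx h k *]; first exact: Cx.
    exact: (Cx (h, k)).
  apply: closed_bigI => -[h k] _ /=.
  apply: (@closed_comp _ _ (fun x => `|q h x - q k x|) [set y | y <= n.+1%:R^-1]).
    move=> x _; apply: (@continuous_comp _ _ _ (fun x => q h x - q k x) Num.norm).
      by apply: cvgB; exact: cq.
    exact: norm_continuous.
  exact: closed_le.
(* [point] is the value of [lim] in the absence of a limit, so that these functions converge to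
   [derive1 G] outside [D] as well. *)
pose f (k : nat) x := if x \in D then q k.+1%:R^-1 x else point.
apply: (@measurable_fun_cvg _ _ _ setT (fun k => f k)).
  move=> k; apply: measurable_fun_ifT => //.
  - apply: (measurable_fun_bool true); rewrite setTI.
    rewrite (_ : _ @^-1` _ = D)//; apply/seteqP; split => y.
      exact: set_mem.
    exact: mem_set.
  - exact: measurable_realfun.continuous_measurable_fun.
move=> x _; rewrite /f; have [Dx|Dx] := pselect (D x).
  rewrite mem_set//.
  have -> : derive1 G x = lim (q ^~ x @ 0^') by [].
  apply/cvgrPdist_le => e e0; move/cvgrPdist_le : Dx => /(_ _ e0)[d /= d0 dP].
  exists (Num.truncn d^-1) => // k Nk; apply: dP; last by rewrite invr_neq0.
  rewrite /= sub0r normrN ger0_norm ?invr_ge0// invf_plt ?posrE//.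
  by rewrite (lt_le_trans (truncnS_gt _))// ler_nat.
rewrite memNset//; have -> : derive1 G x = lim (q ^~ x @ 0^') by [].
by rewrite dvgP//; exact: cvg_cst.
Qed.

Lemma abs_continuous_clamp_continuous (R : realType) (a b : R) (g : R -> R) :
  a <= b -> abs_continuous a b g -> continuous (g \o clamp a b).
Proof.
move=> ab acg x; apply/cvgrPdist_le => eps eps0.
have [delta delta0 H] := acg _ eps0.
have key c d : c <= d -> d - c < delta -> `|g (clamp a b d) - g (clamp a b c)| < eps.
  move=> cd dc; have := H 1%N (fun=> clamp a b c) (fun=> clamp a b d).
  rewrite !big_ord1; apply.
  - have /andP[? ?] := clamp_itv c ab; have /andP[? ?] := clamp_itv d ab.
    by split => //; split => //; exact: clamp_le.
  - by move=> i j _ _ _; rewrite !ord1.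
  - by apply: le_lt_trans dc; exact: clamp_sub_le.
exists delta => // y /=; have [xy|yx] := leP x y.
  by rewrite distrC ger0_norm ?subr_ge0// => xyd; rewrite distrC ltW// key.
by rewrite gtr0_norm ?subr_gt0// => xyd; rewrite ltW// key// ltW.
Qed.

(** Meant for expressions in g and smoother functions, whose increments are controlled by those of g
    and of the identity. *)
Lemma abs_continuousP_bound (R : realType) (a b C : R) (g k : R -> R) :
  abs_continuous a b g ->
  (forall x y, a <= x -> x <= y -> y <= b ->
    `|k y - k x| <= C * (`|g y - g x| + (y - x))) ->
  abs_continuous a b k.
Proof.
move=> acg kC eps eps0.
pose C' := `|C| + 1.
have C'0 : 0 < C' by rewrite ltr_wpDl.
have e0 : 0 < eps / C' / 2 by rewrite !divr_gt0.
have [delta delta0 H] := acg _ e0.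
exists (Num.min delta (eps / C' / 2)); first by rewrite lt_min delta0.
move=> m c d cd tI; rewrite lt_min => /andP[lt1 lt2].
have {}H := H m c d cd tI lt1.
apply: (@le_lt_trans _ _ (C' * (\sum_(l < m) (`|g (d l) - g (c l)| + (d l - c l))))).
  rewrite mulr_sumr; apply: ler_sum => l _; have [h1 [h2 h3]] := cd l.
  apply: le_trans (kC _ _ h1 h2 h3) _; apply: ler_wpM2r.
    by rewrite addr_ge0// subr_ge0.
  by rewrite (le_trans (ler_norm _))// lerDl.
rewrite big_split /= mulrC -ltr_pdivlMr//.
by rewrite [ltRHS]splitr ltrD.
Qed.

Lemma derivative_on_is_derive (R : realType) (a b : R) (f g : R -> R) (t : R) :
  derivative_on a b f g -> a < t < b -> is_derive t 1 f (g t).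
Proof.
move=> fg /andP[at_ tb].
have := fg t; rewrite (ltW at_) (ltW tb) => /(_ erefl) fgt.
have fgt' : (fun s => (f s - f t) / (s - t)) @ t^' --> g t.
  apply/cvgrPdist_le => e e0.
  move/cvgrPdist_le : fgt => /(_ _ e0)[d /= d0 dP].
  exists (Num.min d (Num.min (t - a) (b - t))).
    by rewrite /= !lt_min d0 !subr_gt0 at_ tb.
  move=> s; rewrite /= !lt_min => /andP[sd /andP[sa sb]] st.
  apply: dP => //; rewrite /= in_itv /=.
  by move: sa sb; rewrite !ltr_norml => /andP[_ ?] /andP[? _]; apply/andP; split; lra.
apply/is_derive1_caratheodory.
exists (fun s => if s == t then g t else (f s - f t) / (s - t)); split.
- move=> z; case: eqP => [->|/eqP zt]; first by rewrite !subrr mulr0.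
  by rewrite divfK// subr_eq0.
- apply/continuous_withinNx; rewrite eqxx; apply: cvg_trans fgt'.
  apply: near_eq_cvg; near=> s; rewrite ifN//; near: s.
  exact: nbhs_dnbhs_neq.
- by rewrite eqxx.
Unshelve. all: by end_near. Qed.

Lemma near_in_itv_oo (R : realType) (a b t : R) (P : R -> Prop) :
  a < t < b -> (forall s, a < s < b -> P s) -> \forall s \near t, P s.
Proof.
move=> /andP[at_ tb] HP; near=> s; apply: HP; apply/andP; split; near: s.
  exact: lt_nbhsr.
exact: lt_nbhsl.
Unshelve. all: by end_near. Qed.

Lemma near_eq_derive1 (R : realType) (f g : R -> R) (t : R) :
  {near t, f =1 g} -> derive1 f t = derive1 g t.
Proof. by move=> fg; rewrite !derive1E; exact: near_eq_derive. Qed.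

Lemma derivative_on_derive1 (R : realType) (a b : R) (f g : R -> R) (t : R) :
  derivative_on a b f g -> a < t < b -> derive1 f t = g t.
Proof.
by move=> fg /(derivative_on_is_derive fg)[_ <-]; rewrite derive1E.
Qed.

Lemma derivative_on_derive2 (R : realType) (a b : R) (f g : R -> R) (t : R) :
  derivative_on a b f g -> a < t < b -> derive1 (derive1 f) t = derive1 g t.
Proof.
move=> fg tab; apply/near_eq_derive1/(near_in_itv_oo tab) => s.
exact: derivative_on_derive1.
Qed.

Lemma derivative_on_continuous (R : realType) (a b : R) (f g : R -> R) :
  derivative_on a b f g -> {within `[a, b], continuous f}.
Proof.
move=> fg; apply/subspace_continuousP => t; rewrite /= in_itv /= => /fg fgt.
apply/cvgrPdist_le => e e0.
move/cvgrPdist_le : fgt => /(_ _ ltr01)[d /= d0 dP].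
have C0 : 0 < `|g t| + 1 by rewrite ltr_wpDl.
exists (Num.min d (e / (`|g t| + 1))).
  by rewrite /= lt_min d0 divr_gt0.
move=> s; rewrite /= lt_min => /andP[sd se] sab.
have [->|st] := eqVneq s t; first by rewrite subrr normr0 ltW.
have {}dP := dP s sd st sab.
have st0 : s - t != 0 by rewrite subr_eq0.
rewrite distrC -(divfK st0 (f s - f t)) normrM distrC.
move: se; rewrite ltr_pdivlMr// => /ltW; apply: le_trans.
rewrite distrC mulrC ler_wpM2l//.
have -> : (f s - f t) / (s - t) = g t - (g t - (f s - f t) / (s - t)) by ring.
by rewrite (le_trans (ler_normB _ _))// lerD2l.
Qed.

(** On the open interval f'' is the derivative of the continuous extension of g by constants; adding
    two points preserves measurability. *)
Lemma measurable_fun_derive2 (R : realType) (a b : R) (f g : R -> R) :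
  a <= b -> derivative_on a b f g -> abs_continuous a b g ->
  measurable_fun `[a, b] (derive1 (derive1 f)).
Proof.
move=> ab fg acg; apply/measurable_fun_itv_bndo_bndcP/measurable_fun_itv_obnd_cbndP.
have mG : measurable_fun `]a, b[ (derive1 (g \o clamp a b)).
  have := measurable_fun_derive1 (abs_continuous_clamp_continuous ab acg).
  exact: measurable_funTS.
apply: eq_measurable_fun mG => t; rewrite inE /= in_itv /= => tab.
rewrite (derivative_on_derive2 fg tab).
apply/near_eq_derive1/(near_in_itv_oo tab) => s.
by move=> /andP[/ltW as_ /ltW sb] /=; rewrite clamp_id// as_.
Qed.

Lemma ae_derivable_derive1 (R : realType) (a b : R) (f g : R -> R) :
  a <= b -> derivative_on a b f g -> abs_continuous a b g ->
  {ae @lebesgue_measure R, forall t, a < t < b -> derivable (derive1 f) t 1}.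
Proof.
move=> ab fg /(abs_continuous_derivable ab)[h [_ _]].
apply: filterS => t ht tab; have [dg _] := ht tab.
apply: near_eq_derivable dg.
by apply/(near_in_itv_oo tab) => s /(derivative_on_derive1 fg).
Qed.

Lemma abs_continuous_bounded (R : realType) (a b : R) (g : R -> R) :
  a <= b -> abs_continuous a b g -> exists2 M, 0 < M & forall t, a <= t <= b -> `|g t| <= M.
Proof.
move=> ab acg; pose G x := `|g (clamp a b x)|.
have cG : {within `[a, b], continuous G}.
  apply: continuous_subspaceT => x.
  apply: (@continuous_comp _ _ _ (g \o clamp a b) Num.norm).
    exact: abs_continuous_clamp_continuous.
  exact: norm_continuous.
have [c _ cP] := EVT_max ab cG.
exists (G c + 1); first by rewrite ltr_wpDl// /G.
move=> t tab; have := cP t; rewrite in_itv /= tab => /(_ erefl).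
by rewrite /G clamp_id// => h; rewrite (le_trans h)// lerDl.
Qed.

Lemma derivative_on_lipschitz (R : realType) (a b M : R) (f g : R -> R) :
  derivative_on a b f g -> (forall t, a <= t <= b -> `|g t| <= M) ->
  forall x y, a <= x -> x <= y -> y <= b -> `|f y - f x| <= M * (y - x).
Proof.
move=> fg gM x y ax xy yb.
have [t txy||t] := @MVT_segment _ f g x y xy.
- move: txy; rewrite in_itv /= => /andP[h1 h2]; apply: (derivative_on_is_derive fg).
  by rewrite (le_lt_trans ax)//= (lt_le_trans h2).
- apply: continuous_subspaceW (derivative_on_continuous fg).
  by move=> t /=; rewrite !in_itv /= => /andP[/(le_trans ax) -> /le_trans ->].
- rewrite in_itv /= => /andP[xt ty] ->.
  rewrite normrM (ger0_norm (_ : 0 <= y - x)) ?subr_ge0//.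
  by rewrite ler_wpM2r ?subr_ge0// gM// (le_trans ax xt) (le_trans ty yb).
Qed.

(** Two integrations by parts at once: [H] is an absolutely continuous primitive of f'' times the
    affine weight. *)
Lemma integral_derive2_affine (R : realType) (L al be : R) (f g : R -> R) :
  0 <= L -> derivative_on 0 L f g -> abs_continuous 0 L g ->
  (@lebesgue_measure R).-integrable `[0, L]
     (EFin \o (fun t => derive1 (derive1 f) t * (al + be * t))) /\
  \int[@lebesgue_measure R]_(t in `[0, L]) (derive1 (derive1 f) t * (al + be * t)) =
    (al + be * L) * g L - al * g 0 - be * (f L - f 0).
Proof.
move=> L0 fg acg.
pose H t := g t * (al + be * t) - be * f t.
have [M M0 gM] := abs_continuous_bounded L0 acg.
have fL := derivative_on_lipschitz fg gM.
have acH : abs_continuous 0 L H.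
  apply: (abs_continuousP_bound (C := `|al| + `|be| * L + `|be| * M + `|be| * M) acg).
  move=> x y x0 xy yL.
  have -> : H y - H x = (g y - g x) * (al + be * y) + g x * be * (y - x) - be * (f y - f x).
    by rewrite /H; ring.
  (* The constant is generous so that one factor serves both kinds of increments; the last summand
     below is the nonnegative surplus. *)
  apply: le_trans (ler_normB _ _) _; rewrite [X in _ <= X](_ : _ =
    ((`|al| + `|be| * L) * `|g y - g x| + (`|be| * M) * (y - x)) + (`|be| * M) * (y - x)
     + ((`|al| + `|be| * L) * (y - x) + (`|be| * M + `|be| * M) * `|g y - g x|)); last by ring.
  have yx0 : 0 <= y - x by rewrite subr_ge0.
  apply: ler_wpDr.
    by rewrite addr_ge0// mulr_ge0// addr_ge0// mulr_ge0// ltW.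
  apply: lerD; last first.
    by rewrite normrM -mulrA ler_wpM2l// fL.
  apply: le_trans (ler_normD _ _) _; apply: lerD.
    rewrite normrM mulrC ler_wpM2r//.
    rewrite (le_trans (ler_normD _ _))// lerD2l normrM ler_wpM2l//.
    by rewrite ger0_norm// (le_trans x0).
  rewrite !normrM (ger0_norm yx0) ler_wpM2r// mulrC ler_wpM2l//.
  by rewrite gM// x0 (le_trans xy).
have mf2 := measurable_fun_derive2 L0 fg acg.
have mk : measurable_fun `[0, L] (fun t => derive1 (derive1 f) t * (al + be * t)).
  by apply: measurable_funM => //; apply: measurable_funD.
have aek : {ae @lebesgue_measure R, forall t, 0 < t < L ->
    derive1 H t = derive1 (derive1 f) t * (al + be * t)}.
  have [h [_ _]] := abs_continuous_derivable L0 acg.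
  apply: filterS => t ht t0L; have [dg _] := ht t0L.
  rewrite (derivative_on_derive2 fg t0L).
  have dg' : is_derive t 1 g (derive1 g t) by rewrite derive1E; exact: derivableP.
  have df' := derivative_on_is_derive fg t0L.
  have : is_derive t 1 H (derive1 g t * (al + be * t)).
    rewrite /H; apply: is_derive_eq; rewrite !scaler1 /GRing.scale /=; ring.
  by move=> [_ <-]; rewrite derive1E.
have [ik ->] := abs_continuous_FTC2 L0 acH mk aek.
by split => //; rewrite /H; ring.
Qed.

(** * Relations between the edge directions at a vertex *)

(** Spreads a relation between three consecutive vectors over all positions, a form in which
    relations can be subtracted from each other. *)
Lemma sum_pred3 (R : nzRingType) (l : 'I_3 -> R) (u : nat -> R) (m s : nat) :
  (s + 2 < m)%N ->
  \sum_(k < m) (\sum_(r < 3 | (s + r)%N == k) l r) * u k =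
  \sum_(r < 3) l r * u (s + r)%N.
Proof.
move=> sm; under eq_bigr do rewrite mulr_suml.
rewrite (exchange_big_dep xpredT)//=; apply: eq_bigr => r _.
have rm : (s + r < m)%N.
  by rewrite (leq_ltn_trans _ sm)// leq_add2l -ltnS.
rewrite (bigD1 (Ordinal rm))//= big1 ?addr0// => k /andP[/eqP rk].
by rewrite -val_eqE /= rk eqxx.
Qed.

(* Gaussian elimination: [lam s 0 != 0] lets the coefficient [al s] cancel the
   entry of index [s]; what remains is a relation between the last two vectors. *)
Lemma relations_spanned (R : fieldType) (n : nat) (ux uy w : nat -> R)
    (lam : nat -> 'I_3 -> R) :
  (forall s, (s < n)%N -> lam s ord0 != 0) ->
  (forall s, (s < n)%N -> \sum_(r < 3) lam s r * ux (s + r)%N = 0) ->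
  (forall s, (s < n)%N -> \sum_(r < 3) lam s r * uy (s + r)%N = 0) ->
  ux n * uy n.+1 - uy n * ux n.+1 != 0 ->
  \sum_(k < n.+2) w k * ux k = 0 -> \sum_(k < n.+2) w k * uy k = 0 ->
  exists al : nat -> R, forall k, (k < n.+2)%N ->
    w k = \sum_(s < n) al s * \sum_(r < 3 | (s + r)%N == k) lam s r.
Proof.
elim: n ux uy w lam => [|n IH] ux uy w lam lam0 lamx lamy cross wx wy.
  exists (fun=> 0) => k k2; rewrite big_ord0.
  move: wx wy; rewrite !big_ord_recr !big_ord0 /= !add0r => wx wy.
  (* Cramer's rule for two linearly independent vectors. *)
  have w0 : w 0%N = 0.
    apply/eqP; rewrite -(mulIr_eq0 _ (mulIf cross)); apply/eqP.
    transitivity ((w 0%N * ux 0%N + w 1%N * ux 1%N) * uy 1%N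
      - (w 0%N * uy 0%N + w 1%N * uy 1%N) * ux 1%N); first by ring.
    by rewrite wx wy; ring.
  have w1 : w 1%N = 0.
    apply/eqP; rewrite -(mulIr_eq0 _ (mulIf cross)); apply/eqP.
    transitivity ((w 0%N * uy 0%N + w 1%N * uy 1%N) * ux 0%N
      - (w 0%N * ux 0%N + w 1%N * ux 1%N) * uy 0%N); first by ring.
    by rewrite wx wy; ring.
  by move: k k2 => [|[|//]].
pose a0 := w 0%N / lam 0%N ord0.
pose c0 k := \sum_(r < 3 | (0 + r)%N == k) lam 0%N r.
have c00 : c0 0%N = lam 0%N ord0.
  rewrite /c0 (bigD1 ord0)//= big1 ?addr0// => r /andP[/eqP r0].
  by rewrite -val_eqE /= -[X in X != _]add0n r0.
(* The subtraction cancels the entry of index 0; the shifted remainder is a relation with one vector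
   less. *)
pose w' k := w k.+1 - a0 * c0 k.+1.
have key (u : nat -> R) : \sum_(r < 3) lam 0%N r * u (0 + r)%N = 0 ->
    \sum_(k < n.+3) w k * u k = 0 -> \sum_(k < n.+2) w' k * u k.+1 = 0.
  move=> lamu wu.
  have : \sum_(k < n.+3) (w k - a0 * c0 k) * u k = 0.
    under eq_bigr do rewrite mulrBl -mulrA.
    rewrite sumrB wu -mulr_sumr /c0 (@sum_pred3 R (lam 0%N) u n.+3 0)//.
    by rewrite lamu mulr0 subr0.
  rewrite big_ord_recl /= c00 /a0 divfK; last exact: lam0.
  by rewrite subrr mul0r add0r.
have [||||||al alP] := IH (fun k => ux k.+1) (fun k => uy k.+1) w' (fun s => lam s.+1).
- by move=> s sn; exact: lam0.
- by move=> s sn; exact: (lamx s.+1 sn).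
- by move=> s sn; exact: (lamy s.+1 sn).
- exact: cross.
- by apply: key => //; exact: lamx.
- by apply: key => //; exact: lamy.
exists (fun s => if s is s'.+1 then al s' else a0) => k kn.
rewrite big_ord_recl /=.
case: k kn => [_|k kn].
  rewrite -/(c0 0%N) c00 /a0 divfK; last exact: lam0.
  rewrite big1 ?addr0// => s _; rewrite big_pred0 ?mulr0//.
by rewrite -/(c0 k.+1) -[LHS](subrK (a0 * c0 k.+1)) -/(w' k) alP// addrC.
Qed.

Section unit_vectors.
Variable R : realType.
Implicit Types u v w : R * R.

Definition cross u v : R := u.1 * v.2 - u.2 * v.1.

Definition unitary u := u.1 ^+ 2 + u.2 ^+ 2 = 1.

(** Parallel vectors: v is the multiple of u by their inner product [t], and the unit lengths force
    t^2 = 1. *)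
Lemma unitary_cross0 u v : unitary u -> unitary v -> cross u v = 0 ->
  v = u \/ v = (- u.1, - u.2).
Proof.
case: u v => [a b] [c d]; rewrite /unitary /cross /= => uu vv uv.
pose t := a * c + b * d.
have ct : c = t * a.
  rewrite /t -[LHS]mulr1 -uu -[LHS]addr0 -(mulr0 b) -uv; ring.
have dt : d = t * b.
  rewrite /t -[LHS]mulr1 -uu -[LHS]subr0 -(mulr0 a) -uv; ring.
have t1 : t ^+ 2 = 1.
  by rewrite -vv ct dt !exprMn -mulrDr uu mulr1.
move/eqP: t1; rewrite sqrf_eq1 => /orP[] /eqP t1.
  by left; rewrite ct dt t1 !mul1r.
by right; rewrite ct dt t1 !mulN1r.
Qed.

(** The sum of cross products is twice the signed area of the triangle u v w, and a line meets the
    unit circle in at most two points. *)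
Lemma unitary_affine_independent u v w :
  unitary u -> unitary v -> unitary w -> u <> v -> u <> w -> v <> w ->
  cross v w + cross w u + cross u v != 0.
Proof.
move=> uu vv ww uv uw vw; apply/eqP => D0.
case: u v w uu vv ww uv uw vw D0 => [a b] [c d] [e f].
rewrite /unitary /cross /= => uu vv ww uv uw vw D0.
have n0 : (c - a) ^+ 2 + (d - b) ^+ 2 != 0.
  apply/eqP => /eqP; rewrite paddr_eq0 ?sqr_ge0// !sqrf_eq0 !subr_eq0.
  by move=> /andP[/eqP ca /eqP db]; apply: uv; rewrite ca db.
pose N := (c - a) ^+ 2 + (d - b) ^+ 2.
pose t := ((e - a) * (c - a) + (f - b) * (d - b)) / N.
have D0' : (c - a) * (f - b) - (d - b) * (e - a) = 0 by rewrite -D0; ring.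
have et : e - a = t * (c - a).
  apply: (mulIf n0); rewrite /t mulrAC divfK//.
  rewrite -[RHS]subr0 -(mulr0 (d - b)) -D0'; ring.
have ft : f - b = t * (d - b).
  apply: (mulIf n0); rewrite /t mulrAC divfK//.
  rewrite -[RHS]addr0 -(mulr0 (c - a)) -D0'; ring.
clearbody t.
have h1 : 2 * (a * (c - a) + b * (d - b)) + N = 0.
  transitivity ((c ^+ 2 + d ^+ 2) - (a ^+ 2 + b ^+ 2)); first by rewrite /N; ring.
  by rewrite uu vv subrr.
(* On the line through u and v, the point u + t (v - u) is on the circle only for t = 0 and t =
   1. *)
have h2 : t * (t - 1) * N = 0.
  transitivity (2 * (a * (e - a) + b * (f - b)) + ((e - a) ^+ 2 + (f - b) ^+ 2)
     - t * (2 * (a * (c - a) + b * (d - b)) + N)).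
    by rewrite et ft /N; ring.
  rewrite h1 mulr0 subr0.
  transitivity ((e ^+ 2 + f ^+ 2) - (a ^+ 2 + b ^+ 2)); first by ring.
  by rewrite uu ww subrr.
move/eqP: h2; rewrite !mulf_eq0 (negbTE n0) orbF subr_eq0 => /orP[]/eqP t0.
  apply: uw; move: et ft; rewrite t0 !mul0r => /eqP + /eqP.
  by rewrite !subr_eq0 => /eqP-> /eqP->.
apply: vw; move: et ft; rewrite t0 !mul1r.
by move=> /addIr -> /addIr ->.
Qed.

(** Barycentric coordinates of the origin with respect to the triangle u v w, as quotients of
    areas. *)
Lemma unitary_barycentric u v w :
  unitary u -> unitary v -> unitary w -> u <> v -> u <> w -> v <> w ->
  exists l : 'I_3 -> R, [/\ \sum_(r < 3) l r = 1,
    \sum_(r < 3) l r * (tnth [tuple u; v; w] r).1 = 0 &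
    \sum_(r < 3) l r * (tnth [tuple u; v; w] r).2 = 0].
Proof.
move=> uu vv ww uv uw vw; have D0 := unitary_affine_independent uu vv ww uv uw vw.
set D := _ + _ + _ in D0.
exists (fun r => tnth [tuple cross v w / D; cross w u / D; cross u v / D] r).
rewrite !big_ord_recl !big_ord0 !(tnth_nth 0) /=.
split.
- by rewrite addr0 !addrA -!mulrDl divff.
- by rewrite /cross; field.
- by rewrite /cross; field.
Qed.

(** Equality would give cos (x - y) = 1 and hence sin ((x - y) / 2) = 0, while the half angle lies
    strictly between 0 and pi. *)
Lemma cos_sin_inj (x y : R) : y < x < y + 2 * pi -> (cos x, sin x) <> (cos y, sin y).
Proof.
move=> /andP[yx xy] [cxy sxy].
have : cos (x - y) = 1 by rewrite cosB cxy sxy -!expr2 cos2Dsin2.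
have -> : x - y = ((x - y) / 2) *+ 2 by rewrite mulr2n -splitr.
rewrite cos_mulr2n => /eqP.
have : 0 < sin ((x - y) / 2).
  by apply: sin_gt0_pi; rewrite divr_gt0 ?subr_gt0//= ltr_pdivrMr//; lra.
move=> s0; have := cos2Dsin2 ((x - y) / 2) => cs.
have : 0 < sin ((x - y) / 2) ^+ 2 by rewrite exprn_gt0.
by move=> s2 /eqP; rewrite mulr2n; lra.
Qed.

End unit_vectors.

Lemma edge_irrefl (n : nat) (T : {set {set 'I_n}}) (i : 'I_n) : edge i i \notin edges T.
Proof. by rewrite inE /edge ltnn /= ltnn. Qed.

Lemma edgeC (n : nat) (i j : 'I_n) : edge i j = edge j i.
Proof. by rewrite /edge; case: ltngtP => // /val_inj ->. Qed.

Lemma edges_edge (n : nat) (T : {set {set 'I_n}}) (e : 'I_n * 'I_n) :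
  e \in edges T -> edge e.1 e.2 = e.
Proof. by rewrite inE /edge => /andP[-> _]; case: e. Qed.

Lemma mem_neighbours (n : nat) (T : {set {set 'I_n}}) (i j : 'I_n) :
  (j \in neighbours T i) = (i != j) && [exists s in T, (i \in s) && (j \in s)].
Proof.
rewrite !inE /edge; case: (ltngtP i j) => [ij|ji|/val_inj ->] /=.
- by rewrite ij -val_eqE /= ltn_eqF.
- rewrite ji -val_eqE /= gtn_eqF//=.
  by apply: eq_existsb => s; congr (_ && _); rewrite andbC.
- by rewrite ltnn eqxx.
Qed.

Lemma eq_edge (n : nat) (e : 'I_n * 'I_n) (i j : 'I_n) : (e.1 < e.2)%N ->
  (e == edge i j) = ((i == e.1) && (j == e.2)) || ((i == e.2) && (j == e.1)).
Proof.
move=> e12; apply/eqP/orP => [|[]/andP[/eqP-> /eqP->]].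
- by rewrite /edge; case: ltnP => _ -> /=; rewrite !eqxx; [left|right].
- by rewrite /edge e12; case: e {e12}.
- by rewrite edgeC /edge e12; case: e {e12}.
Qed.

Lemma eucl_distC (R : realType) (v w : R * R) : eucl_dist v w = eucl_dist w v.
Proof. by rewrite /eucl_dist; congr Num.sqrt; ring. Qed.

Lemma eucl_dist_sqr (R : realType) (v w : R * R) :
  eucl_dist v w ^+ 2 = (w.1 - v.1) ^+ 2 + (w.2 - v.2) ^+ 2.
Proof. by rewrite sqr_sqrtr// addr_ge0 ?sqr_ge0. Qed.

Lemma eucl_dist_gt0 (R : realType) (v w : R * R) : v <> w -> 0 < eucl_dist v w.
Proof.
move=> vw; rewrite sqrtr_gt0 lt_neqAle addr_ge0 ?sqr_ge0// andbT eq_sym.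
apply/negP; rewrite paddr_eq0 ?sqr_ge0// !sqrf_eq0 !subr_eq0.
by case: v w vw => [a b] [c d] /= vw /andP[/eqP ca /eqP db]; apply: vw; rewrite ca db.
Qed.

Lemma edge_length_gt0 (R : realType) (n : nat) (V : 'I_n -> R * R)
    (T : {set {set 'I_n}}) (e : 'I_n * 'I_n) :
  injective V -> e \in edges T -> 0 < edge_length V e.
Proof.
move=> Vinj; rewrite inE => /andP[e12 _]; apply: eucl_dist_gt0 => /Vinj e12'.
by rewrite e12' ltnn in e12.
Qed.

Lemma unit_dir_unitary (R : realType) (n : nat) (V : 'I_n -> R * R) (i j : 'I_n) :
  injective V -> i != j -> unitary (unit_dir V i j).
Proof.
move=> Vinj ij.
have d0 : 0 < eucl_dist (V i) (V j).
  by apply: eucl_dist_gt0 => /Vinj ij'; rewrite ij' eqxx in ij.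
rewrite /unitary /unit_dir /= !exprMn -mulrDl -eucl_dist_sqr exprVn divff//.
by rewrite sqrf_eq0 gt_eqF.
Qed.

Lemma unit_dirC (R : realType) (n : nat) (V : 'I_n -> R * R) (i j : 'I_n) :
  unit_dir V i j = (- (unit_dir V j i).1, - (unit_dir V j i).2).
Proof. by rewrite /unit_dir eucl_distC /= -!mulNr !opprB. Qed.

Section vertex.
Variables (R : realType) (n : nat) (V : 'I_n -> R * R) (T : {set {set 'I_n}}).
Variable (nb : 'I_n -> seq 'I_n).
Hypothesis V_inj : injective V.
Hypothesis nb_clockwise : clockwise_listing V T nb.
Variable i : 'I_n.

Let m := degree T i.

Let u k := unit_dir V i (nth i (nb i) k).

Lemma size_nb : size (nb i) = m.
Proof. by have [/perm_size -> _] := nb_clockwise i; rewrite -cardE. Qed.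

Lemma nb_uniq : uniq (nb i).
Proof. by have [/perm_uniq -> _] := nb_clockwise i; rewrite enum_uniq. Qed.

Lemma mem_nb j : (j \in nb i) = (j \in neighbours T i).
Proof. by have [/perm_mem -> _] := nb_clockwise i; rewrite mem_enum. Qed.

Lemma nb_nth_neighbours k : (k < m)%N -> nth i (nb i) k \in neighbours T i.
Proof. by move=> km; rewrite -mem_nb mem_nth// size_nb. Qed.

Lemma nb_unitary k : (k < m)%N -> unitary (u k).
Proof.
move=> /nb_nth_neighbours; rewrite mem_neighbours => /andP[ij _].
exact: unit_dir_unitary.
Qed.

Lemma nb_dir_neq k l : (k < l)%N -> (l < m)%N -> u k <> u l.
Proof.
move=> kl lm; have [_ [theta [thetaP /pairwiseP th]]] := nb_clockwise i.
have km := ltn_trans kl lm.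
have dirE k' : (k' < m)%N ->
    u k' = (cos (theta (nth i (nb i) k')), sin (theta (nth i (nb i) k'))).
  move=> k'm; rewrite /u /unit_dir.
  have := nb_nth_neighbours k'm; rewrite -mem_nb => /thetaP[-> ->].
  have := nb_nth_neighbours k'm; rewrite mem_neighbours => /andP[ij _].
  have d0 : eucl_dist (V i) (V (nth i (nb i) k')) != 0.
    by rewrite gt_eqF// eucl_dist_gt0// => /V_inj ij'; rewrite -ij' eqxx in ij.
  by rewrite ![_ * cos _]mulrC ![_ * sin _]mulrC !mulfK.
rewrite !dirE//; apply: cos_sin_inj.
by apply: (th i k l) => //; rewrite inE size_nb.
Qed.

Lemma sum_neighbours (F : 'I_n -> R) :
  \sum_(j in neighbours T i) F j = \sum_(k < m) F (nth i (nb i) k).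
Proof.
have [pm _] := nb_clockwise i.
by rewrite -big_enum -(perm_big _ pm) (big_nth i) size_nb big_mkord.
Qed.

(** The set from which [lambda] is chosen is inhabited, the three directions being different points
    of the unit circle. *)
Lemma lambda_spec s : (s < m - 2)%N ->
  [/\ \sum_(r < 3) lambda V nb i s r = 1,
      \sum_(r < 3) lambda V nb i s r * (u (s + r)%N).1 = 0 &
      \sum_(r < 3) lambda V nb i s r * (u (s + r)%N).2 = 0].
Proof.
rewrite ltn_subRL addnC => s2m; have s1m : (s + 1 < m)%N by lia.
have sm : (s + 0 < m)%N by lia.
rewrite /lambda.
set P := [set l : 'I_3 -> R | _].
suff /getPex : exists l, P l by [].
have [||||||l [l1 lx ly]] := @unitary_barycentric R (u (s + 0)%N) (u (s + 1)%N) (u (s + 2)%N).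
- exact: nb_unitary.
- exact: nb_unitary.
- exact: nb_unitary.
- by apply: nb_dir_neq => //; rewrite ltn_add2l.
- by apply: nb_dir_neq => //; rewrite ltn_add2l.
- by apply: nb_dir_neq => //; rewrite ltn_add2l.
exists l; split => //.
  rewrite -[RHS]lx; apply: eq_bigr => r _; congr (_ * _).
  by rewrite (tnth_nth 0); case: r => -[|[|[|//]]].
rewrite -[RHS]ly; apply: eq_bigr => r _; congr (_ * _).
by rewrite (tnth_nth 0); case: r => -[|[|[|//]]].
Qed.

(** The value at [V i] of B_is on the edge towards [V j]. *)
Definition lambda_coef (s : nat) (j : 'I_n) : R :=
  \sum_(r < 3 | nb_vertex nb i s r == j) lambda V nb i s r.

Lemma lambda_coef_nth s k : (s < m - 2)%N -> (k < m)%N ->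
  lambda_coef s (nth i (nb i) k) =
  \sum_(r < 3 | (s + r)%N == k) lambda V nb i s r.
Proof.
rewrite ltn_subRL addnC => s2m km; apply: eq_bigl => r.
rewrite /nb_vertex nth_uniq ?size_nb ?nb_uniq//.
by rewrite (leq_ltn_trans _ s2m)// leq_add2l -ltnS.
Qed.

(** Each lambda^(s) is a relation between the edge directions, and relations are closed under linear
    combination. *)
Lemma lambda_coef_relation (al : nat -> R) :
  (\sum_(j in neighbours T i)
     (\sum_(s < m - 2) al s * lambda_coef s j) * (unit_dir V i j).1 = 0) /\
  (\sum_(j in neighbours T i)
     (\sum_(s < m - 2) al s * lambda_coef s j) * (unit_dir V i j).2 = 0).
Proof.
have key (c : R * R -> R) :
    (forall s, (s < m - 2)%N -> \sum_(r < 3) lambda V nb i s r * c (u (s + r)%N) = 0) ->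
    \sum_(j in neighbours T i)
     (\sum_(s < m - 2) al s * lambda_coef s j) * c (unit_dir V i j) = 0.
  move=> cP; rewrite sum_neighbours.
  under eq_bigr do rewrite mulr_suml.
  rewrite exchange_big /= big1// => s _.
  under eq_bigr => k _ do rewrite -mulrA lambda_coef_nth//.
  rewrite -mulr_sumr (sum_pred3 (lambda V nb i s) (c \o u)); last first.
    by have := ltn_ord s; rewrite ltn_subRL addnC.
  by rewrite cP// mulr0.
by split; apply: key => s sm; have [] := lambda_spec sm.
Qed.

Hypothesis nb_admissible : admissible_first_edges V T nb.
Hypothesis T_triangulation : triangulation V T.

Lemma exists_triangle : exists s j k, [/\ s \in T, s = [set i; j; k]%SET,
  j \in neighbours T i, k \in neighbours T i & j != k].
Proof.
have [T3 _ cover] := T_triangulation.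
have : i \in (\bigcup_(s in T) s)%SET by rewrite cover inE.
move=> /bigcupP[s sT is_]; have [s3 _] := T3 _ sT.
have := cardsD1 i s; rewrite s3 is_ add1n => -[/esym/eqP].
move=> /cards2P[j [k [jk sjk]]].
have sE : s = [set i; j; k]%SET by rewrite -(finset.setD1K is_) sjk finset.setUA.
exists s, j, k; rewrite !mem_neighbours.
have /andP[ij js] : (j != i) && (j \in s) by have := finset.in_setD1 j s i; rewrite sjk set21 => <-.
have /andP[ik ks] : (k != i) && (k \in s) by have := finset.in_setD1 k s i; rewrite sjk set22 => <-.
rewrite eq_sym ij eq_sym ik; split => //=.
  by apply/existsP; exists s; rewrite sT is_.
by apply/existsP; exists s; rewrite sT is_.
Qed.

Lemma degree_ge2 : (2 <= m)%N.
Proof.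
have [s [j [k [_ _ ij ik jk]]]] := exists_triangle.
have : [set j; k]%SET \subset neighbours T i.
  by apply/fintype.subsetP => l /set2P[]->.
by move=> /subset_leq_card; rewrite cards2 jk.
Qed.

(** This starts the elimination. Different dependent unit vectors are opposite. At degree 2 this
    would put a triangle at [V i] on a line. Otherwise the preceding direction, which has a nonzero
    coefficient in a relation with two opposite vectors, would be parallel to them and so equal to
    one of them. *)
Lemma nb_last_cross : cross (u (m - 2)) (u (m - 2).+1) != 0.
Proof.
have m2 := degree_ge2.
have lt1 : (m - 2 < m)%N by lia.
have lt2 : ((m - 2).+1 < m)%N by lia.
have neq : u (m - 2)%N <> u (m - 2).+1 by exact: nb_dir_neq.
apply/eqP => c0.
have [e|opp] := unitary_cross0 (nb_unitary lt1) (nb_unitary lt2) c0.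
  exact: neq.
have [m_eq2|m_gt2] := eqVneq m 2%N.
  have [s [j [k [sT sE ij ik jk]]]] := exists_triangle.
  have [T3 _ _] := T_triangulation; have [_] := T3 _ sT; apply.
  have col l : l \in neighbours T i -> cross (u 0%N) (unit_dir V i l) = 0.
    rewrite -mem_nb => lnb; rewrite -(nth_index i lnb).
    have : (index l (nb i) < 2)%N by rewrite -m_eq2 -size_nb index_mem.
    case: (index l (nb i)) => [|[|//]] _; first by rewrite /cross mulrC subrr.
    by move: c0; rewrite m_eq2.
  have colV l : l \in neighbours T i -> 
      (u 0%N).1 * ((V l).2 - (V i).2) - (u 0%N).2 * ((V l).1 - (V i).1) = 0.
    move=> il; have := col l il; rewrite /cross /unit_dir /= => /eqP.
    rewrite !mulrA -mulrBl mulf_eq0 => /orP[/eqP//|].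
    rewrite invr_eq0 gt_eqF// eucl_dist_gt0// => /V_inj il'.
    by move: il; rewrite il' inE (negbTE (edge_irrefl _ _)).
  exists (- (u 0%N).2), (u 0%N).1, (- (u 0%N).2 * (V i).1 + (u 0%N).1 * (V i).2).
  split.
    rewrite oppr_eq0 -negb_and; apply/negP => /andP[/eqP u2 /eqP u1].
    have := nb_unitary (leq_trans (ltnSn 0) (ltnW m2)).
    by rewrite /unitary u1 u2 expr0n addr0 => /esym/eqP; rewrite oner_eq0.
  move=> l; rewrite sE !inE => /orP[/orP[]|] /eqP->//.
    by apply/eqP; rewrite -subr_eq0; apply/eqP; rewrite -(colV j ij); ring.
  by apply/eqP; rewrite -subr_eq0; apply/eqP; rewrite -(colV k ik); ring.
have sm : (m - 3 < m - 2)%N by lia.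
have := nb_admissible sm; have [_ lx ly] := lambda_spec sm => /eqP; apply.
set l0 := lambda V nb i _ _ in lx ly *.
pose l1 := lambda V nb i (m - 3) (lift ord0 ord0).
pose l2 := lambda V nb i (m - 3) (lift ord0 (lift ord0 ord0)).
have sum3 (F : nat -> R) : \sum_(r < 3) lambda V nb i (m - 3) r * F r =
    l0 * F 0%N + (l1 * F 1%N + l2 * F 2%N).
  by rewrite !big_ord_recl big_ord0 addr0.
move: lx ly; rewrite (sum3 (fun r => (u (m - 3 + r)%N).1)) (sum3 (fun r => (u (m - 3 + r)%N).2)).
rewrite addn0 (_ : m - 3 + 1 = m - 2)%N; last by lia.
rewrite (_ : m - 3 + 2 = (m - 2).+1)%N; last by lia.
rewrite opp [(_, _).1]/= [(_, _).2]/=; set u1 := u (m - 2)%N; set u0 := u (m - 3)%N.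
move=> lx ly.
(* The cross product with u1 removes the terms in u1 and - u1 from the relation. *)
have : l0 * cross u0 u1 = 0.
  transitivity ((l0 * u0.1 + (l1 * u1.1 + l2 * - u1.1)) * u1.2
     - (l0 * u0.2 + (l1 * u1.2 + l2 * - u1.2)) * u1.1); first by rewrite /cross; ring.
  by rewrite lx ly !mul0r subrr.
move/eqP; rewrite mulf_eq0 => /orP[/eqP//|/eqP c01].
have lt0 : (m - 3 < m)%N by lia.
have [e|e] := unitary_cross0 (nb_unitary lt0) (nb_unitary lt1) c01.
  by have := @nb_dir_neq (m - 3) (m - 2) sm lt1; rewrite e.
have := @nb_dir_neq (m - 3) (m - 2).+1; case; [lia|lia|].
have oppK (v : R * R) : v = (- (- v.1, - v.2).1, - (- v.1, - v.2).2).
  by case: v => a b /=; rewrite !opprK.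
by rewrite opp e; exact: oppK.
Qed.

Lemma vertex_relations_spanned (w : 'I_n -> R) :
  \sum_(j in neighbours T i) w j * (unit_dir V i j).1 = 0 ->
  \sum_(j in neighbours T i) w j * (unit_dir V i j).2 = 0 ->
  exists al : nat -> R, forall j, j \in neighbours T i ->
    w j = \sum_(s < m - 2) al s * lambda_coef s j.
Proof.
rewrite !sum_neighbours => wx wy.
have mm : (m - 2).+2 = m by have := degree_ge2; lia.
have [||||||al alP] := @relations_spanned R (m - 2) (fun k => (u k).1)
  (fun k => (u k).2) (fun k => w (nth i (nb i) k)) (lambda V nb i).
- by move=> s sm; exact: nb_admissible.
- by move=> s /lambda_spec[].
- by move=> s /lambda_spec[].
- exact: nb_last_cross.
- by rewrite mm.
- by rewrite mm.
exists al => j; rewrite -mem_nb => jnb.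
have jm : (index j (nb i) < m)%N by rewrite -size_nb index_mem.
rewrite -(nth_index i jnb) alP ?mm//; apply: eq_bigr => s _.
by rewrite lambda_coef_nth.
Qed.

End vertex.

(** * Networks and edges *)

(** Only the networks centred at the two ends of [e] contribute; each of them is affine along [e]
    and vanishes at the far end. *)
Lemma basic_network_combination (R : realType) (n : nat) (V : 'I_n -> R * R)
    (T : {set {set 'I_n}}) (nb : 'I_n -> seq 'I_n) (al : 'I_n -> nat -> R)
    (m : 'I_n -> nat) (e : 'I_n * 'I_n) (t : R) :
  injective V -> e \in edges T ->
  \sum_(i < n) \sum_(s < m i) al i s * basic_network V nb i s e t =
  (\sum_(s < m e.1) al e.1 s * lambda_coef V nb e.1 s e.2) * (1 - t / edge_length V e) +
  (\sum_(s < m e.2) al e.2 s * lambda_coef V nb e.2 s e.1) * (t / edge_length V e).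
Proof.
move=> Vinj eT; have L0 := edge_length_gt0 Vinj eT.
have e12 : (e.1 < e.2)%N by move: eT; rewrite inE => /andP[].
have ne12 : (e.2 == e.1) = false by apply/negbTE; rewrite -val_eqE /= gtn_eqF.
have basicE i s : basic_network V nb i s e t =
    (if i == e.1 then lambda_coef V nb e.1 s e.2 * (1 - t / edge_length V e) else 0) +
    (if i == e.2 then lambda_coef V nb e.2 s e.1 * (t / edge_length V e) else 0).
  rewrite /basic_network /lambda_coef -mulr_suml /dist_from.
  under eq_bigl do rewrite eq_edge//.
  have [->|i1] := eqVneq i e.1.
    by rewrite [e.1 == e.2]eq_sym ne12 addr0; under eq_bigl do rewrite orbF.
  have [->|i2] := eqVneq i e.2; last by rewrite big_pred0_eq mul0r addr0.
  by rewrite add0r; congr (_ * _); rewrite mulrBl divff ?gt_eqF//; ring.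
under eq_bigr do under eq_bigr do rewrite basicE mulrDr.
under eq_bigr do rewrite big_split.
rewrite big_split /=; congr (_ + _).
  rewrite (bigD1 e.1)//= [X in _ + X]big1 ?addr0; last first.
    by move=> i /negbTE ->; rewrite big1// => s _; rewrite mulr0.
  by rewrite mulr_suml; apply: eq_bigr => s _; rewrite eqxx mulrA.
rewrite (bigD1 e.2)//= [X in _ + X]big1 ?addr0; last first.
  by move=> i /negbTE ->; rewrite big1// => s _; rewrite mulr0.
by rewrite mulr_suml; apply: eq_bigr => s _; rewrite eqxx mulrA.
Qed.

Definition edge_point (R : realType) (n : nat) (V : 'I_n -> R * R)
    (e : 'I_n * 'I_n) (t : R) : R * R :=
  ((1 - t / edge_length V e) * (V e.1).1 + t / edge_length V e * (V e.2).1,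
   (1 - t / edge_length V e) * (V e.1).2 + t / edge_length V e * (V e.2).2).

Lemma induced_networkE (R : realType) (n : nat) (V : 'I_n -> R * R)
    (F : R * R -> R) (e : 'I_n * 'I_n) (t : R) :
  induced_network V F e t = F (edge_point V e t).
Proof. by []. Qed.

Section edge_geometry.
Variables (R : realType) (n : nat) (V : 'I_n -> R * R) (T : {set {set 'I_n}}).
Hypothesis V_inj : injective V.
Variable e : 'I_n * 'I_n.
Hypothesis eT : e \in edges T.
Let L := edge_length V e.
Let L_gt0 : 0 < L := edge_length_gt0 V_inj eT.

Lemma edge_point0 : edge_point V e 0 = V e.1.
Proof. by rewrite /edge_point mul0r subr0 !mul1r !mul0r !addr0 -surjective_pairing. Qed.

Lemma edge_pointL : edge_point V e L = V e.2.
Proof.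
by rewrite /edge_point divff ?gt_eqF// subrr !mul0r !mul1r !add0r -surjective_pairing.
Qed.

Lemma edge_pointB (s t : R) :
  (edge_point V e s).1 - (edge_point V e t).1 = (s - t) * (unit_dir V e.1 e.2).1 /\
  (edge_point V e s).2 - (edge_point V e t).2 = (s - t) * (unit_dir V e.1 e.2).2.
Proof.
rewrite /edge_point /unit_dir -/(edge_length V e) -/L /=.
by split; ring.
Qed.

Lemma edge_dir_unitary : unitary (unit_dir V e.1 e.2).
Proof.
apply: unit_dir_unitary => //; move: eT; rewrite inE => /andP[+ _].
by apply: contraTneq => ->; rewrite ltnn.
Qed.

Lemma eucl_dist_edge_point (s t : R) :
  eucl_dist (edge_point V e t) (edge_point V e s) = `|s - t|.
Proof.
have [h1 h2] := edge_pointB s t; rewrite /eucl_dist h1 h2.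
move: (unit_dir V e.1 e.2) edge_dir_unitary => u; rewrite /unitary => uu.
by rewrite !exprMn -mulrDr uu mulr1 sqrtr_sqr.
Qed.

Lemma edge_triangle : exists2 s, s \in T & (e.1 \in s) && (e.2 \in s).
Proof.
move: eT; rewrite inE => /andP[_ /existsP[s /andP[sT es]]].
by exists s.
Qed.

Lemma edge_point_hull (s : {set 'I_n}) (t : R) :
  e.1 \in s -> e.2 \in s -> 0 <= t <= L -> hull V s (edge_point V e t).
Proof.
move=> e1 e2 /andP[t0 tL].
have e12 : e.1 != e.2.
  by move: eT; rewrite inE => /andP[+ _]; apply: contraTneq => ->; rewrite ltnn.
pose c i := (1 - t / L) * (i == e.1)%:R + t / L * (i == e.2)%:R.
have sumc (f : 'I_n -> R) : \sum_(i in s) c i * f i = (1 - t / L) * f e.1 + t / L * f e.2.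
  under eq_bigr do rewrite mulrDl.
  rewrite big_split /=; congr (_ + _).
    rewrite (bigD1 e.1)//= eqxx mulr1 big1 ?addr0// => i /andP[_ /negbTE ->].
    by rewrite mulr0 mul0r.
  rewrite (bigD1 e.2)//= eqxx mulr1 big1 ?addr0// => i /andP[_ /negbTE ->].
  by rewrite mulr0 mul0r.
exists c; split.
- move=> i _; rewrite /c addr_ge0// mulr_ge0// ?divr_ge0 ?(ltW L_gt0)//.
  by rewrite subr_ge0 ler_pdivrMr// mul1r.
- have := sumc (fun=> 1); rewrite !mulr1 subrK => <-.
  by apply: eq_bigr => i _; rewrite mulr1.
- by rewrite !sumc.
Qed.

Lemma edge_point_domain (t : R) : 0 <= t <= L -> domain V T (edge_point V e t).
Proof.
have [s sT /andP[e1 e2]] := edge_triangle.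
by move=> tL; exists s => //; exact: edge_point_hull.
Qed.

(** The Euclidean distance of two edge points is the distance of their parameters, so the quotient
    in [gradient_on] is, up to sign, the error of the difference quotient along the edge. *)
Lemma gradient_derivative_on (F : R * R -> R) (G : R * R -> R * R) :
  gradient_on (domain V T) F G ->
  derivative_on 0 L (induced_network V F e)
    (fun t => (G (edge_point V e t)).1 * (unit_dir V e.1 e.2).1 +
              (G (edge_point V e t)).2 * (unit_dir V e.1 e.2).2).
Proof.
move=> FG t tL; have Dt := edge_point_domain tL.
apply/cvgrPdist_le => eps eps0.
have /cvgrPdist_le/(_ _ eps0) FGt := FG _ Dt.
have {FGt}/nbhs_ballP[d d0 dP] : nbhs (edge_point V e t) (fun v =>
    v != edge_point V e t -> domain V T v ->
    `|0 - (F v - F (edge_point V e t) -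
      ((G (edge_point V e t)).1 * (v.1 - (edge_point V e t).1) +
       (G (edge_point V e t)).2 * (v.2 - (edge_point V e t).2))) /
      eucl_dist (edge_point V e t) v| <= eps) by exact: FGt.
exists d => // s std st sab.
have {}std : `|t - s| < d := std.
have {sab} sL : 0 <= s <= L by move: sab; rewrite /= in_itv.
have := eucl_dist_edge_point s t; have [] := edge_pointB s t.
have Ds := edge_point_domain sL.
rewrite !induced_networkE.
move: (edge_point V e t) (edge_point V e s) Dt Ds dP => w v Dw Dv dP.
move: (unit_dir V e.1 e.2) edge_dir_unitary => u u1 h1 h2 dist.
have st0 : s - t != 0 by rewrite subr_eq0.
(* Balls of the plane are taken in the max norm, so each coordinate is bounded separately. *)
have close (a b : R) : a ^+ 2 + b ^+ 2 = 1 -> `|(s - t) * a| < d.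
  move=> ab; rewrite distrC in std; apply: le_lt_trans std.
  rewrite normrM ler_piMr// -(@ler_pXn2r _ 2)// ?nnegrE// expr1n real_normK ?num_real//.
  by rewrite -ab lerDl sqr_ge0.
have : ball w d v.
  split; rewrite -ball_normE /= distrC ?h1 ?h2.
    exact: close u1.
  by apply: (close _ u.1); rewrite addrC.
move=> /dP/(_ _ Dv); rewrite h1 h2 dist sub0r normrN => H.
have {}H : `|(F v - F w - ((G w).1 * ((s - t) * u.1) + (G w).2 * ((s - t) * u.2))) / `|s - t| |
    <= eps.
  apply: H; apply/eqP => vw; move: dist; rewrite vw /eucl_dist !subrr expr0n addr0 sqrtr0.
  by move=> /esym/eqP; rewrite normr_eq0 (negbTE st0).
rewrite normrM normfV normr_id in H.
apply: le_trans H; rewrite le_eqVlt -normfV -normrM distrC.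
by apply/orP; left; apply/eqP; congr `|_|; field.
Qed.

End edge_geometry.

(** Limits along a proper filter are unique; this filter is proper because a < b leaves points of
    [a, b] near t on at least one side. *)
Lemma derivative_on_unique (R : realType) (a b : R) (f g h : R -> R) (t : R) :
  a < b -> derivative_on a b f g -> derivative_on a b f h -> a <= t <= b -> g t = h t.
Proof.
move=> ab fg fh tab; have gt := fg _ tab; have ht := fh _ tab.
have PF : ProperFilter (within `[a, b]%classic t^').
  apply: Build_ProperFilter_ex => P [d /= d0 dP]; move: tab => /andP[at_ tb].
  have [tb'|bt] := ltP t b.
    pose r := Num.min d (b - t).
    have r0 : 0 < r by rewrite lt_min d0 subr_gt0.
    have [rd rb] : r <= d /\ r <= b - t by rewrite !ge_min !lexx orbT.
    exists (t + r / 2); apply: dP.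
    - by rewrite /= opprD addNKr normrN gtr0_norm ?divr_gt0//; lra.
    - by rewrite -subr_eq0 addrAC subrr add0r gt_eqF// divr_gt0.
    - by rewrite /= in_itv /=; apply/andP; split; lra.
  pose r := Num.min d (b - a).
  have r0 : 0 < r by rewrite lt_min d0 subr_gt0.
  have [rd rb] : r <= d /\ r <= b - a by rewrite !ge_min !lexx orbT.
  exists (t - r / 2); apply: dP.
  - by rewrite /= opprB addrC subrK gtr0_norm ?divr_gt0//; lra.
  - by rewrite -subr_eq0 addrAC subrr add0r oppr_eq0 gt_eqF// divr_gt0.
  - by rewrite /= in_itv /=; apply/andP; split; lra.
exact: (cvg_unique _ gt ht).
Qed.

(** Each edge yields two ordered pairs (vertex, neighbour), one for each end. *)
Lemma sum_edges (R : realType) (n : nat) (T : {set {set 'I_n}}) (h : 'I_n -> 'I_n -> R) :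
  \sum_(e in edges T) (h e.1 e.2 + h e.2 e.1) =
  \sum_(i < n) \sum_(j in neighbours T i) h i j.
Proof.
rewrite pair_big_dep /= [RHS](bigID (fun e : 'I_n * 'I_n => (e.1 < e.2)%N)) /=.
rewrite big_split /=; congr (_ + _).
  apply: eq_bigl => -[i j] /=; rewrite !inE /edge.
  by case: (ltnP i j) => ij /=; rewrite ?ij ?andbT ?andbF.
rewrite [RHS](reindex_inj (h := fun e : 'I_n * 'I_n => (e.2, e.1))) /=; last first.
  by move=> [a b] [c d] [-> ->].
apply: eq_bigl => -[i j] /=; rewrite !inE /edge.
case: (ltngtP j i) => [ji|ij|/val_inj ->] /=; rewrite ?andbF ?andbT ?ltnn//.
by rewrite ij.
Qed.

(** * Powers and convexity *)

Section signed_power.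
Variable R : realType.
Implicit Types x y r p q a b : R.

Lemma signed_pow0 r : signed_pow (0 : R) r = 0.
Proof. by rewrite /signed_pow sgr0 mulr0. Qed.

Lemma signed_powN x r : signed_pow (- x) r = - signed_pow x r.
Proof. by rewrite /signed_pow normrN sgrN mulrN. Qed.

Lemma signed_pow_gt0 x r : 0 < x -> signed_pow x r = x `^ r.
Proof. by move=> x0; rewrite /signed_pow gtr0_sg// mulr1 gtr0_norm. Qed.

Lemma norm_signed_pow_le x r : `|signed_pow x r| <= `|x| `^ r.
Proof.
rewrite /signed_pow normrM ger0_norm ?powR_ge0// ler_piMr ?powR_ge0//.
by rewrite normr_sg lern1 leq_b1.
Qed.

Lemma signed_powK r s : r * s = 1 ->
  cancel (signed_pow (R := R) ^~ r) (signed_pow (R := R) ^~ s).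
Proof.
move=> rs x /=.
wlog x0 : x / 0 <= x.
  move=> H; have [/H//|/ltW x0] := leP 0 x.
  by apply: oppr_inj; rewrite -!signed_powN H// oppr_ge0.
move: x0; rewrite le_eqVlt => /predU1P[<-|x0]; first by rewrite !signed_pow0.
by rewrite (signed_pow_gt0 _ x0) signed_pow_gt0 ?powR_gt0// -powRrM rs powRr1 ?ltW.
Qed.

Lemma continuous_signed_pow r : 0 < r -> continuous (signed_pow (R := R) ^~ r).
Proof.
move=> r0.
have pos x : 0 < x -> {for x, continuous (signed_pow (R := R) ^~ r)}.
  move=> x0; have cx : {for x, continuous (fun y : R => y `^ r)}.
    apply: differentiable_continuous; apply/derivable1_diffP.
    by apply: derivable_powR; rewrite in_itv /= x0.
  rewrite /prop_for /continuous_at signed_pow_gt0//.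
  apply: cvg_trans cx; apply: near_eq_cvg; near=> y.
  by rewrite signed_pow_gt0//; near: y; exact: lt_nbhsr.
move=> x; have [x0|x0|->] := ltgtP x 0; last 1 first.
- rewrite /continuous_at signed_pow0; apply/cvgrPdist_le => e e0.
  exists (e `^ r^-1); first by rewrite /= powR_gt0.
  move=> y; rewrite /= !sub0r !normrN => ye.
  apply: le_trans (norm_signed_pow_le _ _) _.
  rewrite -[leRHS](powRr1 (ltW e0)) -(mulVf (lt0r_neq0 r0)) powRrM.
  by apply: ge0_ler_powR; rewrite ?nnegrE ?powR_ge0//; exact: ltW.
- have -> : signed_pow (R := R) ^~ r = (fun y => - signed_pow (- y) r).
    by apply/funext => y; rewrite signed_powN opprK.
  apply: cvgN; apply: (@continuous_comp _ _ _ (fun y : R => - y) (signed_pow (R := R) ^~ r)).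
    exact: opp_continuous.
  by apply: pos; rewrite oppr_gt0.
- exact: pos.
Unshelve. all: by end_near. Qed.

(** The sum is at most twice the larger term; this crude form suffices for sums in L_p and for
    majorants. *)
Lemma powR_add_le x y p : 0 <= x -> 0 <= y -> 0 <= p ->
  (x + y) `^ p <= (2 * x) `^ p + (2 * y) `^ p.
Proof.
move=> x0 y0 p0; have [xy|yx] := leP x y.
  apply: (@le_trans _ _ ((2 * y) `^ p)); last by rewrite lerDr powR_ge0.
  by rewrite ge0_ler_powR ?nnegrE//; lra.
apply: (@le_trans _ _ ((2 * x) `^ p)); last by rewrite lerDl powR_ge0.
by rewrite ge0_ler_powR ?nnegrE//; lra.
Qed.

Lemma powR_le1D x p q : 0 <= x -> 0 <= p -> p <= q -> x `^ p <= 1 + x `^ q.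
Proof.
move=> x0 p0 pq; have [x1|x1] := leP x 1.
  apply: (@le_trans _ _ 1); last by rewrite lerDl powR_ge0.
  by have := @ge0_ler_powR _ p p0 x 1; rewrite !nnegrE powR1; exact.
apply: (@le_trans _ _ (x `^ q)); last by rewrite lerDr.
by rewrite ler_powR// ltW.
Qed.

(* The tangent inequality of the convex function [|x|^p], by Young's inequality. *)
Lemma powR_tangent a b p : 1 < p ->
  `|a| `^ p + p * (signed_pow a (p - 1) * (b - a)) <= `|b| `^ p.
Proof.
move=> p1; have p0 : 0 < p by exact: lt_trans p1.
have aa : signed_pow a (p - 1) * a = `|a| `^ p.
  by rewrite /signed_pow -mulrA -normrEsg mulrC mulr_powRB1.
have p10 : 0 < p - 1 by rewrite subr_gt0.
have young := @conjugate_powR _ (`|a| `^ (p - 1)) `|b| (p / (p - 1)) p.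
have {}young : `|a| `^ (p - 1) * `|b| <= `|a| `^ p * ((p - 1) / p) + `|b| `^ p / p.
  have e1 : (`|a| `^ (p - 1)) `^ (p / (p - 1)) = `|a| `^ p.
    by rewrite -powRrM mulrC divfK// gt_eqF.
  rewrite -{1}e1 -[(p - 1) / p]invf_div; apply: young => //.
  - by rewrite divr_gt0.
  - by rewrite invf_div -[X in _ + X]mul1r -mulrDl subrK divff// gt_eqF.
have ab : signed_pow a (p - 1) * b <= `|a| `^ (p - 1) * `|b|.
  apply: le_trans (ler_norm _) _; rewrite normrM ler_wpM2r//.
  exact: norm_signed_pow_le.
have {young ab} := le_trans ab young.
rewrite -(ler_pM2l p0) mulrDr mulrBr aa => H.
have e2 : p * (`|a| `^ p * ((p - 1) / p)) = (p - 1) * `|a| `^ p.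
  by field; rewrite gt_eqF.
have e3 : p * (`|b| `^ p / p) = `|b| `^ p by field; rewrite gt_eqF.
by move: H; rewrite e2 e3; lra.
Qed.

End signed_power.

(** * Functions of class L_p on a set of finite measure *)

Section variation.
Variables (R : realType) (D : set R) (p : R).
Hypothesis mD : measurable D.
Hypothesis D_fin : (@lebesgue_measure R D < +oo)%E.
Hypothesis p1 : 1 < p.
Let mu : {measure set (measurableTypeR R) -> \bar R} := @lebesgue_measure R.

(** Concerns the values on [D] only, whereas [Lfun] is applied to the extension by zero. *)
Definition Lp (a : R -> R) :=
  measurable_fun D a /\ mu.-integrable D (EFin \o (fun t => `|a t| `^ p)).

Lemma integrable_cst_on (c : R) : mu.-integrable D (EFin \o (fun=> c)).
Proof.
apply: measurable_bounded_integrable => //.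
exists `|c|; split; first exact: num_real.
by move=> x cx t _ /=; exact: ltW.
Qed.

Lemma integrable_onD (f g : R -> R) :
  mu.-integrable D (EFin \o f) -> mu.-integrable D (EFin \o g) ->
  mu.-integrable D (EFin \o (fun t => f t + g t)).
Proof. by move=> If Ig; exact: (integrableD _ If Ig). Qed.

Lemma integrable_onZ (c : R) (f : R -> R) :
  mu.-integrable D (EFin \o f) -> mu.-integrable D (EFin \o (fun t => c * f t)).
Proof. by move=> If; exact: (integrableZl _ c If). Qed.

Lemma le_integrable_on (f g : R -> R) : measurable_fun D f ->
  (forall t, D t -> `|f t| <= g t) -> mu.-integrable D (EFin \o g) ->
  mu.-integrable D (EFin \o f).
Proof.
move=> mf fg; apply: le_integrable => //.
- exact/measurable_EFinP.
- by move=> t /fg fgt /=; rewrite lee_fin (le_trans fgt)// ler_norm.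
Qed.

Lemma measurable_powR_norm (a : R -> R) (r : R) : measurable_fun D a ->
  measurable_fun D (fun t => `|a t| `^ r).
Proof.
move=> ma; apply: (measurableT_comp (f := fun x : R => x `^ r)).
  exact: measurable_powR.
exact: measurableT_comp.
Qed.

Lemma Lp_bounded (b : R -> R) (M : R) : measurable_fun D b ->
  (forall t, D t -> `|b t| <= M) -> Lp b.
Proof.
move=> mb bM; split => //.
apply: (@le_integrable_on _ (fun=> `|M| `^ p)).
- exact: measurable_powR_norm.
- move=> t Dt; rewrite ger0_norm ?powR_ge0// ge0_ler_powR ?nnegrE//.
    by rewrite (le_trans _ (ltW p1)).
  by rewrite (le_trans (bM _ Dt))// ler_norm.
- exact: integrable_cst_on.
Qed.

Lemma LpZ (a : R -> R) (c : R) : Lp a -> Lp (fun t => c * a t).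
Proof.
move=> [ma ia]; split; first exact: measurable_funM.
under eq_fun do rewrite normrM powRM//.
exact: integrable_onZ.
Qed.

Lemma LpD (a b : R -> R) : Lp a -> Lp b -> Lp (fun t => a t + b t).
Proof.
move=> La Lb; have [ma _] := La; have [mb _] := Lb.
split; first exact: measurable_funD.
have [_ ia] := LpZ 2 La; have [_ ib] := LpZ 2 Lb.
apply: (@le_integrable_on _ (fun t => `|2 * a t| `^ p + `|2 * b t| `^ p)).
- by apply: measurable_powR_norm; exact: measurable_funD.
- move=> t Dt; rewrite ger0_norm ?powR_ge0//.
  have p0 : 0 <= p by rewrite (le_trans _ (ltW p1)).
  apply: (@le_trans _ _ ((`|a t| + `|b t|) `^ p)).
    by rewrite ge0_ler_powR ?nnegrE ?addr_ge0// ler_normD.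
  by rewrite (le_trans (powR_add_le _ _ _))// !normrM ger0_norm.
- exact: integrable_onD.
Qed.

Lemma Lp_ae_eq (a b : R -> R) : Lp a -> measurable_fun D b ->
  {ae mu, forall t, D t -> a t = b t} -> Lp b.
Proof.
move=> [ma ia] mb ab; split => //.
apply: (@ae_eq_integrable _ _ (fun t => `|a t| `^ p)) ia => //.
  exact: measurable_powR_norm.
by apply: filterS ab => t abt Dt; rewrite abt.
Qed.

Lemma Lp_integrableM (a b : R -> R) (M : R) : Lp a -> measurable_fun D b ->
  (forall t, D t -> `|b t| <= M) -> mu.-integrable D (EFin \o (fun t => a t * b t)).
Proof.
move=> [ma ia] mb bM.
apply: (@le_integrable_on _ (fun t => `|M| * (1 + `|a t| `^ p))).
- exact: measurable_funM.
- move=> t Dt; rewrite normrM mulrC ler_pM//; first by rewrite (le_trans (bM t Dt))// ler_norm.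
  by rewrite -{1}[`|a t|]powRr1// powR_le1D// ltW.
- by apply/integrable_onZ/integrable_onD => //; exact: integrable_cst_on.
Qed.

Lemma signed_pow_integrableM (a b : R -> R) (M : R) : Lp a -> measurable_fun D b ->
  (forall t, D t -> `|b t| <= M) ->
  mu.-integrable D (EFin \o (fun t => signed_pow (a t) (p - 1) * b t)).
Proof.
move=> [ma ia] mb bM.
have p10 : 0 < p - 1 by rewrite subr_gt0.
apply: (@le_integrable_on _ (fun t => `|M| * (1 + `|a t| `^ p))).
- apply: measurable_funM => //.
  apply: (measurableT_comp (f := signed_pow (R := R) ^~ (p - 1))) => //.
  by apply: continuous_measurable_fun; exact: continuous_signed_pow.
- move=> t Dt; rewrite normrM mulrC ler_pM//; first by rewrite (le_trans (bM t Dt))// ler_norm.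
  apply: le_trans (norm_signed_pow_le _ _) _.
  by rewrite powR_le1D ?(ltW p10)// gerBl.
- by apply/integrable_onZ/integrable_onD => //; exact: integrable_cst_on.
Qed.

(** Dominated convergence: since |x|^(p-1) <= 1 + |x|^p and the steps 1/(k+1) are at most 1, all
    integrands lie below the single function [g]. *)
Lemma cvg_variation (a b : R -> R) (M : R) : Lp a -> measurable_fun D b ->
  (forall t, D t -> `|b t| <= M) ->
  \int[mu]_(t in D) (signed_pow (a t + k.+1%:R^-1 * b t) (p - 1) * b t) @[k --> \oo] -->
  \int[mu]_(t in D) (signed_pow (a t) (p - 1) * b t).
Proof.
move=> La mb bM; have [ma ia] := La.
have p10 : 0 < p - 1 by rewrite subr_gt0.
have p0 : 0 <= p by rewrite (le_trans _ (ltW p1)).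
have mphi : measurable_fun setT (signed_pow (R := R) ^~ (p - 1)).
  by apply: continuous_measurable_fun; exact: continuous_signed_pow.
pose f k t := signed_pow (a t + k.+1%:R^-1 * b t) (p - 1) * b t.
pose g t := `|M| * (1 + (`|2 * a t| `^ p + `|2 * M| `^ p)).
have mf k : measurable_fun D (EFin \o f k).
  apply/measurable_EFinP; apply: measurable_funM => //.
  apply: (measurableT_comp (f := signed_pow (R := R) ^~ (p - 1))) => //.
  by apply: measurable_funD => //; exact: measurable_funM.
have fcvg t : D t -> (EFin \o f k) t @[k --> \oo] --> (signed_pow (a t) (p - 1) * b t)%:E.
  move=> Dt; apply: cvg_EFin; first exact: nearW.
  apply: cvgMl.
  rewrite -[X in signed_pow X _]addr0 -(mul0r (b t)).
  apply: (@cvg_comp _ _ _ (fun k : nat => a t + k.+1%:R^-1 * b t)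
     (signed_pow (R := R) ^~ (p - 1)) _ (nbhs (a t + 0 * b t))).
    apply: cvgD; first exact: cvg_cst.
    by apply: cvgMl; exact: cvg_harmonic.
  exact: continuous_signed_pow.
have ig : mu.-integrable D (EFin \o g).
  apply/integrable_onZ/integrable_onD; first exact: integrable_cst_on.
  apply: integrable_onD; last exact: integrable_cst_on.
  by have [] := LpZ 2 La.
have fg t k : D t -> (`|(EFin \o f k) t| <= (EFin \o g) t)%E.
  move=> Dt; rewrite /= lee_fin /f /g normrM mulrC ler_pM//.
    by rewrite (le_trans (bM t Dt))// ler_norm.
  apply: le_trans (norm_signed_pow_le _ _) _.
  apply: (@le_trans _ _ (1 + `|a t + k.+1%:R^-1 * b t| `^ p)).
    by rewrite powR_le1D ?(ltW p10)// gerBl.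
  rewrite lerD2l; apply: (@le_trans _ _ ((`|a t| + `|M|) `^ p)).
    rewrite ge0_ler_powR ?nnegrE ?addr_ge0//.
    rewrite (le_trans (ler_normD _ _))// lerD2l normrM.
    rewrite (@le_trans _ _ `|b t|)//; last by rewrite (le_trans (bM t Dt))// ler_norm.
    by rewrite ler_piMl// ger0_norm// invf_le1// ler1n.
  by rewrite (le_trans (powR_add_le _ _ _))// !normrM ger0_norm.
have aefcvg : {ae mu, forall t, D t -> (EFin \o f k) t @[k --> \oo] -->
    (signed_pow (a t) (p - 1) * b t)%:E} by exact: (aeW mu fcvg).
have aefg : {ae mu, forall t k, D t -> (`|(EFin \o f k) t| <= (EFin \o g) t)%E}.
  by exact: (aeW mu fg).
have [iphi _ cvgI] := @dominated_convergence _ _ _ mu D mD (fun k => EFin \o f k)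
  (EFin \o (fun t => signed_pow (a t) (p - 1) * b t)) (EFin \o g) mf
  (measurable_int _ (signed_pow_integrableM La mb bM))
  aefcvg ig aefg.
have fin_int := integrable_fin_num (_ : measurable (D : set (measurableTypeR R))) iphi.
by apply: fine_cvg; rewrite /Rintegral fineK; [exact: cvgI|exact: fin_int].
Qed.

End variation.

(** * The variational problem *)

(** [w i j] is the value at [V i] on the edge towards [V j], so the two end values of an edge belong
    to the two orders of its ends. *)
Definition affine_network (R : realType) (n : nat) (V : 'I_n -> R * R)
    (w : 'I_n -> 'I_n -> R) : network R n :=
  fun e t => w e.1 e.2 * (1 - t / edge_length V e) + w e.2 e.1 * (t / edge_length V e).

Definition edge_regular (R : realType) (n : nat) (V : 'I_n -> R * R)
    (F : R * R -> R) (e : 'I_n * 'I_n) : Prop :=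
  exists2 g, derivative_on 0 (edge_length V e) (induced_network V F e) g &
    abs_continuous 0 (edge_length V e) g.

(** The boundary terms of the integrations by parts are directional derivatives at the vertices.
    Both ends of an edge contribute with the same sign once directions point away from the vertex,
    and all edges at a vertex share one gradient. *)
Lemma integral_second_derivative_affine (R : realType) (n : nat) (V : 'I_n -> R * R)
    (T : {set {set 'I_n}}) (F : R * R -> R) (G : R * R -> R * R) (w : 'I_n -> 'I_n -> R) :
  injective V -> gradient_on (domain V T) F G ->
  (forall e, e \in edges T -> edge_regular V F e) ->
  \sum_(e in edges T) \int[@lebesgue_measure R]_(t in `[0, edge_length V e])
     (second_derivative (induced_network V F) e t * affine_network V w e t) =
  - (\sum_(i < n) \sum_(j in neighbours T i)
      w i j * ((G (V i)).1 * (unit_dir V i j).1 + (G (V i)).2 * (unit_dir V i j).2))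
  - \sum_(e in edges T) (w e.2 e.1 - w e.1 e.2) / edge_length V e * (F (V e.2) - F (V e.1)).
Proof.
move=> V_inj FG Freg; rewrite -sum_edges -sumrN -sumrB; apply: eq_bigr => e eT.
have [g fg acg] := Freg e eT; have L0 := edge_length_gt0 V_inj eT.
have gE t : 0 <= t <= edge_length V e -> g t =
    (G (edge_point V e t)).1 * (unit_dir V e.1 e.2).1 +
    (G (edge_point V e t)).2 * (unit_dir V e.1 e.2).2.
  exact: (derivative_on_unique L0 fg (gradient_derivative_on V_inj eT FG)).
have g0 := gE 0; rewrite lexx (ltW L0) edge_point0 in g0.
have gL := gE (edge_length V e); rewrite lexx (ltW L0) (edge_pointL V_inj eT) in gL.
pose be := (w e.2 e.1 - w e.1 e.2) / edge_length V e.
have [_] := integral_derive2_affine (w e.1 e.2) be (ltW L0) fg acg.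
rewrite !induced_networkE edge_point0 (edge_pointL V_inj eT) g0// gL//.
have -> : w e.1 e.2 + be * edge_length V e = w e.2 e.1.
  by rewrite /be divfK ?gt_eqF// addrC subrK.
have [-> ->] : (unit_dir V e.2 e.1).1 = - (unit_dir V e.1 e.2).1 /\
    (unit_dir V e.2 e.1).2 = - (unit_dir V e.1 e.2).2.
  by rewrite (unit_dirC V e.2 e.1).
move=> H; transitivity (\int[@lebesgue_measure R]_(t in `[0, edge_length V e])
    (derive1 (derive1 (induced_network V F e)) t * (w e.1 e.2 + be * t))).
  apply: eq_Rintegral => t _; congr (_ * _).
  by rewrite /affine_network /be; field; rewrite gt_eqF.
by rewrite H -/be; ring.
Qed.

Lemma Lfun_restrictP (R : realType) (D : set R) (p : R) (h : R -> R) :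
  measurable D -> 1 < p -> measurable_fun D h ->
  (h \_ D \in Lfun (@lebesgue_measure R) p%:E) <-> Lp D p h.
Proof.
move=> mD p1 mh.
have p0 : p != 0 by rewrite gt_eqF// (lt_trans _ p1).
have restrE : (fun t => (`|(h \_ D) t| `^ p)%:E) = (EFin \o (fun t => `|h t| `^ p)) \_ D.
  apply/funext => t; rewrite /patch; case: ifPn => // _.
  by rewrite normr0 powR0.
split.
  move=> hL; split => //.
  have := Lfun_integrable (ltW p1) hL; rewrite restrE.
  by move=> /(integrable_mkcond _ (_ : measurable (D : set (measurableTypeR R))))-/(_ mD).
move=> [_ ih].
have mhD : measurable_fun setT (h \_ D) by apply/(measurable_restrictT _ mD).
apply/andP; split; rewrite inE//.
rewrite /= /finite_norm unlock /=.
apply: poweR_lty.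
rewrite restrE -integral_mkcond.
have /integrableP[mh'] := ih.
apply: le_lt_trans; apply: ge0_le_integral => //.
- by move=> t _; rewrite lee_fin powR_ge0.
- exact: measurableT_comp.
- by move=> t _; rewrite /= lee_fin ler_norm.
Qed.

(** Monotonicity of the power 1/p, in an abstract setting: [x] stands for a network, [y] for a
    function on the domain, and [I y x] says that [y] induces [x] on the edges. *)
Lemma ereal_inf_powRP (R : realType) (X Y : Type) (N : X -> \bar R) (S : Y -> Prop)
    (I : Y -> X -> Prop) (E : Y -> R) (p : R) (x0 : X) (y0 : Y) :
  0 < p -> (forall y, 0 <= E y) -> (forall y, exists x, I y x) ->
  (forall x y, S y -> I y x -> N x = ((E y) `^ p^-1)%:E) -> S y0 -> I y0 x0 ->
  (N x0 = ereal_inf [set N x | x in [set x | exists2 y, S y & I y x]]) <->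
  (forall y, S y -> E y0 <= E y).
Proof.
move=> p0 E0 Iex NE Sy0 Ixy0; rewrite (NE _ _ Sy0 Ixy0); split.
  move=> minE y Sy; have [x Iyx] := Iex y.
  have : ((E y0 `^ p^-1)%:E <= (E y `^ p^-1)%:E)%E.
    rewrite minE -(NE _ _ Sy Iyx); apply: ereal_inf_lbound.
    by exists x => //; exists y.
  rewrite lee_fin => H; have := ge0_ler_powR (ltW p0) _ _ H.
  by rewrite !nnegrE !powR_ge0 -!powRrM mulVf ?gt_eqF// !powRr1//; exact.
move=> minE; apply/eqP; rewrite eq_le; apply/andP; split.
  apply: le_ereal_inf_tmp => _ [x [y Sy Iyx] <-].
  rewrite (NE _ _ Sy Iyx) lee_fin; apply: ge0_ler_powR.
  - by rewrite invr_ge0 ltW.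
  - by rewrite nnegrE.
  - by rewrite nnegrE.
  - exact: minE.
apply: ereal_inf_lbound; exists x0; first by exists y0.
exact: NE.
Qed.

Section problem.
Variables (R : realType) (n : nat) (V : 'I_n -> R * R) (z : 'I_n -> R).
Variables (T : {set {set 'I_n}}) (p : R).
Hypothesis V_inj : injective V.
Hypothesis p1 : 1 < p.
Let mu : {measure set (measurableTypeR R) -> \bar R} := @lebesgue_measure R.
Let D2 F := second_derivative (induced_network V F).

Definition edge_itv e : set R := `[0, edge_length V e]%classic.

Lemma measurable_edge_itv e : measurable (edge_itv e).
Proof. exact: measurable_itv. Qed.

Lemma edge_itv_finite e : (@lebesgue_measure R (edge_itv e) < +oo)%E.
Proof. by rewrite /edge_itv lebesgue_measure_itv; case: ifPn => // _; rewrite -EFinB ltry. Qed.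

Lemma smooth_interpolant_regular F e : smooth_interpolant V z T p F ->
  e \in edges T -> edge_regular V F e.
Proof. by move=> [_ _ Fe] /Fe[[g fg acg] _]; exists g. Qed.

Lemma measurable_D2 F e : e \in edges T -> edge_regular V F e ->
  measurable_fun (edge_itv e) (D2 F e).
Proof.
move=> eT [g fg acg].
exact: (measurable_fun_derive2 (ltW (edge_length_gt0 V_inj eT)) fg acg).
Qed.

Lemma smooth_interpolant_Lp F e : smooth_interpolant V z T p F ->
  e \in edges T -> Lp (edge_itv e) p (D2 F e).
Proof.
move=> sF eT; have Freg := smooth_interpolant_regular sF eT.
have [_ _ /(_ e eT)[_ H]] := sF.
by have [+ _] := Lfun_restrictP (measurable_edge_itv e) p1 (measurable_D2 eT Freg); exact.
Qed.

(** The p-th power of the norm as a real number, which keeps roots and infinite values out of the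
    variational arguments. *)
Definition energy F : R :=
  \sum_(e in edges T) \int[mu]_(t in edge_itv e) (`|D2 F e t| `^ p).

Lemma energy_ge0 F : 0 <= energy F.
Proof.
by apply: sumr_ge0 => e _; apply: Rintegral_ge0 => t _; exact: powR_ge0.
Qed.

Lemma ae_edge_itv e (P : R -> Prop) :
  (forall t, 0 < t < edge_length V e -> P t) ->
  {ae mu, forall t, edge_itv e t -> P t}.
Proof.
move=> HP.
have neq c : {ae mu, forall x, x != c}.
  exists [set c]; split; [exact: measurable_set1|exact: lebesgue_measure_set1|].
  by move=> x /= /negP; rewrite negbK => /eqP.
have := neq 0; have := neq (edge_length V e).
apply: filterS2 => t tL t0; rewrite /edge_itv /= in_itv /= => /andP[h1 h2].
by apply: HP; rewrite !lt_neqAle h1 h2 tL eq_sym t0.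
Qed.

Lemma second_derivative_induced (f : network R n) F e t : 
  (forall t, 0 <= t <= edge_length V e -> f e t = induced_network V F e t) ->
  0 < t < edge_length V e -> second_derivative f e t = D2 F e t.
Proof.
move=> fF tL; apply: near_eq_derive1; apply: (near_in_itv_oo tL) => s sL.
apply: near_eq_derive1; apply: (near_in_itv_oo sL) => r /andP[/ltW r0 /ltW rL].
by apply: fF; rewrite r0.
Qed.

Lemma network_norm_energy (f : network R n) F : smooth_interpolant V z T p F ->
  (forall e t, e \in edges T -> 0 <= t <= edge_length V e ->
     f e t = induced_network V F e t) ->
  network_norm V T p (second_derivative f) = ((energy F) `^ p^-1)%:E.
Proof.
move=> sF fF; rewrite /network_norm /energy -poweR_EFin; congr (_ `^ _)%E.
rewrite -sumEFin; apply: eq_bigr => e eT.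
have [mD iD] := smooth_interpolant_Lp sF eT.
have L0 := edge_length_gt0 V_inj eT.
have fin_int := integrable_fin_num (_ : measurable (edge_itv e : set (measurableTypeR R))) iD.
rewrite /Rintegral fineK; last by apply: fin_int; exact: measurable_edge_itv.
have moo : measurable_fun `]0, edge_length V e[ (D2 F e).
  by apply: measurable_funS mD => //; [exact: measurable_itv|exact: subset_itv_oo_cc].
have ff t : 0 < t < edge_length V e -> second_derivative f e t = D2 F e t.
  by apply: second_derivative_induced => s; exact: fF.
have mfoo : measurable_fun `]0, edge_length V e[ (second_derivative f e).
  apply: eq_measurable_fun moo => t; rewrite inE /= in_itv /= => tL.
  by rewrite ff.
(* The two networks agree on the closed edge only, so their second derivatives are compared on the
   open one. *)
apply: (@eq_integral_itv_bounded _ 0 (edge_length V e) (fun t => `|D2 F e t| `^ p)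
   (fun t => `|second_derivative f e t| `^ p) true false).
- exact: (measurable_powR_norm p mfoo).
- exact: (measurable_powR_norm p moo).
- by move=> t; rewrite in_itv /= => /ff ->.
Qed.

Lemma minimal_energyP (Fstar : network R n) (F0 : R * R -> R) :
  smooth_interpolant V z T p F0 ->
  (forall e t, e \in edges T -> 0 <= t <= edge_length V e ->
     Fstar e t = induced_network V F0 e t) ->
  (network_norm V T p (second_derivative Fstar) =
    ereal_inf [set network_norm V T p (second_derivative F)
              | F in smooth_network V z T p]) <->
  (forall F, smooth_interpolant V z T p F -> energy F0 <= energy F).
Proof.
move=> sF0 F0E; have p0 := lt_trans ltr01 p1.
apply: (@ereal_inf_powRP R (network R n) (R * R -> R)
  (fun f => network_norm V T p (second_derivative f)) (smooth_interpolant V z T p)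
  (fun F f => forall e t, e \in edges T -> 0 <= t <= edge_length V e ->
     f e t = induced_network V F e t) energy p Fstar F0 p0 energy_ge0) => //.
- by move=> F; exists (induced_network V F).
- by move=> f F sF fF; exact: network_norm_energy.
Qed.

End problem.

(** * Integrated tangent inequalities *)

Section variation_inequalities.
Variables (R : realType) (D : set R) (p q : R).
Hypothesis mD : measurable D.
Hypothesis D_fin : (@lebesgue_measure R D < +oo)%E.
Hypothesis p1 : 1 < p.
Let mu : {measure set (measurableTypeR R) -> \bar R} := @lebesgue_measure R.

Lemma ae_eq_Rintegral (f g : R -> R) : measurable_fun D f -> measurable_fun D g ->
  {ae mu, forall t, D t -> f t = g t} ->
  \int[mu]_(t in D) f t = \int[mu]_(t in D) g t.
Proof.
move=> mf mg fg; congr fine; apply: ae_eq_integral => //.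
- exact/measurable_EFinP.
- exact/measurable_EFinP.
- by apply: filterS fg => t fgt Dt /=; rewrite fgt.
Qed.

(** The tangent inequality at [a], whose slope is p W because the signed powers q - 1 and p - 1 are
    inverse to each other. *)
Lemma integral_powR_ge (a b W : R -> R) (M : R) : (q - 1) * (p - 1) = 1 ->
  Lp D p a -> Lp D p b -> measurable_fun D W -> (forall t, D t -> `|W t| <= M) ->
  {ae mu, forall t, D t -> a t = signed_pow (W t) (q - 1)} ->
  \int[mu]_(t in D) (`|a t| `^ p) +
    p * (\int[mu]_(t in D) (b t * W t) - \int[mu]_(t in D) (a t * W t)) <=
  \int[mu]_(t in D) (`|b t| `^ p).
Proof.
move=> qp La Lb mW WM aW.
have p10 : 0 < p - 1 by rewrite subr_gt0.
have q10 : 0 < q - 1 by rewrite -(pmulr_lgt0 _ p10) qp.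
(* The pointwise inequality needs the slope at every point, so [a] is replaced by a function equal
   to it almost everywhere. *)
pose a' t := signed_pow (W t) (q - 1).
have ma' : measurable_fun D a'.
  apply: (measurableT_comp (f := signed_pow (R := R) ^~ (q - 1))) => //.
  by apply: continuous_measurable_fun; exact: continuous_signed_pow.
have La' : Lp D p a' by apply: Lp_ae_eq aW.
have [ma ia] := La; have [mb ib] := Lb; have [_ ia'] := La'.
have aE : \int[mu]_(t in D) (`|a t| `^ p) = \int[mu]_(t in D) (`|a' t| `^ p).
  apply: ae_eq_Rintegral; [exact: measurable_powR_norm|exact: measurable_powR_norm|].
  by apply: filterS aW => t H Dt; rewrite (H Dt).
have aWE : \int[mu]_(t in D) (a t * W t) = \int[mu]_(t in D) (a' t * W t).
  apply: ae_eq_Rintegral; [exact: measurable_funM|exact: measurable_funM|].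
  by apply: filterS aW => t H Dt; rewrite (H Dt).
have iaW := Lp_integrableM mD D_fin p1 La' mW WM.
have ibW := Lp_integrableM mD D_fin p1 Lb mW WM.
rewrite aE aWE -RintegralB//.
have idiff : mu.-integrable D (EFin \o (fun t => b t * W t - a' t * W t)).
  exact: (integrableB _ ibW iaW).
have ipdiff := integrable_onZ mD p idiff.
have mD' : measurable (D : set (measurableTypeR R)) := mD.
rewrite -(RintegralZl p mD' idiff) -(RintegralD mD' ia' ipdiff).
apply: (le_Rintegral mD' (integrable_onD mD ia' ipdiff) ib) => t Dt.
have := @powR_tangent _ (a' t) (b t) p p1.
rewrite {2}/a' (signed_powK qp).
by congr (_ <= _); ring.
Qed.

(** The tangent inequality at the perturbed point, evaluated at [a], bounds the increment from
    above. *)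
Lemma integral_powR_variation (a b : R -> R) (M c : R) : 0 <= c ->
  Lp D p a -> measurable_fun D b -> (forall t, D t -> `|b t| <= M) ->
  \int[mu]_(t in D) (`|a t + c * b t| `^ p) - \int[mu]_(t in D) (`|a t| `^ p) <=
  p * c * \int[mu]_(t in D) (signed_pow (a t + c * b t) (p - 1) * b t).
Proof.
move=> c0 La mb bM.
have Lb := Lp_bounded mD D_fin p1 mb bM.
have Lab := LpD mD p1 La (LpZ mD c Lb).
have iphi := signed_pow_integrableM mD D_fin p1 Lab mb bM.
have [_ ia] := La; have [_ iab] := Lab.
rewrite -RintegralB// -RintegralZl//.
apply: le_Rintegral => //.
- exact: (integrableB _ iab ia).
- exact: (integrableZl _ (p * c) iphi).
- move=> t Dt; have := @powR_tangent _ (a t + c * b t) (a t) p p1.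
  set A := `|_| `^ p; set B := `|_| `^ p; set S := signed_pow _ _.
  have -> : p * (S * (a t - (a t + c * b t))) = - (p * c * (S * b t)) by ring.
  by lra.
Qed.

End variation_inequalities.

Section combination.
Variable R : realType.

Lemma derivative_onD (a b c : R) (f f' g g' : R -> R) :
  derivative_on a b f f' -> derivative_on a b g g' ->
  derivative_on a b (fun t => f t + c * g t) (fun t => f' t + c * g' t).
Proof.
move=> ff' gg' t tab; have ft := ff' t tab; have gt := gg' t tab.
have H := cvgD ft (cvgMr (a := c) gt).
rewrite (_ : (fun s => _) = (fun s => (f s - f t) / (s - t) + c * ((g s - g t) / (s - t)))).
  exact: H.
by apply/funext => s; ring.
Qed.

Lemma abs_continuousD (a b c : R) (f g : R -> R) :
  abs_continuous a b f -> abs_continuous a b g ->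
  abs_continuous a b (fun t => f t + c * g t).
Proof.
move=> acf acg eps eps0.
have e1 : 0 < eps / 2 by rewrite divr_gt0.
have C0 : 0 < `|c| + 1 by rewrite ltr_wpDl.
have e2 : 0 < eps / 2 / (`|c| + 1) by rewrite !divr_gt0.
have [d1 d10 H1] := acf _ e1; have [d2 d20 H2] := acg _ e2.
exists (Num.min d1 d2); first by rewrite lt_min d10.
move=> m x y xy tI; rewrite lt_min => /andP[lt1 lt2].
have {}H1 := H1 m x y xy tI lt1; have {}H2 := H2 m x y xy tI lt2.
apply: (@le_lt_trans _ _ (\sum_(k < m) (`|f (y k) - f (x k)| +
    (`|c| + 1) * `|g (y k) - g (x k)|))).
  apply: ler_sum => k _.
  have -> : f (y k) + c * g (y k) - (f (x k) + c * g (x k)) =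
    (f (y k) - f (x k)) + c * (g (y k) - g (x k)) by ring.
  rewrite (le_trans (ler_normD _ _))// lerD2l normrM ler_wpM2r//.
  by rewrite lerDl.
rewrite big_split /= -mulr_sumr [ltRHS]splitr ltrD//.
by rewrite mulrC -ltr_pdivlMr.
Qed.

Lemma gradient_onD (D : set (R * R)) (c : R) (F P : R * R -> R) (G H : R * R -> R * R) :
  gradient_on D F G -> gradient_on D P H ->
  gradient_on D (fun v => F v + c * P v)
    (fun v => ((G v).1 + c * (H v).1, (G v).2 + c * (H v).2)).
Proof.
move=> FG PH w Dw; have Fw := FG w Dw; have Pw := PH w Dw.
have := cvgD Fw (cvgMr (a := c) Pw); rewrite mulr0 addr0 => FPw.
rewrite (_ : (fun v => _) = (fun v =>
  (F v - F w - ((G w).1 * (v.1 - w.1) + (G w).2 * (v.2 - w.2))) / eucl_dist w v +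
  c * ((P v - P w - ((H w).1 * (v.1 - w.1) + (H w).2 * (v.2 - w.2))) / eucl_dist w v))).
  exact: FPw.
by apply/funext => v; rewrite [(_, _).1]/= [(_, _).2]/=; ring.
Qed.

Lemma continuous_pairP (D : set (R * R)) (G : R * R -> R * R) :
  {within D, continuous G} <->
  {within D, continuous (fun v => (G v).1)} /\ {within D, continuous (fun v => (G v).2)}.
Proof.
split.
  move=> cG; split => w.
    by apply: (@continuous_comp (subspace D) _ _ G fst); [exact: cG|exact: cvg_fst].
  by apply: (@continuous_comp (subspace D) _ _ G snd); [exact: cG|exact: cvg_snd].
move=> [c1 c2] w.
have -> : G = (fun v => ((G v).1, (G v).2)) by apply/funext => v; case: (G v).
exact: cvg_pair (c1 w) (c2 w).
Qed.

End combination.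

Section first_variation.
Variables (R : realType) (n : nat) (V : 'I_n -> R * R) (z : 'I_n -> R).
Variables (T : {set {set 'I_n}}) (p : R).
Hypothesis V_inj : injective V.
Hypothesis p1 : 1 < p.
Let mu : {measure set (measurableTypeR R) -> \bar R} := @lebesgue_measure R.
Local Notation D2 F := (second_derivative (induced_network V F)).

(* A test function [P]; [b] stands for its second derivatives along the edges. *)
Definition admissible_variation (P : R * R -> R) (b : 'I_n * 'I_n -> R -> R) : Prop :=
  [/\ forall i, P (V i) = 0,
      exists2 G : R * R -> R * R, gradient_on (domain V T) P G &
        {within domain V T, continuous G},
      forall e, e \in edges T -> edge_regular V P e &
      forall e, e \in edges T -> [/\ measurable_fun (edge_itv V e) (b e),
        exists M, forall t, edge_itv V e t -> `|b e t| <= M &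
        {ae mu, forall t, edge_itv V e t -> D2 P e t = b e t}]].

(** Additivity is available where both first derivatives are differentiable, which is almost
    everywhere by absolute continuity. *)
Lemma ae_D2D F P c e : e \in edges T -> edge_regular V F e -> edge_regular V P e ->
  {ae mu, forall t, edge_itv V e t ->
    D2 (fun v => F v + c * P v) e t = D2 F e t + c * D2 P e t}.
Proof.
move=> eT [f ff acf] [g gg acg]; have L0 := edge_length_gt0 V_inj eT.
have h1 := ae_derivable_derive1 (ltW L0) ff acf.
have h2 := ae_derivable_derive1 (ltW L0) gg acg.
have h3 : {ae mu, forall t, edge_itv V e t -> 0 < t < edge_length V e}.
  exact: ae_edge_itv.
have := h1; have := h2; have := h3; apply: filterS3 => t h3t h2t h1t /h3t tL.
have der F' f' : derivative_on 0 (edge_length V e) (induced_network V F' e) f' ->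
    derivable (derive1 (induced_network V F' e)) t 1 -> is_derive t 1 f' (D2 F' e t).
  move=> ff' dF'; rewrite /second_derivative derive1E.
  apply: near_eq_is_derive (derivableP dF').
  by apply: (near_in_itv_oo tL) => s; exact: derivative_on_derive1.
have [_ <-] : is_derive t 1 (fun t => f t + c * g t) (D2 F e t + c * D2 P e t).
  have d1 := der _ _ ff (h1t tL); have d2 := der _ _ gg (h2t tL).
  exact: (is_deriveD d1 (is_deriveZ c d2)).
by rewrite -derive1E; exact: (derivative_on_derive2 (derivative_onD (c := c) ff gg) tL).
Qed.

Lemma smooth_interpolantD F P b c : smooth_interpolant V z T p F ->
  admissible_variation P b -> smooth_interpolant V z T p (fun v => F v + c * P v).
Proof.
move=> sF [PV [H PH cH] Preg Pb]; have [FV [G FG cG] FL] := sF.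
have reg e : e \in edges T -> edge_regular V (fun v => F v + c * P v) e.
  move=> eT; have [f ff acf] := smooth_interpolant_regular sF eT.
  have [g gg acg] := Preg e eT; exists (fun t => f t + c * g t).
    exact: derivative_onD.
  exact: abs_continuousD.
split.
- by move=> i; rewrite PV mulr0 addr0.
- exists (fun v => ((G v).1 + c * (H v).1, (G v).2 + c * (H v).2)).
    exact: gradient_onD.
  move: cG cH => /continuous_pairP[G1 G2] /continuous_pairP[H1 H2].
  apply/continuous_pairP; split => w /=.
    by apply: cvgD; [exact: G1|apply: cvgMr; exact: H1].
  by apply: cvgD; [exact: G2|apply: cvgMr; exact: H2].
- move=> e eT; split; first by have [g] := reg e eT; exists g.
  apply/(Lfun_restrictP (measurable_edge_itv V e) p1 (measurable_D2 V_inj eT (reg e eT))).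
  have [mb [M bM] Pbe] := Pb e eT.
  have LF := smooth_interpolant_Lp V_inj p1 sF eT.
  have Lb := Lp_bounded (measurable_edge_itv V e) (edge_itv_finite V e) p1 mb bM.
  have mE := measurable_edge_itv V e.
  apply: (Lp_ae_eq mE (LpD mE p1 LF (LpZ mE c Lb))).
    exact: (measurable_D2 V_inj eT (reg e eT)).
  have := ae_D2D c eT (smooth_interpolant_regular sF eT) (Preg e eT); have := Pbe.
  by apply: filterS2 => t H1 H2 Et; rewrite (H2 Et) (H1 Et).
Qed.

(** Minimality against F + c sg P, divided by p c, makes the integral at the perturbed function
    nonnegative; then c = 1/(k+1) tends to 0. The values 1 and -1 of [sg] will give both signs of
    the variation. *)
Lemma first_variation_ge0 F P b sg : smooth_interpolant V z T p F ->
  (forall F', smooth_interpolant V z T p F' -> energy V T p F <= energy V T p F') ->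
  admissible_variation P b ->
  0 <= \sum_(e in edges T) \int[mu]_(t in edge_itv V e)
         (signed_pow (D2 F e t) (p - 1) * (sg * b e t)).
Proof.
move=> sF minF aP; have [_ _ Preg Pb] := aP.
have p0 : 0 < p := lt_trans ltr01 p1.
have Psg e : e \in edges T -> measurable_fun (edge_itv V e) (fun t => sg * b e t) /\
    exists M, forall t, edge_itv V e t -> `|sg * b e t| <= M.
  move=> eT; have [mb [M bM] Pbe] := Pb e eT; split; first exact: measurable_funM.
  by exists (`|sg| * M) => t Et; rewrite normrM ler_wpM2l// bM.
have cvgS : \sum_(e in edges T) \int[mu]_(t in edge_itv V e)
    (signed_pow (D2 F e t + k.+1%:R^-1 * (sg * b e t)) (p - 1) * (sg * b e t)) @[k --> \oo] -->
    \sum_(e in edges T) \int[mu]_(t in edge_itv V e)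
         (signed_pow (D2 F e t) (p - 1) * (sg * b e t)).
  apply: cvg_big => [|e eT]; first exact: add_continuous.
  have [mb [M bM]] := Psg e eT.
  exact: (cvg_variation (measurable_edge_itv V e) (edge_itv_finite V e) p1
    (smooth_interpolant_Lp V_inj p1 sF eT) mb bM).
rewrite -(cvg_lim _ cvgS)//; apply: limr_ge; first by apply/cvg_ex; eexists; exact: cvgS.
apply: nearW => k; set c := k.+1%:R^-1.
have c0 : 0 < c by rewrite invr_gt0.
have sFc := smooth_interpolantD (c * sg) sF aP.
have := minF _ sFc.
rewrite -subr_ge0 => /le_trans; rewrite -(pmulr_rge0 _ (mulr_gt0 p0 c0)); apply.
rewrite /energy -sumrB mulr_sumr; apply: ler_sum => e eT.
have [_ _ Pbe] := Pb e eT; have [mb [M bM]] := Psg e eT.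
have mE := measurable_edge_itv V e.
have LF := smooth_interpolant_Lp V_inj p1 sF eT.
apply: le_trans (integral_powR_variation mE (edge_itv_finite V e) p1 (ltW c0) LF mb bM).
rewrite lerD2r le_eqVlt; apply/orP; left; apply/eqP.
have [mF _] := LF; have [mFc _] := smooth_interpolant_Lp V_inj p1 sFc eT.
apply: (ae_eq_Rintegral mE).
- exact: measurable_powR_norm.
- exact: (measurable_powR_norm p (measurable_funD mF (measurable_funM (measurable_cst c) mb))).
- have := ae_D2D (c * sg) eT (smooth_interpolant_regular sF eT) (Preg e eT); have := Pbe.
  by apply: filterS2 => t H1 H2 Et; rewrite (H2 Et) (H1 Et) mulrA.
Qed.

Lemma first_variation_eq0 F P b : smooth_interpolant V z T p F ->
  (forall F', smooth_interpolant V z T p F' -> energy V T p F <= energy V T p F') ->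
  admissible_variation P b ->
  \sum_(e in edges T) \int[mu]_(t in edge_itv V e)
    (signed_pow (D2 F e t) (p - 1) * b e t) = 0.
Proof.
move=> sF minF aP.
set S := \sum_(e in edges T) _.
have SE sg : \sum_(e in edges T) \int[mu]_(t in edge_itv V e)
         (signed_pow (D2 F e t) (p - 1) * (sg * b e t)) = sg * S.
  rewrite mulr_sumr; apply: eq_bigr => e eT.
  have [_ _ _ /(_ e eT)[mb [M bM] _]] := aP.
  have iphi := signed_pow_integrableM (measurable_edge_itv V e) (edge_itv_finite V e) p1
    (smooth_interpolant_Lp V_inj p1 sF eT) mb bM.
  rewrite -RintegralZl//; last exact: measurable_edge_itv.
  by apply: eq_Rintegral => t _; ring.
have := first_variation_ge0 1 sF minF aP; have := first_variation_ge0 (-1) sF minF aP.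
rewrite !SE mul1r mulN1r oppr_ge0 => S0 S1; apply/eqP.
by rewrite eq_le S0 S1.
Qed.

End first_variation.

(** * Separation of the edges *)

Section edge_coefficients.
Variables (R : realType) (n : nat) (V : 'I_n -> R * R) (T : {set {set 'I_n}}).
Hypothesis V_inj : injective V.

(** Barycentric coordinates of [edge_point V e t] with respect to any triangle containing both
    ends. *)
Definition edge_coef (e : 'I_n * 'I_n) (t : R) (i : 'I_n) : R :=
  (1 - t / edge_length V e) * (i == e.1)%:R + t / edge_length V e * (i == e.2)%:R.

Lemma sum_edge_coef e t (s : {set 'I_n}) (f : 'I_n -> R) : e.1 \in s -> e.2 \in s ->
  \sum_(i in s) edge_coef e t i * f i =
  (1 - t / edge_length V e) * f e.1 + t / edge_length V e * f e.2.
Proof.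
move=> e1 e2; under eq_bigr do rewrite mulrDl.
rewrite big_split /=; congr (_ + _).
  rewrite (bigD1 e.1)//= eqxx mulr1 big1 ?addr0// => i /andP[_ /negbTE ->].
  by rewrite mulr0 mul0r.
rewrite (bigD1 e.2)//= eqxx mulr1 big1 ?addr0// => i /andP[_ /negbTE ->].
by rewrite mulr0 mul0r.
Qed.

Lemma edge_coef_support e t i : edge_coef e t i != 0 -> i = e.1 \/ i = e.2.
Proof.
have [->|i1] := eqVneq i e.1; first by left.
have [->|i2] := eqVneq i e.2; first by right.
by rewrite /edge_coef (negbTE i1) (negbTE i2) !mulr0 addr0 eqxx.
Qed.

Lemma edge_coef_gt0 e t : e \in edges T -> 0 < t < edge_length V e ->
  0 < edge_coef e t e.1 /\ 0 < edge_coef e t e.2.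
Proof.
move=> eT /andP[t0 tL]; have L0 := edge_length_gt0 V_inj eT.
have ne12 : (e.2 == e.1) = false.
  by move: eT; rewrite inE -val_eqE /= => /andP[e12 _]; rewrite gtn_eqF.
rewrite /edge_coef !eqxx ne12 [e.1 == e.2]eq_sym ne12 !mulr0 !mulr1 addr0 add0r.
by rewrite subr_gt0 ltr_pdivrMr// mul1r divr_gt0.
Qed.

Hypothesis T_triangulation : triangulation V T.

(** The differences of the coordinates solve a homogeneous 2 x 2 system whose determinant [X] is, up
    to sign, twice the area of the triangle. *)
Lemma barycentric_unique s (c c' : 'I_n -> R) : s \in T ->
  \sum_(i in s) c i = \sum_(i in s) c' i ->
  \sum_(i in s) c i * (V i).1 = \sum_(i in s) c' i * (V i).1 ->
  \sum_(i in s) c i * (V i).2 = \sum_(i in s) c' i * (V i).2 ->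
  forall i, i \in s -> c i = c' i.
Proof.
move=> sT cc cc1 cc2 i is_.
have [T3 _ _] := T_triangulation; have [s3 ncol] := T3 _ sT.
have := cardsD1 i s; rewrite s3 is_ add1n => -[/esym/eqP].
move=> /cards2P[j [k [jk sjk]]].
have sumE (f : 'I_n -> R) : \sum_(l in s) f l = f i + (f j + f k).
  rewrite (big_setD1 i)//= sjk big_setU1 ?inE//= big_set1//.
pose d l := c l - c' l.
have d0 : d i + (d j + d k) = 0.
  by rewrite -sumE sumrB cc subrr.
have d1 : d j * ((V j).1 - (V i).1) + d k * ((V k).1 - (V i).1) = 0.
  transitivity (\sum_(l in s) d l * (V l).1 - (d i + (d j + d k)) * (V i).1).
    by rewrite (sumE (fun l => d l * (V l).1)); ring.
  rewrite d0 mul0r subr0; under eq_bigr do rewrite mulrBl.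
  by rewrite sumrB cc1 subrr.
have d2 : d j * ((V j).2 - (V i).2) + d k * ((V k).2 - (V i).2) = 0.
  transitivity (\sum_(l in s) d l * (V l).2 - (d i + (d j + d k)) * (V i).2).
    by rewrite (sumE (fun l => d l * (V l).2)); ring.
  rewrite d0 mul0r subr0; under eq_bigr do rewrite mulrBl.
  by rewrite sumrB cc2 subrr.
pose X := ((V j).1 - (V i).1) * ((V k).2 - (V i).2) - ((V j).2 - (V i).2) * ((V k).1 - (V i).1).
have X0 : X != 0.
  apply/eqP => X0; apply: ncol.
  exists (- ((V j).2 - (V i).2)), ((V j).1 - (V i).1),
    (- ((V j).2 - (V i).2) * (V i).1 + ((V j).1 - (V i).1) * (V i).2); split.
    rewrite oppr_eq0 !subr_eq0 -negb_and; apply/negP => /andP[/eqP e2 /eqP e1].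
    have ji : V j = V i by case: (V j) (V i) e1 e2 => ? ? [? ?] /= -> ->.
    have /setD1P[] : j \in s :\ i by rewrite sjk set21.
    by rewrite (V_inj ji) eqxx.
  move=> l ls; have [->|li] := eqVneq l i; first by ring.
  have : l \in s :\ i by rewrite !inE li.
  rewrite sjk !inE => /orP[]/eqP->; first by ring.
  by apply/eqP; rewrite -subr_eq0 -X0 /X; apply/eqP; ring.
have dj : d j = 0.
  apply/eqP; rewrite -(mulIr_eq0 _ (mulIf X0)); apply/eqP.
  transitivity ((d j * ((V j).1 - (V i).1) + d k * ((V k).1 - (V i).1)) * ((V k).2 - (V i).2)
    - (d j * ((V j).2 - (V i).2) + d k * ((V k).2 - (V i).2)) * ((V k).1 - (V i).1)).
    by rewrite /X; ring.
  by rewrite d1 d2 !mul0r subrr.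
have dk : d k = 0.
  apply/eqP; rewrite -(mulIr_eq0 _ (mulIf X0)); apply/eqP.
  transitivity ((d j * ((V j).2 - (V i).2) + d k * ((V k).2 - (V i).2)) * ((V j).1 - (V i).1)
    - (d j * ((V j).1 - (V i).1) + d k * ((V k).1 - (V i).1)) * ((V j).2 - (V i).2)).
    by rewrite /X; ring.
  by rewrite d1 d2 !mul0r subrr.
by move: d0; rewrite dj dk !addr0 => /eqP; rewrite subr_eq0 => /eqP.
Qed.

(** In a common triangle the coordinates of a point of [e'] vanish except at the ends of [e'];
    positivity at the ends of [e] makes them ends of [e'], and the ordering of index pairs does the
    rest. *)
Lemma edge_coef_unique e e' t' s (c : 'I_n -> R) : e \in edges T -> e' \in edges T ->
  0 < c e.1 -> 0 < c e.2 ->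
  s \in T -> e.1 \in s -> e.2 \in s -> e'.1 \in s -> e'.2 \in s ->
  \sum_(i in s) c i = 1 ->
  edge_point V e' t' = (\sum_(i in s) c i * (V i).1, \sum_(i in s) c i * (V i).2) ->
  e = e'.
Proof.
move=> eT eT' c1 c2 sT e1 e2 e1' e2' sumc [ptx pty].
have cE : forall i, i \in s -> c i = edge_coef e' t' i.
  apply: barycentric_unique => //.
  - have := sum_edge_coef t' (fun=> 1) e1' e2'.
    by rewrite !mulr1 subrK sumc; under eq_bigr do rewrite mulr1.
  - by rewrite sum_edge_coef.
  - by rewrite sum_edge_coef.
have h1 : e.1 = e'.1 \/ e.1 = e'.2.
  by apply: (@edge_coef_support _ t'); rewrite -cE// gt_eqF.
have h2 : e.2 = e'.1 \/ e.2 = e'.2.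
  by apply: (@edge_coef_support _ t'); rewrite -cE// gt_eqF.
move: eT eT'; rewrite !inE => /andP[lt12 _] /andP[lt12' _].
case: e e' h1 h2 lt12 lt12' {c1 c2 e1 e2 e1' e2' ptx pty cE} => [a b] [a' b'] /=.
move=> [->|->] [->|->]; rewrite ?ltnn// => lt1 lt2.
by move: (ltn_trans lt1 lt2); rewrite ltnn.
Qed.

(** Reduction to one common triangle. The hulls of the two triangles share the point. If they shared
    one vertex only, both ends of [e] would be that vertex; if they share an edge, the coordinates
    are supported on it, so both triangles contain the ends of [e]. *)
Lemma open_edge_unique e e' t t' : e \in edges T -> e' \in edges T ->
  0 < t < edge_length V e -> 0 <= t' <= edge_length V e' ->
  edge_point V e t = edge_point V e' t' -> e = e'.
Proof.
move=> eT eT' tL tL' pt.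
have tL0 : 0 <= t <= edge_length V e by case/andP: tL => /ltW -> /ltW ->.
have [c1 c2] := edge_coef_gt0 eT tL.
have [s sT /andP[e1 e2]] := edge_triangle eT.
have [s' sT' /andP[e1' e2']] := edge_triangle eT'.
have hs := edge_point_hull V_inj eT e1 e2 tL0.
have hs' := edge_point_hull V_inj eT' e1' e2' tL'.
rewrite -pt in hs'.
have sum1 : \sum_(i in s) edge_coef e t i = 1.
  have := sum_edge_coef t (fun=> 1) e1 e2.
  by rewrite !mulr1 subrK; under eq_bigr do rewrite mulr1.
have ptE : edge_point V e t =
    (\sum_(i in s) edge_coef e t i * (V i).1, \sum_(i in s) edge_coef e t i * (V i).2).
  by rewrite !sum_edge_coef.
have [ss'|ss'] := eqVneq s s'.
  subst s'; apply: (edge_coef_unique (t' := t') eT eT' c1 c2 sT) => //.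
  by rewrite -pt.
have [_ T2 _] := T_triangulation.
case: (T2 _ _ sT sT' ss') => [h0|[m /setIP[ms ms'] hm]|[i [j [ij is_ js hij]]]].
- have : (hull V s `&` hull V s')%classic (edge_point V e t) by split.
  by rewrite h0.
- have : (hull V s `&` hull V s')%classic (edge_point V e t) by split.
  rewrite hm /= => ptm.
  have sumd (f : 'I_n -> R) : \sum_(i in s) (i == m)%:R * f i = f m.
    rewrite (bigD1 m)//= eqxx mul1r big1 ?addr0// => l /andP[_ /negbTE ->].
    by rewrite mul0r.
  have cE : forall i, i \in s -> edge_coef e t i = (i == m)%:R.
    move: ptm; rewrite ptE => ptm.
    apply: barycentric_unique => //.
    + by rewrite sum1; have := sumd (fun=> 1); under eq_bigr do rewrite mulr1.
    + by rewrite sumd -ptm.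
    + by rewrite sumd -ptm.
  move: c1 c2; rewrite !cE// !lt0r !pnatr_eq0 !eqb0 !negbK => /andP[/eqP m1 _] /andP[/eqP m2 _].
  by move: eT; rewrite inE m1 m2 ltnn.
- have : (hull V s `&` hull V s')%classic (edge_point V e t) by split.
  rewrite hij => -[c [c0 sumc ptc]].
  move: is_ js => /setIP[is_ is'] /setIP[js js'].
  (* Extended by zero, coordinates on the common edge are coordinates in either triangle. *)
  pose c' l := if l \in [set i; j]%SET then c l else 0.
  have sumc' (s0 : {set 'I_n}) (f : 'I_n -> R) : i \in s0 -> j \in s0 ->
      \sum_(l in s0) c' l * f l = \sum_(l in [set i; j]%SET) c l * f l.
    move=> i0 j0; rewrite (big_setID [set i; j]%SET)/= [X in _ + X]big1 ?addr0; last first.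
      by move=> l /setDP[_ /negbTE lij]; rewrite /c' lij mul0r.
    rewrite (finset.setIidPr _); last by apply/fintype.subsetP => l /set2P[]->.
    by apply: eq_bigr => l lij; rewrite /c' lij.
  have sumc1 (s0 : {set 'I_n}) : i \in s0 -> j \in s0 -> \sum_(l in s0) c' l = 1.
    move=> i0 j0; have := sumc' s0 (fun=> 1) i0 j0.
    under eq_bigr do rewrite mulr1; move=> ->.
    by under eq_bigr do rewrite mulr1.
  have cE : forall l, l \in s -> edge_coef e t l = c' l.
    move: ptc; rewrite ptE => -[ptx pty].
    by apply: barycentric_unique => //; rewrite ?sum1 ?sumc1 ?sumc'.
  have mem l : l \in s -> 0 < edge_coef e t l -> l \in s'.
    move=> ls; rewrite cE// /c'; case: ifPn => [/set2P[]-> //|_].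
    by rewrite ltxx.
  apply: (@edge_coef_unique e e' t' s' c') => //.
  + by rewrite -cE.
  + by rewrite -cE.
  + exact: mem.
  + exact: mem.
  + exact: sumc1.
  + by rewrite -pt ptc !sumc'.
Qed.

End edge_coefficients.

Section edge_coordinates.
Variables (R : realType) (n : nat) (V : 'I_n -> R * R) (T : {set {set 'I_n}}).
Hypothesis V_inj : injective V.
Implicit Types e : 'I_n * 'I_n.

(** First of two orthonormal coordinates with origin [V e.1] and axis along the edge; on the edge it
    is the arc length. *)
Definition edge_abscissa e (v : R * R) : R :=
  (unit_dir V e.1 e.2).1 * (v.1 - (V e.1).1) + (unit_dir V e.1 e.2).2 * (v.2 - (V e.1).2).

Definition edge_ordinate e (v : R * R) : R :=
  (unit_dir V e.1 e.2).1 * (v.2 - (V e.1).2) - (unit_dir V e.1 e.2).2 * (v.1 - (V e.1).1).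

Lemma edge_pointE e t : edge_point V e t =
  ((V e.1).1 + t * (unit_dir V e.1 e.2).1, (V e.1).2 + t * (unit_dir V e.1 e.2).2).
Proof. by rewrite /edge_point /unit_dir /edge_length; congr pair => /=; ring. Qed.

Lemma edge_abscissa_point e t : e \in edges T -> edge_abscissa e (edge_point V e t) = t.
Proof.
move=> /(edge_dir_unitary V_inj); rewrite /edge_abscissa edge_pointE /unitary.
move: (unit_dir _ _ _) => u u1 /=; transitivity (t * (u.1 ^+ 2 + u.2 ^+ 2)); first by ring.
by rewrite u1 mulr1.
Qed.

Lemma edge_ordinate_point e t : edge_ordinate e (edge_point V e t) = 0.
Proof. by rewrite /edge_ordinate edge_pointE; move: (unit_dir _ _ _) => u /=; ring. Qed.

Lemma edge_point_abscissa e v : e \in edges T -> edge_ordinate e v = 0 ->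
  v = edge_point V e (edge_abscissa e v).
Proof.
move=> /(edge_dir_unitary V_inj); rewrite edge_pointE /edge_ordinate /edge_abscissa /unitary.
move: (unit_dir _ _ _) => u u1 ord0; rewrite [LHS]surjective_pairing.
congr pair.
  transitivity ((V e.1).1 + (v.1 - (V e.1).1) * (u.1 ^+ 2 + u.2 ^+ 2) +
    u.2 * (u.1 * (v.2 - (V e.1).2) - u.2 * (v.1 - (V e.1).1))).
    by rewrite u1 ord0; ring.
  by ring.
transitivity ((V e.1).2 + (v.2 - (V e.1).2) * (u.1 ^+ 2 + u.2 ^+ 2) -
    u.1 * (u.1 * (v.2 - (V e.1).2) - u.2 * (v.1 - (V e.1).1))).
  by rewrite u1 ord0; ring.
by ring.
Qed.

Hypothesis T_triangulation : triangulation V T.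

(** Compactness: on every other edge the continuous function [h] has a positive minimum, and there
    are finitely many edges. Other edges may come arbitrarily close to [e] near its ends, hence the
    margin [delta]. *)
Lemma edge_strip e delta : e \in edges T -> 0 < delta ->
  exists2 rho : R, 0 < rho & forall e' t', e' \in edges T -> e' != e ->
    0 <= t' <= edge_length V e' ->
    delta <= edge_abscissa e (edge_point V e' t') <= edge_length V e - delta ->
    rho <= `|edge_ordinate e (edge_point V e' t')|.
Proof.
move=> eT d0; set L := edge_length V e.
have H e' : \forall rho \near (0 : R)^'+, e' \in edges T -> e' != e -> forall t' : R,
    0 <= t' <= edge_length V e' ->
    delta <= edge_abscissa e (edge_point V e' t') <= L - delta ->
    rho <= `|edge_ordinate e (edge_point V e' t')|.
  have [eT'|eT'] := boolP (e' \in edges T); last exact: nearW.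
  have [->|ee'] := eqVneq e' e; first exact: nearW.
  (* Distance to the line of [e] plus penalties for an abscissa outside the allowed range, so that a
     zero is a point of the open edge [e]. *)
  pose h t := `|edge_ordinate e (edge_point V e' t)| +
    (Num.max 0 (delta - edge_abscissa e (edge_point V e' t)) +
     Num.max 0 (edge_abscissa e (edge_point V e' t) - (L - delta))).
  have co : continuous (fun t => edge_ordinate e (edge_point V e' t)).
    rewrite /edge_ordinate; under eq_fun do rewrite edge_pointE /=.
    move=> t; apply: cvgB; apply: cvgMr; apply: cvgB; try exact: cvg_cst;
      apply: cvgD; try exact: cvg_cst; apply: cvgMl; exact: cvg_id.
  have ca : continuous (fun t => edge_abscissa e (edge_point V e' t)).
    rewrite /edge_abscissa; under eq_fun do rewrite edge_pointE /=.
    move=> t; apply: cvgD; apply: cvgMr; apply: cvgB; try exact: cvg_cst;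
      apply: cvgD; try exact: cvg_cst; apply: cvgMl; exact: cvg_id.
  have cmax (f : R -> R) : continuous f -> continuous (fun t => Num.max 0 (f t)).
    by move=> cf t; exact: (continuous_max (cvg_cst 0 : {for t, continuous (cst (0 : R^o))}) (cf t)).
  have ch : continuous h.
    move=> t; apply: cvgD; first by apply: cvg_norm; exact: co.
    have c1 : continuous (fun t => delta - edge_abscissa e (edge_point V e' t)).
      by move=> s; apply: cvgB; [exact: cvg_cst|exact: ca].
    have c2 : continuous (fun t => edge_abscissa e (edge_point V e' t) - (L - delta)).
      by move=> s; apply: cvgB; [exact: ca|exact: cvg_cst].
    exact: (cvgD (cmax _ c1 t) (cmax _ c2 t)).
  have [c cL hmin] := EVT_min (ltW (edge_length_gt0 V_inj eT')) (continuous_subspaceT ch).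
  rewrite in_itv /= in cL.
  have hc0 : 0 < h c.
    rewrite lt_neqAle eq_sym addr_ge0 ?addr_ge0 ?le_max ?lexx//= andbT.
    have max0 (x : R) : 0 <= Num.max 0 x by rewrite le_max lexx.
    apply/negP; rewrite /h (paddr_eq0 (normr_ge0 _) (addr_ge0 (max0 _) (max0 _))) normr_eq0.
    rewrite (paddr_eq0 (max0 _) (max0 _)) => /andP[/eqP ord0 /andP[/eqP m1 /eqP m2]].
    have a1 : delta <= edge_abscissa e (edge_point V e' c).
      by rewrite -subr_le0 -m1 le_max lexx orbT.
    have a2 : edge_abscissa e (edge_point V e' c) <= L - delta.
      by rewrite -subr_le0 -m2 le_max lexx orbT.
    have aL : 0 < edge_abscissa e (edge_point V e' c) < edge_length V e.
      by rewrite (lt_le_trans d0 a1) (le_lt_trans a2)// gtrBl.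
    move/negP: ee'; apply; apply/eqP/esym.
    apply: (open_edge_unique V_inj T_triangulation eT eT' aL cL).
    by rewrite -edge_point_abscissa.
  near=> rho => _ _ t' tL' /andP[b1 b2].
  have -> : `|edge_ordinate e (edge_point V e' t')| = h t'.
    by rewrite /h !max_l ?subr_le0// !addr0.
  apply: (@le_trans _ _ (h c)); last by apply: hmin; rewrite in_itv.
  by near: rho; exact: nbhs_right_ltW.
have {}H := filter_forall _ H.
have [rho [rho0 Hrho]] := filter_ex (filterI (nbhs_right_gt (0 : R)) (H _)).

exists rho => // e' t' eT' ee' tL' ab.
exact: (Hrho e').
Unshelve. all: by end_near. Qed.

End edge_coordinates.

(** * Test functions *)

Lemma Rintegral_support (R : realType) (A B : set R) (f : R -> R) :
  (forall t, f t != 0 -> A t) -> (forall t, f t != 0 -> B t) ->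
  \int[@lebesgue_measure R]_(t in A) f t = \int[@lebesgue_measure R]_(t in B) f t.
Proof.
have restr (C : set R) : (forall t, f t != 0 -> C t) -> f \_ C = f.
  move=> fC; apply/funext => t; rewrite /patch; case: ifPn => // tC.
  by apply/eqP; rewrite eq_sym; apply: contraNT tC => /fC ?; rewrite inE.
by move=> /restr fA /restr fB; rewrite Rintegral_mkcond [RHS]Rintegral_mkcond fA fB.
Qed.

Lemma integrable_support (R : realType) (c d M : R) (f : R -> R) :
  measurable_fun setT f -> (forall t, `|f t| <= M) ->
  (forall t, f t != 0 -> c <= t <= d) ->
  (@lebesgue_measure R).-integrable setT (EFin \o f).
Proof.
move=> mf fM fcd; have mcd : measurable (`[c, d]%classic : set (measurableTypeR R)).
  exact: measurable_itv.
have : (@lebesgue_measure R).-integrable `[c, d] (EFin \o f).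
  apply: measurable_bounded_integrable => //.
  - by rewrite /= lebesgue_measure_itv; case: ifPn => // _; rewrite -EFinB ltry.
  - exact: measurable_funS mf.
  - exists M; split; first exact: num_real.
    by move=> x Mx t _; apply: le_trans (fM t) (ltW Mx).
move=> /(integrable_mkcond _ mcd).
have -> // : (EFin \o f) \_ `[c, d] = EFin \o f.
apply/funext => t; rewrite /patch; case: ifPn => // tcd.
apply/esym/eqP; rewrite /= eqe; apply: contraNT tcd => /fcd ?.
by rewrite inE /= in_itv.
Qed.

(** * Primitives of bounded functions with bounded support *)

Section primitive.
Variables (R : realType) (c d M : R) (f : R -> R).
Hypothesis mf : measurable_fun setT f.
Hypothesis fM : forall t, `|f t| <= M.
Hypothesis fcd : forall t, f t != 0 -> c <= t <= d.
Let mu : {measure set (measurableTypeR R) -> \bar R} := @lebesgue_measure R.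

(** Integration from -oo makes it vanish to the left of the support. *)
Definition primitive (t : R) : R := \int[mu]_(s in `]-oo, t]) f s.

Let f_integrable : mu.-integrable setT (EFin \o f) := integrable_support mf fM fcd.

Lemma integrable_itv (i : interval R) : mu.-integrable [set` i] (EFin \o f).
Proof. by apply: integrableS f_integrable => //; exact: measurable_itv. Qed.

Lemma primitive_lipschitz x y : x <= y -> `|primitive y - primitive x| <= M * (y - x).
Proof.
move=> xy; rewrite /primitive (@Rintegral_itvB _ f -oo%O (BRight y) x)//; last first.
  exact: integrable_itv.
have mxy : measurable (`]x, y]%classic : set (measurableTypeR R)) by exact: measurable_itv.
apply: le_trans (le_normr_Rintegral mxy (integrable_itv _)) _.
have fin_xy : fine (mu `]x, y]%classic) = y - x.
  rewrite /mu /= lebesgue_measure_itv /= lte_fin.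
  by case: ltP => //= yx; apply/eqP; rewrite eq_sym subr_eq0 eq_le xy yx.
rewrite -fin_xy -Rintegral_cst//.
have iM : mu.-integrable `]x, y] (EFin \o (fun=> M)).
  apply: integrable_cst_on => //.
  by rewrite /= lebesgue_measure_itv; case: ifPn => // _; rewrite -EFinB ltry.
apply: (le_Rintegral mxy _ iM) => //.
by have := integrable_norm (integrable_itv `]x, y]%R).
Qed.

Lemma primitive_lt t : t < c -> primitive t = 0.
Proof.
move=> tc; rewrite /primitive /Rintegral integral0_eq// => s.
rewrite /= in_itv /= => st; congr EFin; apply/eqP.
by apply: contraTT (le_lt_trans st tc) => /fcd /andP[cs _]; rewrite -leNgt.
Qed.

Lemma primitive_ge t : d <= t -> primitive t = \int[mu]_(s in setT) f s.
Proof.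
move=> dt; apply: Rintegral_support => // s /fcd /andP[_ sd].
by rewrite /= in_itv /= (le_trans sd).
Qed.

Lemma primitive_continuous : continuous primitive.
Proof.
move=> t; apply/cvgrPdist_le => eps eps0.
have M0 : 0 < `|M| + 1 by rewrite ltr_wpDl.
exists (eps / (`|M| + 1)) => /=; first by rewrite divr_gt0.
have key x y : x <= y -> y - x < eps / (`|M| + 1) -> `|primitive y - primitive x| <= eps.
  move=> xy lt_xy; apply: le_trans (primitive_lipschitz xy) _.
  rewrite ltr_pdivlMr// in lt_xy; apply: le_trans (ltW lt_xy); rewrite mulrC.
  by rewrite ler_wpM2l ?subr_ge0// (le_trans (ler_norm M))// lerDl.
move=> s /=; have [st|ts] := leP s t.
  by rewrite ger0_norm ?subr_ge0//; exact: key.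
rewrite [`|primitive t - _|]distrC ltr0_norm ?subr_lt0// opprB => lt_ts.
exact: (key _ _ (ltW ts)).
Qed.

Lemma primitive_is_derive t : {for t, continuous f} -> is_derive t 1 primitive (f t).
Proof.
have tt1 : t < t + 1 by rewrite ltrDl.
move=> cf; have [|dF F'] := continuous_FTC1 tt1 (integrable_itv `]-oo, t + 1]%R) _ cf.
  by rewrite ltNyr.
by rewrite -F' derive1E; exact: derivableP.
Qed.

Lemma ae_derive1_primitive : {ae mu, forall t, derive1 primitive t = f t}.
Proof.
have := FTC1Ny (fun y => integrable_itv `]-oo, y]) (open_integrable_locally openT f_integrable).
by apply: filterS => t [].
Qed.

End primitive.

Lemma derivative_on_derive (R : realType) (a b : R) (f g : R -> R) :
  (forall t : R, is_derive t 1 f (g t)) -> derivative_on a b f g.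
Proof.
move=> fg t _; have /is_derive1_caratheodory[h [hE ch <-]] := fg t.
have {}ch : h @ within `[a, b]%classic t^' --> h t.
  by apply: cvg_within_filter; exact: cvg_within_filter.
have near_neq : \forall s \near within `[a, b]%classic t^', s != t.
  by rewrite near_withinE; near=> s => _; near: s; exact: nbhs_dnbhs_neq.
apply: cvg_trans ch; apply: near_eq_cvg; near=> s.
by rewrite hE mulfK// subr_eq0; near: s; exact: near_neq.
Unshelve. all: by end_near. Qed.

Lemma lipschitz_abs_continuous (R : realType) (a b C : R) (k : R -> R) :
  (forall x y, a <= x -> x <= y -> y <= b -> `|k y - k x| <= C * (y - x)) ->
  abs_continuous a b k.
Proof.
move=> kC eps eps0; have C0 : 0 < `|C| + 1 by rewrite ltr_wpDl.
exists (eps / (`|C| + 1)); first by rewrite divr_gt0.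
move=> m c d cd _; rewrite ltr_pdivlMr// mulrC; apply: le_lt_trans.
rewrite mulr_sumr; apply: ler_sum => l _; have [h1 [h2 h3]] := cd l.
apply: le_trans (kC _ _ h1 h2 h3) _; rewrite ler_wpM2r ?subr_ge0//.
by rewrite (le_trans (ler_norm _))// lerDl.
Qed.

(* [h] is the second primitive of [g]; it vanishes beyond [d] by the two moment conditions. *)
Lemma exists_profile (R : realType) (c d L M : R) (g : R -> R) :
  0 < c -> c <= d -> d < L -> measurable_fun setT g -> (forall t, `|g t| <= M) ->
  (forall t, g t != 0 -> c <= t <= d) ->
  \int[@lebesgue_measure R]_(t in `[0, L]) g t = 0 ->
  \int[@lebesgue_measure R]_(t in `[0, L]) (g t * t) = 0 ->
  exists h k : R -> R, [/\ forall t : R, is_derive t 1 h (k t), continuous k,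
    abs_continuous 0 L k, {ae @lebesgue_measure R, forall t, derive1 k t = g t} &
    forall t, h t != 0 -> c <= t <= d].
Proof.
move=> c0 cd dL mg gM gcd g0 g1.
have cL : 0 <= L by rewrite ltW// (lt_trans c0)// (le_lt_trans cd).
have in0L t : c <= t <= d -> 0 <= t <= L.
  by move=> /andP[ct td]; rewrite (le_trans (ltW c0) ct) (le_trans td (ltW dL)).
pose k := primitive g; pose h := primitive k.
have kM := primitive_lipschitz mg gM gcd.
have kcont := primitive_continuous mg gM gcd.
have kcd t : k t != 0 -> c <= t <= d.
  move=> kt; apply/andP; split.
    by rewrite leNgt; apply: contraNN kt => tc; rewrite /k (primitive_lt gcd).
  rewrite leNgt; apply: contraNN kt => /ltW dt.
  rewrite /k (primitive_ge gcd)// -g0; apply/eqP; apply: Rintegral_support => // s /gcd.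
  by rewrite /= in_itv; exact: in0L.
have [N kN] : exists N, forall t, `|k t| <= N.
  exists (M * (d - c)) => t; have M0 : 0 <= M := le_trans (normr_ge0 _) (gM 0).
  have [->|/kcd /andP[ct td]] := eqVneq (k t) 0.
    by rewrite normr0 mulr_ge0// subr_ge0.
  (* [primitive_lt] requires a point strictly left of c, so the Lipschitz bound starts at c -
     eps. *)
  have kc' eps : 0 < eps -> `|k t| <= M * (d - c) + M * eps.
    move=> eps0; have := kM (c - eps) t.
    rewrite (primitive_lt gcd (_ : c - eps < c)) ?gtrBl// subr0 => H.
    apply: le_trans (H _) _; first by lra.
    by rewrite -mulrDr ler_wpM2l//; lra.
  apply/ler_addgt0Pr => eps eps0.
  have M1 : 0 < M + 1 by lra.
  apply: le_trans (kc' (eps / (M + 1)) _) _; first by rewrite divr_gt0.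
  by rewrite lerD2l mulrA ler_pdivrMr// mulrC ler_wpM2l; lra.
have mk : measurable_fun setT k by exact: continuous_measurable_fun.
have hk (t : R) : is_derive t 1 h (k t) by apply: (primitive_is_derive mk kN kcd); exact: kcont.
have ack : abs_continuous 0 L k.
  by apply: (lipschitz_abs_continuous (C := M)) => x y _ xy _; exact: kM.
have kg := ae_derive1_primitive mg gM gcd.
have derh : derive1 h = k.
  by apply/funext => t; have [_ <-] := hk t; rewrite derive1E.
exists h, k; split => // t ht; apply/andP; split.
  by rewrite leNgt; apply: contraNN ht => tc; rewrite /h (primitive_lt kcd).
rewrite leNgt; apply: contraNN ht => /ltW dt.
(* With the weight t the boundary terms reduce to - h L, so the vanishing moment of order 1 gives h
   L = 0. *)
have [_] := integral_derive2_affine 0 1 cL (derivative_on_derive hk) ack.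
have kL : k L = 0.
  by apply/eqP; apply/negPn/negP => /kcd /andP[_]; rewrite leNgt dL.
have k0 : k 0 = 0.
  by apply/eqP; apply/negPn/negP => /kcd /andP[]; rewrite leNgt c0.
have h0 : h 0 = 0 by rewrite /h (primitive_lt kcd c0).
rewrite kL k0 h0 !mulr0 !subr0 mul1r sub0r.
have -> : h L = h t by rewrite /h !(primitive_ge kcd)// ltW.
have -> : \int[@lebesgue_measure R]_(t in `[0, L]) (derive1 (derive1 h) t * (0 + 1 * t)) = 
  \int[@lebesgue_measure R]_(t in `[0, L]) (g t * t).
  apply: ae_eq_Rintegral.
  - exact: measurable_itv.
  - apply: measurable_funM; last by apply: measurable_funD => //; exact: measurable_funM.
    exact: (measurable_fun_derive2 cL (derivative_on_derive hk) ack).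
  - by apply: measurable_funM => //; exact: measurable_funS mg.
  - by apply: filterS kg => s ks _; rewrite derh ks add0r mul1r.
by rewrite g1 => /eqP; rewrite eq_sym oppr_eq0.
Qed.

(** Differentiability on the whole plane, where the usual rules of calculus apply; the notions
    relative to the domain follow by restriction. *)
Definition C1_gradient (R : realType) (F : R * R -> R) (G : R * R -> R * R) : Prop :=
  [/\ forall w : R * R, is_diff w F (fun v => (G w).1 * v.1 + (G w).2 * v.2),
      continuous (fun w => (G w).1) & continuous (fun w => (G w).2)].

Section C1_functions.
Variable R : realType.
Implicit Types (F : R * R -> R) (G : R * R -> R * R).

Lemma C1_affine (a b c : R) :
  C1_gradient (fun v => a * v.1 + b * v.2 + c) (fun=> (a, b)).
Proof.
split=> w; try exact: cvg_cst.
have fst_diff : is_diff w (fst : R * R -> R) fst.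
  have cfst : continuous (fst : R * R -> R) by move=> v; exact: cvg_fst.
  by split; [exact: (linear_differentiable w cfst)|exact: (diff_lin w cfst)].
have snd_diff : is_diff w (snd : R * R -> R) snd.
  have csnd : continuous (snd : R * R -> R) by move=> v; exact: cvg_snd.
  by split; [exact: (linear_differentiable w csnd)|exact: (diff_lin w csnd)].
have H := is_diffD (is_diffD (is_diffZ a fst_diff) (is_diffZ b snd_diff)) (is_diff_cst c w).
by apply: is_diff_eq H _; apply/funext => v /=; rewrite addr0.
Qed.

Lemma C1_comp F G (h h' : R -> R) : C1_gradient F G ->
  (forall t : R, is_derive t 1 h (h' t)) -> continuous h' ->
  C1_gradient (h \o F) (fun w => (h' (F w) * (G w).1, h' (F w) * (G w).2)).
Proof.
move=> [FG c1 c2] dh ch; have cF w : {for w, continuous F}.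
  by have [dF _] := FG w; exact: differentiable_continuous.
have chF w : h' (F v) @[v --> w] --> h' (F w) by apply: continuous_comp; [exact: cF|exact: ch].
split=> w /=.
- have dhw := dh (F w).
  have H : is_diff (F w) h (fun t => h' (F w) * t).
    have [dvh <-] := dhw; have /derivable1_diffP df := dvh.
    by split => //; rewrite diff1E//; apply/funext => t /=; rewrite derive1E mulrC.
  have [dF dFE] := FG w; have [dh' dhE] := H.
  split; first exact: differentiable_comp.
  by rewrite diff_comp// dFE dhE; apply/funext => v /=; ring.
- exact: (cvgM (chF w) (c1 w)).
- exact: (cvgM (chF w) (c2 w)).
Qed.

Lemma C1_mul F1 G1 F2 G2 : C1_gradient F1 G1 -> C1_gradient F2 G2 ->
  C1_gradient (fun w => F1 w * F2 w)
    (fun w => (F1 w * (G2 w).1 + F2 w * (G1 w).1, F1 w * (G2 w).2 + F2 w * (G1 w).2)).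
Proof.
move=> [FG1 c11 c12] [FG2 c21 c22].
have cF F G w : is_diff w F (fun v => (G w).1 * v.1 + (G w).2 * v.2) -> {for w, continuous F}.
  by move=> [dF _]; exact: differentiable_continuous.
have cF1 w := cF _ _ _ (FG1 w); have cF2 w := cF _ _ _ (FG2 w).
split=> w /=.
- apply: (is_diff_eq (is_diffM (FG1 w) (FG2 w))); apply/funext => v.
  rewrite [LHS](_ : _ = F1 w * ((G2 w).1 * v.1 + (G2 w).2 * v.2) +
    F2 w * ((G1 w).1 * v.1 + (G1 w).2 * v.2))//; ring.
- exact: (cvgD (cvgM (cF1 w) (c21 w)) (cvgM (cF2 w) (c11 w))).
- exact: (cvgD (cvgM (cF1 w) (c22 w)) (cvgM (cF2 w) (c12 w))).
Qed.

Lemma C1_gradient_on D F G : C1_gradient F G ->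
  gradient_on D F G /\ {within D, continuous G}.
Proof.
move=> [FG c1 c2]; split; last first.
  by apply/continuous_pairP; split; exact: continuous_subspaceT.
move=> w Dw; apply: cvg_within_filter; apply: cvg_within_filter.
apply/cvgrPdist_le => eps eps0.
have [dF dFE] := FG w.
have /diff_locallyP[_ /eqaddoP/(_ _ eps0)/nbhs_ballP[d d0 H]] := dF.
apply/nbhs_ballP; exists d => // v vd.
have {}H := H (v - w).
rewrite sub0r normrN normrM normfV [`|eucl_dist w v|]ger0_norm ?sqrtr_ge0//.
have [->|vw] := eqVneq v w.
  rewrite (_ : _ - _ - _ = 0); last by ring.
  by rewrite normr0 mul0r ltW.
have dist0 : 0 < eucl_dist w v by apply: eucl_dist_gt0 => /esym/eqP; exact/negP.
(* The remainder of the differential is small relative to the max norm, which the Euclidean distance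
   dominates. *)
have vw_eucl : `|v - w| <= eucl_dist w v.
  by rewrite prod_normE ge_max /eucl_dist -!sqrtr_sqr !ler_wsqrtr ?lerDl ?lerDr ?sqr_ge0.
rewrite ler_pdivrMr//; apply: le_trans (_ : _ <= eps * `|v - w|) _; last by rewrite ler_wpM2l// ltW.
have -> : F v - F w - ((G w).1 * (v.1 - w.1) + (G w).2 * (v.2 - w.2)) =
    (F \o shift w - (cst (F w) + 'd F w)) (v - w).
  rewrite [RHS](_ : _ = F (v - w + w) - (F w + 'd F w (v - w)))// dFE subrK /=; ring.
by apply: H; rewrite -ball_normE /= sub0r opprB; move: vd; rewrite -ball_normE.
Qed.

End C1_functions.

(** Derivatives along an edge can be computed from any function on the whole line that agrees with
    [F] there. *)
Lemma edge_regular_profile (R : realType) (n : nat) (V : 'I_n -> R * R) (F : R * R -> R)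
    (e : 'I_n * 'I_n) (f f' : R -> R) :
  (forall t, 0 <= t <= edge_length V e -> F (edge_point V e t) = f t) ->
  (forall t : R, is_derive t 1 f (f' t)) -> abs_continuous 0 (edge_length V e) f' ->
  edge_regular V F e /\ forall t, 0 < t < edge_length V e ->
    second_derivative (induced_network V F) e t = derive1 f' t.
Proof.
move=> Ff df acf'; split.
  exists f' => // t tL.
  apply: cvg_trans (derivative_on_derive (a := 0) (b := edge_length V e) df tL).
  apply: near_eq_cvg; rewrite !near_withinE; near=> s => _; rewrite /= in_itv /= => sL.
  by rewrite !induced_networkE !Ff.
move=> t tL; rewrite /second_derivative; apply: near_eq_derive1.
apply: (near_in_itv_oo tL) => s sL.
have [_ <-] := df s; rewrite -derive1E; apply: near_eq_derive1.
apply: (near_in_itv_oo sL) => r /andP[r0 rL].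
by rewrite induced_networkE Ff// !ltW.
Unshelve. all: by end_near. Qed.

Section cutoff.
Variable R : realType.

Lemma is_derive_max0_sqr (t : R) :
  is_derive t 1 (fun s => Num.max 0 s ^+ 2) (2 * Num.max 0 t).
Proof.
have [t0|t0|->] := ltgtP t 0.
- have eq0 : {near t, cst 0 =1 (fun s => Num.max 0 s ^+ 2)}.
    near=> s; rewrite /= max_l ?expr0n//= ltW//; near: s; exact: lt_nbhsl.
  by rewrite mulr0; apply: near_eq_is_derive eq0 _.
- have eqs : {near t, (fun s => s ^+ 2) =1 (fun s => Num.max 0 s ^+ 2)}.
    near=> s; rewrite /= max_r//= ltW//; near: s; exact: lt_nbhsr.
  apply: near_eq_is_derive eqs _.
  by apply: is_derive_eq; rewrite !scaler1 /GRing.scale /=; ring.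
(* The slope from 0 of the squared positive part is the positive part itself. *)
- apply/is_derive1_caratheodory; exists (Num.max 0); split.
  + move=> s; rewrite subr0 maxxx expr0n subr0.
    by have [s0|s0] := leP s 0; rewrite ?expr0n ?mul0r.
  + exact: (continuous_max (cvg_cst 0 : {for 0, continuous (cst (0 : R^o))}) cvg_id).
  + by rewrite maxxx mulr0.
Unshelve. all: by end_near. Qed.

(** The outer square makes the truncated parabola continuously differentiable. *)
Definition cutoff (rho t : R) := Num.max 0 (1 - (t / rho) ^+ 2) ^+ 2.

Lemma cutoff0 rho : cutoff rho 0 = 1.
Proof. by rewrite /cutoff mul0r expr0n subr0 max_r// expr1n. Qed.

Lemma cutoff_support rho t : 0 < rho -> rho <= `|t| -> cutoff rho t = 0.
Proof.
move=> rho0 rt; rewrite /cutoff max_l ?expr0n// subr_le0.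
rewrite -real_normK ?num_real// normrM normfV (gtr0_norm rho0) exprn_ege1//.
by rewrite ler_pdivlMr// mul1r.
Qed.

Lemma C1_cutoff rho F G : C1_gradient F G -> exists G', C1_gradient (cutoff rho \o F) G'.
Proof.
move=> FG; pose D (t : R) := 2 * Num.max 0 (1 - (t / rho) ^+ 2) * (- (2 * t * rho^-1 ^+ 2)).
eexists; apply: (C1_comp (h' := D) FG).
- move=> t.
  have di : is_derive t 1 (fun t : R => 1 - (t / rho) ^+ 2) (- (2 * t * rho^-1 ^+ 2)).
    apply: is_derive_eq; rewrite /GRing.scale /=; ring.
  exact: (is_derive1_comp (is_derive_max0_sqr _) di).
- have cq : continuous (fun t : R => 1 - (t / rho) ^+ 2).
    move=> t; apply: cvgB; first exact: cvg_cst.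
    by under eq_fun do rewrite expr2; rewrite expr2; apply: cvgM; apply: cvgMl; exact: cvg_id.
  move=> t; apply: cvgM.
    apply: cvgMr; exact: (continuous_max (cvg_cst 0 : {for t, continuous (cst (0 : R^o))}) (cq t)).
  by apply: cvgN; apply: cvgMl; apply: cvgMr; exact: cvg_id.
Qed.

End cutoff.

Section edge_variations.
Variables (R : realType) (n : nat) (V : 'I_n -> R * R) (T : {set {set 'I_n}}).
Hypothesis V_inj : injective V.
Hypothesis T_triangulation : triangulation V T.
Let mu : {measure set (measurableTypeR R) -> \bar R} := @lebesgue_measure R.

Lemma vertex_on_edge (i : 'I_n) : exists2 e, e \in edges T & i = e.1 \/ i = e.2.
Proof.
have [s [j [k [_ _ ij _ _]]]] := exists_triangle i T_triangulation.
exists (edge i j); first by rewrite inE in ij.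
by rewrite /edge; case: ifP; [left|right].
Qed.

(* [P] is the second primitive of [g] along [e] times a cutoff across [e]. *)
Lemma edge_variation e c d M (g : R -> R) : e \in edges T ->
  0 < c -> c <= d -> d < edge_length V e ->
  measurable_fun setT g -> (forall t, `|g t| <= M) ->
  (forall t, g t != 0 -> c <= t <= d) ->
  \int[mu]_(t in edge_itv V e) g t = 0 ->
  \int[mu]_(t in edge_itv V e) (g t * t) = 0 ->
  exists P, admissible_variation V T P (fun e' => if e' == e then g else cst 0).
Proof.
move=> eT c0 cd dL mg gM gcd g0 g1; set L := edge_length V e.
have [h [k [hk ck ack kg hcd]]] := exists_profile c0 cd dL mg gM gcd g0 g1.
(* Chosen so that c <= t <= d implies delta <= t <= L - delta. *)
pose delta := Num.min c (L - d).
have delta0 : 0 < delta by rewrite lt_min c0 subr_gt0.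
have [rho rho0 strip] := edge_strip V_inj T_triangulation eT delta0.
pose P v := h (edge_abscissa V e v) * cutoff rho (edge_ordinate V e v).
have Pe t : P (edge_point V e t) = h t.
  by rewrite /P (edge_abscissa_point V_inj t eT) edge_ordinate_point cutoff0 mulr1.
have Pe' e' t : e' \in edges T -> e' != e -> 0 <= t <= edge_length V e' ->
    P (edge_point V e' t) = 0.
  move=> eT' ee' tL; rewrite /P; set x := edge_abscissa V e _.
  (* Either the abscissa is outside the support of h, or the strip keeps the point outside the
     support of the cutoff. *)
  have [->|/hcd /andP[h1 h2]] := eqVneq (h x) 0.
    by rewrite mul0r.
  rewrite (cutoff_support rho0) ?mulr0// strip//.
  by rewrite (le_trans _ h1) ?ge_min ?lexx// (le_trans h2)// lerBrDl -lerBrDr ge_min lexx orbT.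
have [G' C1P] : exists G', C1_gradient P G'.
  have C1a : C1_gradient (edge_abscissa V e) (fun=> (unit_dir V e.1 e.2)).
    have := C1_affine (unit_dir V e.1 e.2).1 (unit_dir V e.1 e.2).2
      (- ((unit_dir V e.1 e.2).1 * (V e.1).1 + (unit_dir V e.1 e.2).2 * (V e.1).2)).
    rewrite -surjective_pairing; congr C1_gradient; apply/funext => v.
    by rewrite /edge_abscissa; move: (unit_dir _ _ _) => u; ring.
  have C1o : C1_gradient (edge_ordinate V e) (fun=> (- (unit_dir V e.1 e.2).2, (unit_dir V e.1 e.2).1)).
    have := C1_affine (- (unit_dir V e.1 e.2).2) (unit_dir V e.1 e.2).1
      (- ((unit_dir V e.1 e.2).1 * (V e.1).2 - (unit_dir V e.1 e.2).2 * (V e.1).1)).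
    congr C1_gradient; apply/funext => v.
    by rewrite /edge_ordinate; move: (unit_dir _ _ _) => u; ring.
  have [G' C1c] := C1_cutoff rho C1o.
  by eexists; exact: (C1_mul (C1_comp C1a hk ck) C1c).
have ac0 (x : R) : abs_continuous 0 x (cst 0).
  by apply: (lipschitz_abs_continuous (C := 0)) => s t _ _ _; rewrite /= subrr normr0 mul0r.
have profile0 e' : e' \in edges T -> e' != e ->
    edge_regular V P e' /\ forall t, 0 < t < edge_length V e' ->
    second_derivative (induced_network V P) e' t = derive1 (cst 0) t.
  by move=> eT' ee'; apply: (edge_regular_profile (f := cst 0)) => // t; exact: Pe'.
have profilee := edge_regular_profile (fun t _ => Pe t) hk ack.
exists P; split.
- move=> i; have [e' eT' ie'] := vertex_on_edge i.
  have L0 := edge_length_gt0 V_inj eT'.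
  have [ee'|ee'] := eqVneq e' e.
    rewrite ee' in ie' L0; have h0 t : ~~ (c <= t <= d) -> h t = 0.
      by move=> tcd; apply/eqP; apply: contraNT tcd => /hcd.
    case: ie' => ->.
      by rewrite -(edge_point0 V e) Pe h0// leNgt c0.
    by rewrite -(edge_pointL V_inj eT) Pe h0// [_ <= d]leNgt dL andbF.
  case: ie' => ->.
    by rewrite -(edge_point0 V e') Pe'// lexx ltW.
  by rewrite -(edge_pointL V_inj eT') Pe'// lexx ltW.
- by have [H1 H2] := C1_gradient_on (domain V T) C1P; exists G'.
- move=> e' eT'; have [->|ee'] := eqVneq e' e; first by have [] := profilee.
  by have [] := profile0 _ eT' ee'.
- move=> e' eT'; have [->|ee'] := eqVneq e' e.
    split; first exact: measurable_funS mg.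
      by exists M => t _.
    have := kg; have := ae_edge_itv profilee.2; apply: filterS2 => t H1 H2 /H1 ->.
    by rewrite H2.
  split; first exact: measurable_cst.
    by exists 0 => t _; rewrite normr0.
  have := ae_edge_itv (profile0 _ eT' ee').2; apply: filterS => t H /H ->.
  by rewrite derive1_cst.
Qed.

End edge_variations.

(** * The du Bois-Reymond lemma *)

Section du_bois_reymond.
Variables (R : realType) (L : R) (W : R -> R).
Hypothesis L0 : 0 < L.
Let mu : {measure set (measurableTypeR R) -> \bar R} := @lebesgue_measure R.
Let D : set R := `[0, L]%classic.
Let mD : measurable (D : set (measurableTypeR R)).
Proof. exact: measurable_itv. Qed.
Let D_fin : (mu D < +oo)%E.
Proof. by rewrite /mu /= lebesgue_measure_itv; case: ifPn => // _; rewrite -EFinB ltry. Qed.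

Hypothesis iW : mu.-integrable D (EFin \o W).

Let bounded_measurable (g : R -> R) :=
  measurable_fun setT g /\ exists M, forall t, D t -> `|g t| <= M.

Let iWM (g : R -> R) : bounded_measurable g ->
  mu.-integrable D (EFin \o (fun t => W t * g t)).
Proof.
move=> [mg [M gM]]; have /integrableP[mW _] := iW.
have {}mW : measurable_fun D W by exact/measurable_EFinP.
have iaW : mu.-integrable D (EFin \o (fun t => `|W t|)) := integrable_norm iW.
apply: (le_integrable_on mD (g := fun t => M * `|W t|)).
- by apply: measurable_funM => //; exact: measurable_funS mg.
- by move=> t Dt; rewrite normrM mulrC ler_wpM2r// gM.
- exact: integrable_onZ.
Qed.

Let iM (g : R -> R) : bounded_measurable g -> mu.-integrable D (EFin \o g).
Proof.
move=> [mg [M gM]]; apply: (le_integrable_on mD (g := fun=> M)) => //.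
  exact: measurable_funS mg.
exact: integrable_cst_on.
Qed.

Let bounded_id (g : R -> R) : bounded_measurable g -> bounded_measurable (fun t => g t * t).
Proof.
move=> [mg [M gM]]; split; first exact: measurable_funM.
exists (M * L) => t Dt; have := Dt; rewrite /D /= in_itv /= => /andP[t0 tL].
by rewrite normrM ler_pM// ?gM// ger0_norm.
Qed.

Let bounded_combination (g g1 g2 : R -> R) (x y : R) : bounded_measurable g ->
  bounded_measurable g1 -> bounded_measurable g2 ->
  bounded_measurable (fun t => g t - (x * g1 t + y * g2 t)).
Proof.
move=> [mg [M gM]] [mg1 [M1 g1M]] [mg2 [M2 g2M]]; split.
  by apply: measurable_funB => //; apply: measurable_funD; exact: measurable_funM.
exists (M + (`|x| * M1 + `|y| * M2)) => t Dt.
apply: le_trans (ler_normB _ _) _; apply: lerD; first exact: gM.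
apply: le_trans (ler_normD _ _) _; apply: lerD.
  by rewrite normrM ler_wpM2l// g1M.
by rewrite normrM ler_wpM2l// g2M.
Qed.

Let integral_combination (f g1 g2 : R -> R) (x y : R) : mu.-integrable D (EFin \o f) ->
  mu.-integrable D (EFin \o g1) -> mu.-integrable D (EFin \o g2) ->
  \int[mu]_(t in D) (f t - (x * g1 t + y * g2 t)) =
  \int[mu]_(t in D) f t - (x * \int[mu]_(t in D) g1 t + y * \int[mu]_(t in D) g2 t).
Proof.
move=> If I1 I2; have J1 := integrable_onZ mD x I1; have J2 := integrable_onZ mD y I2.
rewrite -(RintegralZl x mD I1) -(RintegralZl y mD I2) -(RintegralD mD J1 J2).
exact: (RintegralB mD If (integrable_onD mD J1 J2)).
Qed.

Let indic_bounded a b : bounded_measurable (\1_`[a, b] : R -> R).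
Proof.
split; first by apply: measurable_indic; exact: measurable_itv.
by exists 1 => t _; rewrite indicE; case: (_ \in _) => /=; rewrite ?normr1// normr0.
Qed.

Let indic_integral a b : 0 <= a -> a <= b -> b <= L ->
  \int[mu]_(t in D) (\1_`[a, b]%classic t : R) = b - a.
Proof.
move=> a0 ab bL; rewrite /Rintegral integral_indic//.
rewrite (_ : `[a, b]%classic `&` D = `[a, b]%classic); last first.
  apply/setIidPl => t /=; rewrite !in_itv /= => /andP[h1 h2].
  by rewrite /D /= in_itv /= (le_trans a0)//= (le_trans h2).
rewrite /mu /= lebesgue_measure_itv /= lte_fin; case: ltP => //= ba.
by apply/eqP; rewrite eq_sym subr_eq0 eq_le ab ba.
Qed.

Hypothesis W_orthogonal : forall (c d M : R) (g : R -> R), 0 < c -> c <= d -> d < L ->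
  measurable_fun setT g -> (forall t, `|g t| <= M) ->
  (forall t, g t != 0 -> c <= t <= d) ->
  \int[mu]_(t in D) g t = 0 -> \int[mu]_(t in D) (g t * t) = 0 ->
  \int[mu]_(t in D) (W t * g t) = 0.

(* Correcting a test function by the indicators of two disjoint intervals annihilates
   its moments of order 0 and 1. *)
Let orthogonal_to_affine : exists al be : R, forall (c d M : R) (g : R -> R),
  0 < c -> c <= L / 5 -> L * 4 / 5 <= d -> d < L ->
  measurable_fun setT g -> (forall t, `|g t| <= M) ->
  (forall t, g t != 0 -> c <= t <= d) ->
  \int[mu]_(t in D) (W t * g t) =
  al * \int[mu]_(t in D) g t + be * \int[mu]_(t in D) (g t * t).
Proof.
have L0' := L0.
(* Both intervals lie in [L/5, 4L/5], hence in every [c, d] considered; the gap between them makes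
   their moments independent. *)
pose g1 : R -> R := \1_`[L / 5, L * 2 / 5]; pose g2 : R -> R := \1_`[L * 3 / 5, L * 4 / 5].
have bg1 : bounded_measurable g1 := indic_bounded _ _.
have bg2 : bounded_measurable g2 := indic_bounded _ _.
have g1_01 t : g1 t = 0 \/ g1 t = 1.
  by rewrite /g1 indicE; case: (_ \in _); [right|left].
have g2_01 t : g2 t = 0 \/ g2 t = 1.
  by rewrite /g2 indicE; case: (_ \in _); [right|left].
have supp1 t : g1 t != 0 -> L / 5 <= t <= L * 2 / 5.
  by rewrite /g1 indicE; case: (boolP (t \in _)) => [|_]; rewrite ?eqxx// inE /= in_itv.
have supp2 t : g2 t != 0 -> L * 3 / 5 <= t <= L * 4 / 5.
  by rewrite /g2 indicE; case: (boolP (t \in _)) => [|_]; rewrite ?eqxx// inE /= in_itv.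
pose A1 := \int[mu]_(t in D) g1 t; pose A2 := \int[mu]_(t in D) g2 t.
pose B1 := \int[mu]_(t in D) (g1 t * t); pose B2 := \int[mu]_(t in D) (g2 t * t).
pose w1 := \int[mu]_(t in D) (W t * g1 t); pose w2 := \int[mu]_(t in D) (W t * g2 t).
have A1E : A1 = L / 5.
  by rewrite /A1 /g1 indic_integral; lra.
have A2E : A2 = L / 5 by rewrite /A2 /g2 indic_integral; lra.
have B1_le : B1 <= L * 2 / 5 * A1.
  rewrite /B1 /A1 -(RintegralZl _ mD (iM bg1)).
  apply: (le_Rintegral mD (iM (bounded_id bg1)) (integrable_onZ mD _ (iM bg1))) => t _.
  rewrite mulrC; have [->|/supp1 /andP[_ tle]] := eqVneq (g1 t) 0; first by rewrite !mulr0.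
  by rewrite ler_wpM2r//; have [->|->] := g1_01 t.
have B2_ge : L * 3 / 5 * A2 <= B2.
  rewrite /B2 /A2 -(RintegralZl _ mD (iM bg2)).
  apply: (le_Rintegral mD (integrable_onZ mD _ (iM bg2)) (iM (bounded_id bg2))) => t _.
  rewrite [leRHS]mulrC; have [->|/supp2 /andP[let_ _]] := eqVneq (g2 t) 0; first by rewrite !mulr0.
  by rewrite ler_wpM2r//; have [->|->] := g2_01 t.
(* Equal masses with different centres make this moment determinant positive. *)
pose Delta := A1 * B2 - A2 * B1.
have Delta0 : Delta != 0.
  rewrite gt_eqF// /Delta A1E A2E -mulrBr mulr_gt0//; first by lra.
  rewrite A1E in B1_le; rewrite A2E in B2_ge.
  have := mulr_gt0 L0 L0; lra.
exists ((B2 * w1 - B1 * w2) / Delta), ((A1 * w2 - A2 * w1) / Delta).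
move=> c d M g c0 cL Ld dL mg gM gcd.
have bg : bounded_measurable g by split => //; exists M.
set m0 := \int[mu]_(t in D) g t; set m1 := \int[mu]_(t in D) (g t * t).
have [x [y [x0 x1 xw]]] : exists x y, [/\ m0 = x * A1 + y * A2, m1 = x * B1 + y * B2 &
    x * w1 + y * w2 = (B2 * w1 - B1 * w2) / Delta * m0 + (A1 * w2 - A2 * w1) / Delta * m1].
  exists ((m0 * B2 - m1 * A2) / Delta), ((m1 * A1 - m0 * B1) / Delta).
  by split; rewrite /Delta; field; exact: Delta0.
pose h t := g t - (x * g1 t + y * g2 t).
have bh : bounded_measurable h := bounded_combination x y bg bg1 bg2.
have := @W_orthogonal c d (M + (`|x| + `|y|)) h c0 _ dL.
have -> : \int[mu]_(t in D) h t = 0.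
  rewrite /h (integral_combination x y (iM bg) (iM bg1) (iM bg2)) -/A1 -/A2 -/m0.
  by rewrite x0 subrr.
have -> : \int[mu]_(t in D) (h t * t) = 0.
  transitivity (\int[mu]_(t in D) (g t * t - (x * (g1 t * t) + y * (g2 t * t)))).
    by apply: eq_Rintegral => t _; rewrite /h; ring.
  rewrite (integral_combination x y (iM (bounded_id bg)) (iM (bounded_id bg1)) (iM (bounded_id bg2))).
  by rewrite -/B1 -/B2 -/m1 x1 subrr.
have -> : \int[mu]_(t in D) (W t * h t) = \int[mu]_(t in D) (W t * g t) - (x * w1 + y * w2).
  rewrite -(integral_combination x y (iWM bg) (iWM bg1) (iWM bg2)); apply: eq_Rintegral => t _.
  by rewrite /h; ring.
move=> H; have {}H : \int[mu]_(t in D) (W t * g t) - (x * w1 + y * w2) = 0.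
  apply: H => //; first by lra.
  - by case: bh.
  - move=> t; apply: le_trans (ler_normB _ _) _; apply: lerD => //.
    apply: le_trans (ler_normD _ _) _; apply: lerD; rewrite normrM ler_piMr//.
      by have [->|->] := g1_01 t; rewrite ?normr0// normr1.
    by have [->|->] := g2_01 t; rewrite ?normr0// normr1.
  - move=> t; apply: contra_neqT => tcd.
    have z (f : R -> R) : (f t != 0 -> c <= t <= d) -> f t = 0.
      by move=> H; apply/eqP; apply: contraNT tcd => /H.
    have gt0 : g t = 0 by apply: z; exact: gcd.
    have g1t0 : g1 t = 0 by apply: z => /supp1 /andP[h1 h2]; apply/andP; split; lra.
    have g2t0 : g2 t = 0 by apply: z => /supp2 /andP[h1 h2]; apply/andP; split; lra.
    by rewrite /h gt0 g1t0 g2t0 !mulr0 addr0 subr0.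
by move/eqP: H; rewrite subr_eq0 xw => /eqP.
Qed.

(** Testing with the sign of the deviation [Y] on [c, d] shows that the integral of |Y| over [c, d]
    is zero; these intervals exhaust the open edge. *)
Lemma du_bois_reymond : exists al be : R,
  {ae mu, forall t, D t -> W t = al + be * t}.
Proof.
have [al [be H]] := orthogonal_to_affine; have L0' := L0.
exists al, be.
have /integrableP[mW _] := iW.
have {}mW : measurable_fun D W by exact/measurable_EFinP.
pose Y t := W t - (al + be * t).
have mY : measurable_fun D Y.
  by apply: measurable_funB => //; apply: measurable_funD => //; exact: measurable_funM.
have key c d : 0 < c -> c <= L / 5 -> L * 4 / 5 <= d -> d < L ->
    {ae mu, forall t, `[c, d]%classic t -> Y t = 0}.
  move=> c0 cL Ld dL.
  have mcd : measurable (`[c, d]%classic : set (measurableTypeR R)) by exact: measurable_itv.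
  have cdD : `[c, d]%classic `<=` D.
    by move=> t; rewrite /D /= !in_itv /= => /andP[h1 h2]; apply/andP; split; lra.
  have mYcd : measurable_fun `[c, d] Y by apply: measurable_funS mY.
  pose Y' := Y \_ `[c, d]; have mY' : measurable_fun setT Y' by apply/(measurable_restrictT _ mcd).
  pose g t : R := if 0 < Y' t then 1 else if Y' t < 0 then -1 else 0.
  have mg : measurable_fun setT g.
    apply: measurable_fun_ifT; [exact: measurable_fun_ltr|exact: measurable_cst|].
    by apply: measurable_fun_ifT; [exact: measurable_fun_ltr|exact: measurable_cst|exact: measurable_cst].
  have gM t : `|g t| <= 1.
    rewrite /g; case: ifP => _; first by rewrite normr1.
    by case: ifP => _; rewrite ?normrN ?normr1 ?normr0.
  have gY' t : g t * Y' t = `|Y' t|.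
    rewrite /g; case: (ltgtP (Y' t) 0) => [lt0|gt0|->] /=.
    - by rewrite mulN1r ltr0_norm.
    - by rewrite mul1r gtr0_norm.
    - by rewrite mul0r normr0.
  have gcd t : g t != 0 -> c <= t <= d.
    rewrite /g /Y' /patch; case: (boolP (t \in _)) => [|_]; first by rewrite inE /= in_itv.
    by rewrite ltxx eqxx.
  have gYE t : W t * g t - (al * g t + be * (g t * t)) = `|Y' t|.
    rewrite -gY' /Y' /patch; case: ifPn => [_|]; first by rewrite /Y; ring.
    rewrite notin_setE /= in_itv /= => tcd; suff -> : g t = 0 by ring.
    by apply/eqP/negPn/negP => /gcd.
  have bg : bounded_measurable g by split => //; exists 1.
  have int0 : \int[mu]_(t in D) `|Y' t| = 0.
    transitivity (\int[mu]_(t in D) (W t * g t - (al * g t + be * (g t * t)))).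
      by apply: eq_Rintegral => t _; rewrite gYE.
    rewrite (integral_combination al be (iWM bg) (iM bg) (iM (bounded_id bg))).
    by rewrite (H c d 1)// subrr.
  have iY' : mu.-integrable D (EFin \o (fun t => `|Y' t|)).
    rewrite (_ : (fun t => _) = (fun t => W t * g t + (- 1) * (al * g t + be * (g t * t)))).
      apply: integrable_onD => //; [exact: iWM|apply: integrable_onZ => //].
      by apply: integrable_onD => //; apply: integrable_onZ => //; apply: iM => //; exact: bounded_id.
    by apply/funext => t; rewrite -gYE mulN1r.
  have eint0 : (\int[mu]_(t in D) `|(Y' t)%:E| = 0)%E.
    have := integrable_fin_num mD iY'; rewrite /= => fin_int.
    by rewrite -[LHS](fineK fin_int); congr EFin; exact: int0.
  have mY'D : measurable_fun D (EFin \o Y').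
    by apply/measurable_EFinP; exact: measurable_funS mY'.
  have /(ae_eq_integral_abs mu mD mY'D) := eint0.
  apply: filterS => t Yt tcd; have := Yt (cdD _ tcd).
  by rewrite /= /Y' /patch mem_set// => -[].
(* Tends to 0 and never exceeds L / 5, as [key] requires. *)
pose c (k : nat) : R := L / 5 / k.+1%:R.
have c0 k : 0 < c k by rewrite !divr_gt0.
have cL k : c k <= L / 5.
  by rewrite ler_pdivrMr// ler_peMr ?ler1n//; lra.
have keyk k : {ae mu, forall t, `[c k, L - c k]%classic t -> Y t = 0}.
  by apply: key => //; have := c0 k; have := cL k; lra.
have ne (a : R) : {ae mu, forall x, x != a}.
  exists [set a]; split; [exact: measurable_set1|exact: lebesgue_measure_set1|].
  by move=> x /= /negP; rewrite negbK => /eqP.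
have := ae_foralln keyk; have := ne 0; have := ne L; apply: filterS3 => t tL t0 Yk.
rewrite /D /= in_itv /= => /andP[h0 hL].
have {}h0 : 0 < t by rewrite lt_neqAle eq_sym t0.
have {}hL : 0 < L - t by rewrite subr_gt0 lt_neqAle tL.
have [k kP] : exists k, c k <= Num.min t (L - t).
  have m0 : 0 < Num.min t (L - t) by rewrite lt_min h0.
  exists (Num.trunc (L / 5 / Num.min t (L - t))).
  rewrite /c ler_pdivrMr// [leRHS]mulrC -ler_pdivrMr//; apply: ltW; exact: truncnS_gt.
move: kP; rewrite le_min => /andP[k1 k2]; apply/eqP; rewrite -subr_eq0.
by apply/eqP; apply: (Yk k); rewrite /= in_itv /= k1 lerBrDl -lerBrDr.
Qed.

End du_bois_reymond.

(** * The Euler-Lagrange equations *)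

Section necessity.
Variables (R : realType) (n : nat) (V : 'I_n -> R * R) (z : 'I_n -> R).
Variables (T : {set {set 'I_n}}) (p : R) (F : R * R -> R).
Hypothesis V_inj : injective V.
Hypothesis T_triangulation : triangulation V T.
Hypothesis p1 : 1 < p.
Hypothesis sF : smooth_interpolant V z T p F.
Hypothesis minF : forall F', smooth_interpolant V z T p F' -> energy V T p F <= energy V T p F'.
Let mu : {measure set (measurableTypeR R) -> \bar R} := @lebesgue_measure R.
Local Notation D2 F := (second_derivative (induced_network V F)).

Lemma minimal_edge_affine e : e \in edges T -> exists al be : R,
  {ae mu, forall t, edge_itv V e t -> signed_pow (D2 F e t) (p - 1) = al + be * t}.
Proof.
move=> eT; have L0 := edge_length_gt0 V_inj eT.
apply: du_bois_reymond L0 _ _.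
  have := signed_pow_integrableM (measurable_edge_itv V e) (edge_itv_finite V e) p1
    (smooth_interpolant_Lp V_inj p1 sF eT) (@measurable_cst _ _ _ _ _ (1 : R)) (M := 1).
  under [X in EFin \o X]eq_fun do rewrite mulr1.
  by apply => t _; rewrite normr1.
move=> c d M g c0 cd dL mg gM gcd g0 g1.
have [P aP] := edge_variation V_inj T_triangulation eT c0 cd dL mg gM gcd g0 g1.
have := first_variation_eq0 V_inj p1 sF minF aP.
rewrite (bigD1 e)//= eqxx [X in _ + X]big1 ?addr0// => e' /andP[_ /negbTE ->].
under eq_Rintegral do rewrite mulr0.
by rewrite Rintegral_cst ?mul0r//; exact: measurable_edge_itv.
Qed.

Lemma minimal_affine_network : exists w : 'I_n -> 'I_n -> R, forall e, e \in edges T ->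
  {ae mu, forall t, edge_itv V e t ->
    signed_pow (D2 F e t) (p - 1) = affine_network V w e t}.
Proof.
have /choice[c cP] e : exists c : R * R, e \in edges T ->
    {ae mu, forall t, edge_itv V e t -> signed_pow (D2 F e t) (p - 1) = c.1 + c.2 * t}.
  have [eT|] := boolP (e \in edges T); last by exists 0.
  by have [al [be H]] := minimal_edge_affine eT; exists (al, be).
(* An edge is parametrized from its smaller end: the value there is the constant term, and the value
   at the larger end is taken at the edge length. *)
exists (fun i j : 'I_n => if (i < j)%N then (c (i, j)).1
                   else (c (j, i)).1 + (c (j, i)).2 * edge_length V (j, i)).
move=> e eT; have := cP e eT; apply: filterS => t H /H ->.
have := eT; rewrite inE => /andP[e12 _]; have L0 := edge_length_gt0 V_inj eT.
rewrite /affine_network e12 ltnNge (ltnW e12) /= -surjective_pairing.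
by field; rewrite gt_eqF.
Qed.

End necessity.

(** * Test functions at a vertex *)

Section vertex_variations.
Variables (R : realType) (n : nat) (V : 'I_n -> R * R) (T : {set {set 'I_n}}).
Hypothesis V_inj : injective V.

Lemma abs_continuous_horner (a b : R) (q : {poly R}) : a <= b -> abs_continuous a b (horner q).
Proof.
move=> ab; have cq : {within `[a, b], continuous (fun t => `|q^`().[t]|)}.
  by apply: continuous_subspaceT => t; apply: cvg_norm; exact: continuous_horner.
have [c _ cmax] := EVT_max ab cq.
apply: (lipschitz_abs_continuous (C := `|q^`().[c]|)) => x y ax xy yb.
apply: (@derivative_on_lipschitz _ a b _ _ (horner q^`()) _ _ x y) => //.
by apply: derivative_on_derive => t; exact: is_derive_poly.
Qed.

(** Polynomial profiles give absolute continuity and bounded second derivatives on all edges at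
    once. *)
Lemma edge_polynomial_variation (P : R * R -> R) (G : R * R -> R * R) :
  (forall i, P (V i) = 0) -> C1_gradient P G ->
  (forall e, exists q : {poly R}, forall t, P (edge_point V e t) = q.[t]) ->
  exists b, admissible_variation V T P b.
Proof.
move=> PV C1P /choice[q qP].
exists (fun e => horner (q e)^`()^`()).
have prof e : e \in edges T -> edge_regular V P e /\ forall t, 0 < t < edge_length V e ->
    second_derivative (induced_network V P) e t = (q e)^`()^`().[t].
  move=> eT; have L0 := ltW (edge_length_gt0 V_inj eT).
  have [Preg D2P] := edge_regular_profile (fun t _ => qP e t)
    (fun t => is_derive_poly (q e) t) (abs_continuous_horner (q e)^`() L0).
  by split => // t tL; rewrite D2P// -derivE.
split => //.
- by have [H1 H2] := C1_gradient_on (domain V T) C1P; exists G.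
- by move=> e /prof[].
- move=> e eT; have L0 := ltW (edge_length_gt0 V_inj eT).
  have cq : continuous (horner (q e)^`()^`()) by exact: continuous_horner.
  split.
  + by apply: measurable_funTS; exact: continuous_measurable_fun.
  + have cqn : {within `[0, edge_length V e], continuous (fun t => `|(q e)^`()^`().[t]|)}.
      by apply: continuous_subspaceT => t; apply: cvg_norm; exact: cq.
    by have [c _ cmax] := EVT_max L0 cqn; exists `|(q e)^`()^`().[c]|.
  + by have := ae_edge_itv (prof e eT).2.
Qed.

Lemma edge_polynomial_affine (a b c : R) e : exists q : {poly R}, forall t,
  a * (edge_point V e t).1 + b * (edge_point V e t).2 + c = q.[t].
Proof.
exists ((a * (V e.1).1 + b * (V e.1).2 + c)%:P +
  (a * (unit_dir V e.1 e.2).1 + b * (unit_dir V e.1 e.2).2)%:P * 'X) => t.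
rewrite edge_pointE !(hornerD, hornerM, hornerC, hornerX).
by move: (unit_dir V e.1 e.2) => u; rewrite [(_, _).1]/= [(_, _).2]/=; ring.
Qed.

(* The product of an affine function vanishing at [V i] and of the squares of affine functions
   vanishing at the other vertices has a gradient that is nonzero at [V i] only. *)
Lemma vertex_variation (i : 'I_n) (a b : R) : exists P G r,
  [/\ exists h, admissible_variation V T P h, gradient_on (domain V T) P G, r != 0,
      G (V i) = (r * a, r * b) & forall j, j != i -> G (V j) = (0, 0)].
Proof.
pose A a b c (v : R * R) : R := a * v.1 + b * v.2 + c.
(* Vanishes at [V k] and takes at [V i] the squared distance of the two points. *)
pose f k := A ((V i).1 - (V k).1) ((V i).2 - (V k).2)
  (- (((V i).1 - (V k).1) * (V k).1 + ((V i).2 - (V k).2) * (V k).2)).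
have fE k v : f k v = ((V i).1 - (V k).1) * (v.1 - (V k).1) + ((V i).2 - (V k).2) * (v.2 - (V k).2).
  by rewrite /f /A; ring.
pose Q v := \prod_(k | k != i) f k v.
pose l := A a b (- (a * (V i).1 + b * (V i).2)).
have [GQ C1Q] : exists G, C1_gradient Q G.
  rewrite /Q; elim: (index_enum _) => [|k s [G IH]].
    exists (fun=> (0, 0)); have := C1_affine (0 : R) 0 1; congr C1_gradient.
    by apply/funext => v; rewrite big_nil !mul0r !add0r.
  have [ki|ki] := boolP (k != i); last first.
    by exists G; move: IH; congr C1_gradient; apply/funext => v; rewrite big_cons (negbTE ki).
  eexists; have := C1_mul (C1_affine _ _ _ : C1_gradient (f k) _) IH; congr C1_gradient.
  by apply/funext => v; rewrite big_cons ki.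
have polyQ e : exists q : {poly R}, forall t, Q (edge_point V e t) = q.[t].
  rewrite /Q; elim: (index_enum _) => [|k s [q IH]].
    by exists 1 => t; rewrite big_nil hornerE.
  have [ki|ki] := boolP (k != i); last first.
    by exists q => t; rewrite big_cons (negbTE ki).
  have [q' q'P] := edge_polynomial_affine ((V i).1 - (V k).1) ((V i).2 - (V k).2)
    (- (((V i).1 - (V k).1) * (V k).1 + ((V i).2 - (V k).2) * (V k).2)) e.
  by exists (q' * q) => t; rewrite big_cons ki IH hornerM -q'P.
have Q0 j : j != i -> Q (V j) = 0.
  by move=> ji; rewrite /Q (bigD1 j)//= fE !subrr !mulr0 addr0 mul0r.
have Qi : Q (V i) != 0.
  apply/prodf_neq0 => k ki; rewrite fE -!expr2 paddr_eq0 ?sqr_ge0// !sqrf_eq0 !subr_eq0.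
  apply: contraNN ki => /andP[/eqP e1 /eqP e2]; apply/eqP/V_inj/esym.
  by rewrite [LHS]surjective_pairing e1 e2 -surjective_pairing.
have li : l (V i) = 0 by rewrite /l /A subrr.
have C1P := C1_mul (C1_affine a b _ : C1_gradient l _) (C1_mul C1Q C1Q).
set G := (X in C1_gradient _ X) in C1P.
(* Every term contains Q, which vanishes at the other vertices; at [V i], where l vanishes, only Q^2
   (a, b) remains. *)
have GE v : G v = (l v * (Q v * (GQ v).1 + Q v * (GQ v).1) + Q v * Q v * a,
                   l v * (Q v * (GQ v).2 + Q v * (GQ v).2) + Q v * Q v * b) by [].
exists (fun w => l w * (Q w * Q w)), G, (Q (V i) * Q (V i)); split; last 1 first.
- by move=> j ji; rewrite GE Q0// !mul0r !addr0 mulr0.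
- apply: edge_polynomial_variation C1P _.
    move=> j; have [->|ji] := eqVneq j i; first by rewrite li mul0r.
    by rewrite Q0// mul0r mulr0.
  move=> e; have [q qP] := polyQ e.
  have [q' q'P] := edge_polynomial_affine a b (- (a * (V i).1 + b * (V i).2)) e.
  by exists (q' * (q * q)) => t; rewrite !hornerM -q'P qP.
- by have [] := C1_gradient_on (domain V T) C1P.
- by rewrite mulf_neq0.
- by rewrite GE li !mul0r !add0r.
Qed.

End vertex_variations.

Section euler_lagrange.
Variables (R : realType) (n : nat) (V : 'I_n -> R * R) (z : 'I_n -> R).
Variables (T : {set {set 'I_n}}) (p q : R).
Hypothesis V_inj : injective V.
Hypothesis p1 : 1 < p.
Hypothesis qp : (q - 1) * (p - 1) = 1.
Let mu : {measure set (measurableTypeR R) -> \bar R} := @lebesgue_measure R.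
Local Notation D2 F := (second_derivative (induced_network V F)).

(** Equilibrium of end values at every vertex, which makes their pairing with any gradient there
    vanish. *)
Definition balanced (w : 'I_n -> 'I_n -> R) : Prop := forall i,
  \sum_(j in neighbours T i) w i j * (unit_dir V i j).1 = 0 /\
  \sum_(j in neighbours T i) w i j * (unit_dir V i j).2 = 0.

Lemma measurable_affine_network w e : measurable_fun (edge_itv V e) (affine_network V w e).
Proof.
by apply: measurable_funD; apply: measurable_funM => //;
  [apply: measurable_funB => //|]; exact: measurable_funM.
Qed.

Lemma affine_network_bounded w e : e \in edges T ->
  exists M, forall t, edge_itv V e t -> `|affine_network V w e t| <= M.
Proof.
move=> eT; have L0 := edge_length_gt0 V_inj eT.
exists (`|w e.1 e.2| + `|w e.2 e.1|) => t; rewrite /edge_itv /= in_itv /= => /andP[t0 tL].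
have x0 : 0 <= t / edge_length V e by rewrite divr_ge0// ltW.
have x1 : t / edge_length V e <= 1 by rewrite ler_pdivrMr// mul1r.
rewrite (le_trans (ler_normD _ _))// lerD// normrM ler_piMr//.
  by rewrite ger0_norm ?subr_ge0// gerBl.
by rewrite ger0_norm.
Qed.

Lemma minimal_balanced F w : triangulation V T -> smooth_interpolant V z T p F ->
  (forall F', smooth_interpolant V z T p F' -> energy V T p F <= energy V T p F') ->
  (forall e, e \in edges T -> {ae mu, forall t, edge_itv V e t ->
    signed_pow (D2 F e t) (p - 1) = affine_network V w e t}) ->
  balanced w.
Proof.
move=> T_triangulation sF minF Fw i.
have key a b : \sum_(j in neighbours T i)
    w i j * (a * (unit_dir V i j).1 + b * (unit_dir V i j).2) = 0.
  have [P [G [r [[h aP] PG r0 Gi Gj]]]] := vertex_variation T V_inj i a b.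
  have [PV _ Preg Ph] := aP.
  have := integral_second_derivative_affine w V_inj PG Preg.
  rewrite [X in _ - X]big1 ?subr0; last by move=> e _; rewrite !PV subrr mulr0.
  have -> : \sum_(e in edges T) \int[@lebesgue_measure R]_(t in `[0, edge_length V e])
      (D2 P e t * affine_network V w e t) = 0.
    rewrite -[RHS](first_variation_eq0 V_inj p1 sF minF aP); apply: eq_bigr => e eT.
    have [mh _ Pe] := Ph e eT.
    have mF : measurable_fun (edge_itv V e) (fun t => signed_pow (D2 F e t) (p - 1)).
      have mD2 := measurable_D2 V_inj eT (smooth_interpolant_regular sF eT).
      apply: (measurableT_comp (f := signed_pow (R := R) ^~ (p - 1))) => //.
      by apply: continuous_measurable_fun; apply: continuous_signed_pow; rewrite subr_gt0.
    apply: (ae_eq_Rintegral (measurable_edge_itv V e)).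
    - apply: measurable_funM; last exact: measurable_affine_network.
      exact: (measurable_D2 V_inj eT (Preg e eT)).
    - exact: measurable_funM.
    - have := Fw e eT; have := Pe; apply: filterS2 => t H1 H2 Et.
      by rewrite (H1 Et) (H2 Et) mulrC.
  (* The gradient is nonzero at [V i] only, where it is r (a, b) with r nonzero. *)
  rewrite (bigD1 i)//= [X in _ + X]big1 ?addr0; last first.
    by move=> j ji; rewrite Gj// big1// => k _; rewrite !mul0r addr0 mulr0.
  rewrite Gi => /esym/eqP; rewrite oppr_eq0 => /eqP H; apply: (mulfI r0).
  rewrite mulr0 -[RHS]H mulr_sumr; apply: eq_bigr => j _ /=.
  by move: (unit_dir V i j) => u; ring.
split.
  rewrite -[RHS](key 1 0); apply: eq_bigr => j _.
  by move: (unit_dir V i j) => u; ring.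
rewrite -[RHS](key 0 1); apply: eq_bigr => j _.
by move: (unit_dir V i j) => u; ring.
Qed.

(* By [integral_second_derivative_affine], the pairing of F'' with a balanced network depends
   only on the values of F at the vertices. *)
Lemma balanced_minimal F0 w F : balanced w ->
  smooth_interpolant V z T p F0 -> smooth_interpolant V z T p F ->
  (forall e, e \in edges T -> {ae mu, forall t, edge_itv V e t ->
    D2 F0 e t = signed_pow (affine_network V w e t) (q - 1)}) ->
  energy V T p F0 <= energy V T p F.
Proof.
move=> bal sF0 sF F0w; have p0 := lt_trans ltr01 p1.
have pairing F1 : smooth_interpolant V z T p F1 ->
    \sum_(e in edges T) \int[mu]_(t in edge_itv V e) (D2 F1 e t * affine_network V w e t) =
    - \sum_(e in edges T) (w e.2 e.1 - w e.1 e.2) / edge_length V e * (z e.2 - z e.1).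
  move=> sF1; have [F1z [G F1G _] _] := sF1.
  have := integral_second_derivative_affine w V_inj F1G
    (fun e eT => smooth_interpolant_regular sF1 eT).
  rewrite [X in - X - _]big1 => [->|i _]; last first.
    have [b1 b2] := bal i.
    under eq_bigr do rewrite mulrDr [_ * ((G (V i)).1 * _)]mulrCA [_ * ((G (V i)).2 * _)]mulrCA.
    by rewrite big_split /= -!mulr_sumr b1 b2 !mulr0 addr0.
  by rewrite oppr0 sub0r; congr (- _); apply: eq_bigr => e _; rewrite !F1z.
(* Adds p times zero, written as the difference of the equal pairings of F and F0, after which the
   inequality holds edge by edge. *)
rewrite -[leLHS]addr0 -(mulr0 p) -[X in p * X](subrr
  (\sum_(e in edges T) \int[mu]_(t in edge_itv V e) (D2 F e t * affine_network V w e t))).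
rewrite {2}(pairing _ sF) -(pairing _ sF0) /energy -sumrB mulr_sumr -big_split /=.
apply: ler_sum => e eT; have [M wM] := affine_network_bounded w eT.
exact: (integral_powR_ge (measurable_edge_itv V e) (edge_itv_finite V e) p1 qp
  (smooth_interpolant_Lp V_inj p1 sF0 eT) (smooth_interpolant_Lp V_inj p1 sF eT)
  (@measurable_affine_network w e) wM (F0w e eT)).
Qed.

End euler_lagrange.

Unset Implicit Arguments.
Set Strict Implicit.
Set Printing Implicit Defensive.

Theorem theorem2 (R : realType) (n : nat) (V : 'I_n -> R * R) (z : 'I_n -> R)
    (T : {set {set 'I_n}}) (nb : 'I_n -> seq 'I_n) (p q : R)
    (Fstar : network R n)
    (n_ge3 : (3 <= n)%N)
    (V_inj : injective V)
    (V_not_collinear : ~ collinear V [set: 'I_n]%SET)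
    (T_triangulation : triangulation V T)
    (nb_clockwise : clockwise_listing V T nb)
    (nb_admissible : admissible_first_edges V T nb)
    (p_gt1 : 1 < p)
    (pq_conj : 1 / p + 1 / q = 1)
    (Fstar_smooth : smooth_network V z T p Fstar) :
  network_norm V T p (second_derivative Fstar) =
    ereal_inf [set network_norm V T p (second_derivative F)
              | F in smooth_network V z T p]
  <->
  exists alpha : 'I_n -> nat -> R,
    forall e, e \in edges T ->
      {ae @lebesgue_measure R, forall t, 0 <= t <= edge_length V e ->
        second_derivative Fstar e t =
        signed_pow (\sum_(i < n) \sum_(s < degree T i - 2)
                      alpha i s * basic_network V nb i s e t) (q - 1)}.
Proof.
have p0 : p != 0 by rewrite gt_eqF// (lt_trans _ p_gt1).
(* For q = 0 the convention 1 / 0 = 0 would give p = 1. *)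
have q0 : q != 0.
  apply/eqP => q0; move: pq_conj p_gt1; rewrite q0 invr0 mulr0 addr0 mul1r => pV.
  by rewrite -[p]invrK pV invr1 ltxx.
have pqE : p + q = p * q.
  have <- : (1 / p + 1 / q) * (p * q) = p * q by rewrite pq_conj mul1r.
  by field; rewrite p0 q0.
have qp : (q - 1) * (p - 1) = 1.
  by transitivity (p * q - (p + q) + 1); [ring|rewrite pqE subrr add0r].
have pq : (p - 1) * (q - 1) = 1 by rewrite mulrC.
have [F0 sF0 FstarE] := Fstar_smooth.
rewrite (minimal_energyP V_inj p_gt1 sF0 FstarE).
have second_derivativeE e : e \in edges T -> {ae @lebesgue_measure R, forall t,
    edge_itv V e t -> second_derivative Fstar e t = second_derivative (induced_network V F0) e t}.
  move=> eT; apply: ae_edge_itv => t; apply: second_derivative_induced => s.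
  exact: FstarE.
(* End values on the edges of the combination of basic networks. *)
pose coef (alpha : 'I_n -> nat -> R) i j :=
  \sum_(s < degree T i - 2) alpha i s * lambda_coef V nb i s j.
have combinationE (alpha : 'I_n -> nat -> R) e t : e \in edges T ->
    \sum_(i < n) \sum_(s < degree T i - 2) alpha i s * basic_network V nb i s e t =
    affine_network V (coef alpha) e t.
  by move=> eT; rewrite (basic_network_combination nb alpha (fun i => degree T i - 2)%N t V_inj eT).
split=> [minF|[alpha alphaE] F sF].
  have [w wE] := minimal_affine_network V_inj T_triangulation p_gt1 sF0 minF.
  have bal := minimal_balanced V_inj p_gt1 T_triangulation sF0 minF wE.
  have /choice[alpha alphaE] i : exists al : nat -> R, forall j, j \in neighbours T i ->
      w i j = \sum_(s < degree T i - 2) al s * lambda_coef V nb i s j.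
    have [b1 b2] := bal i.
    exact: (vertex_relations_spanned V_inj nb_clockwise nb_admissible T_triangulation b1 b2).
  exists alpha => e eT.
  have := wE e eT; have := second_derivativeE e eT; apply: filterS2 => t H1 H2 tL.
  have Et : edge_itv V e t by rewrite /edge_itv /= in_itv.
  have e12 : e.2 \in neighbours T e.1 by rewrite inE (edges_edge eT).
  have e21 : e.1 \in neighbours T e.2 by rewrite inE edgeC (edges_edge eT).
  rewrite (H1 Et) (combinationE _ _ _ eT).
  have -> : affine_network V (coef alpha) e t = affine_network V w e t.
    by rewrite /affine_network (alphaE _ _ e12) (alphaE _ _ e21).
  (* The signed power q - 1 inverts the signed power p - 1 and recovers F''. *)
  rewrite -(H2 Et); exact/esym/(signed_powK pq).
apply: (balanced_minimal (w := coef alpha) V_inj p_gt1 qp _ sF0 sF).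
  by move=> i; exact: (lambda_coef_relation V_inj nb_clockwise i (alpha i)).
move=> e eT; have := alphaE e eT; have := second_derivativeE e eT.
apply: filterS2 => t H1 H2 Et; have := Et; rewrite /edge_itv /= in_itv /= => tL.
by rewrite -(H1 Et) (H2 tL) (combinationE _ _ _ eT).
Qed.
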